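(* Let $V$ be a real vector space of dimension $n$, $L\subset V$ a lattice of rank $n$, $p$ a prime, and $1\le k\le n-1$. Let $P$ be a nonsingular $n$-dimensional lattice polytope with respect to $L$. Let $f$ be a face of $P$ and let $\pi=(\pi(F))_{F\supseteq f}$ assign a positive integer to each facet $F$ of $P$ containing $f$, with $\sum_{F\supseteq f}\pi(F)=l$. Then \[ \sum_{M\in\mathscr{L}_k}A_M(f,\pi)\,\partial_f^{\pi}\operatorname{Vol}_M P^{M}(h)\Bigr|_{h=0}=\nu_{n,k,n-l}(p)\,A_L(f,\pi)\,\partial_f^{\pi}\operatorname{Vol}_L P^{L}(h)\Bigr|_{h=0}. \]
   Context: A lattice polytope $P$ w.r.t. $L$ is a full-dimensional convex polytope with vertices in $L$; it is simple if each vertex lies on exactly $n$ edges, and nonsingular if at each vertex the primitive lattice vectors along the $n$ edges form a $\mathbb{Z}$-basis of $L$. For a lattice $L\subsetneq M\subsetneq p^{-1}L$ let $\overline M=M/L\subset p^{-1}L/L\cong\mathbb{F}_p^n$, and let $\mathscr{L}_k$ be the set of such $M$ with $\dim\overline M=k$. For $0\le j\le n$, $\nu_{n,k,j}(p)=\sum_{W\subset\mathbb{F}_p^n,\ \dim W=k}p^{\dim(W\cap U)}$ for any fixed $j$-dimensional $U\subset\mathbb{F}_p^n$. For a lattice $N$ (here $N=L$ or $N\in\mathscr{L}_k$; $P$ has vertices in $N$ since $L\subset N$) let $N^*\subset V^*$ be the dual lattice. For each facet $F$ of $P$, let $u_F^N\in N^*$ be the primitive inward normal of $F$ and $\lambda_F^N$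 the number with $F\subset\{x:\langle u_F^N,x\rangle+\lambda_F^N=0\}$. For real variables $h=(h_F)_F$ indexed by facets, $P^N(h)=\{x:\langle u_F^N,x\rangle+\lambda_F^N+h_F\ge0\ \forall F\}$, and $\operatorname{Vol}_N$ is Lebesgue measure normalized so that a fundamental domain of $N$ has volume $1$; for small $h$, $\operatorname{Vol}_N P^N(h)$ is a polynomial in $h$. The operator $\partial_f^\pi=\prod_{F\supseteq f}(\partial/\partial h_F)^{\pi(F)}$. For $a\in\mathbb{C}$ define numbers $c(a,m)$ by the formal expansion $\frac{x}{1-a e^{-x}}=\sum_{m\ge0}c(a,m)x^m$. Let $\Gamma^N_f$ be the set of $g\in N^*$ of the form $g=\sum_{F\supseteq f}\rho_F u_F^N$ with $0\le\rho_F<1$ (the $u_F^N$, $F\supseteq f$, are linearly independent since $P$ is simple), and for such $g$ put $a_F(g)=\exp(2\pi i\rho_F)$. Define \[ A_N(f,\pi)=\sum_{g\in\Gamma^N_f}\prod_{F\supseteq f}c\bigl(a_F(g),\pi(F)\bigr). \] The facets and faces of $P$ are the same whether $P$ is regarded w.r.t. $L$ or $M$, so the variables $h_F$ and the face $f$ are common to all terms. *)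

(* Defs.v *)
From HB Require Import structures.
From mathcomp Require Import all_boot all_order all_algebra.
From mathcomp Require Import all_classical all_reals all_analysis.
From mathcomp Require Import complex.

Set Implicit Arguments.
Unset Strict Implicit.
Unset Printing Implicit Defensive.

Import Order.TTheory GRing.Theory Num.Theory.
Local Open Scope classical_set_scope.
Local Open Scope ring_scope.

Section Defs.
Variables (R : realType) (n : nat).
Local Notation V := 'rV[R]_n.

(** Pairing between V and V^* (V^* identified with row vectors). *)
Definition dotp (x u : V) : R := (x *m u^T) 0 0.

Definition intvec (c : 'rV[int]_n) : V := map_mx (fun z : int => z%:~R) c.

Definition lattice_of (B : 'M[R]_n) : set V := [set intvec c *m B | c in [set: 'rV[int]_n]].

Definition is_lattice (N : set V) : Prop :=
  exists2 B : 'M[R]_n, B \in unitmx & N = lattice_of B.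

Definition lattice_basis (N : set V) : 'M[R]_n :=
  xget 0 [set B | B \in unitmx /\ N = lattice_of B].

Definition dual_lattice (N : set V) : set V :=
  [set u | forall x, N x -> dotp x u \is a Num.int].

Definition primitive (N : set V) (u : V) : Prop :=
  [/\ N u, u != 0 & forall (v : V) (m : nat), N v -> u = m%:R *: v -> m = 1%N].

(** Lebesgue volume on V = R^n, as the iterated Lebesgue integral of the
    indicator function over the n coordinates. *)
Fixpoint iint (k : nat) (g : seq R -> R) : R :=
  match k with
  | 0 => g [::]
  | k'.+1 => Rintegral (@lebesgue_measure R) setT
               (fun t => iint k' (fun s => g (t :: s)))
  end.

Definition vol (S : set V) : R :=
  iint n (fun s => if `[< S (\row_i nth 0 s i) >] then 1 else 0).

Definition fund_domain (N : set V) : set V :=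
  [set t *m lattice_basis N | t in [set t : V | forall i, 0 <= t 0 i < 1]].

Definition VolN (N : set V) (S : set V) : R := vol S / vol (fund_domain N).

Definition conv (vs : seq V) : set V :=
  [set x | exists w : 'I_(size vs) -> R,
     [/\ forall i, 0 <= w i, \sum_i w i = 1 & x = \sum_i w i *: vs`_i]].

Definition lattice_polytope (N : set V) (P : set V) : Prop :=
  (exists vs : seq V, (forall i, (i < size vs)%N -> N vs`_i) /\ P = conv vs)
  /\ (exists (x : V) (e : R), 0 < e /\
        forall y : V, (forall i, `|y 0 i - x 0 i| < e) -> P y).

Definition face (P F : set V) : Prop :=
  F !=set0 /\ F `<=` P /\
  (F = P \/ exists (u : V) (c : R), u != 0 /\ (forall x, P x -> c <= dotp x u)
                             /\ F = [set x | P x /\ dotp x u = c]).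

(** facets: proper faces of dimension n-1 (containing n affinely independent
    points) *)
Definition facet (P F : set V) : Prop :=
  face P F /\ F <> P /\
  exists (x0 : V) (X : 'M[R]_(n.-1, n)),
    [/\ F x0, forall i, F (x0 + row i X) & \rank X = n.-1].

Definition vertex (P : set V) (v : V) : Prop := face P [set v].

Definition segment (a b : V) : set V :=
  [set (1 - t) *: a + t *: b | t in `[0, 1]%classic].

Definition edge (P E : set V) : Prop :=
  face P E /\ exists a b : V, a != b /\ E = segment a b.

Definition nonsingular (N : set V) (P : set V) : Prop :=
  forall v, vertex P v ->
  exists (E : 'I_n -> set V) (b : 'I_n -> V) (W : 'M[R]_n),
    [/\ injective E,
        forall i, edge P (E i) /\ E i = segment v (b i),
        forall E', edge P E' -> E' v -> exists i, E' = E i,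
        forall i, primitive N (row i W) /\ exists2 t : R, 0 < t & row i W = t *: (b i - v)
      & N = lattice_of W].

Definition unormal (N : set V) (P F : set V) : V :=
  xget 0 [set u | primitive (dual_lattice N) u /\
     exists c : R, (forall x, P x -> c <= dotp x u) /\ F = [set x | P x /\ dotp x u = c]].

Definition lambdaN (N : set V) (P F : set V) : R :=
  xget 0 [set lam | forall x, F x -> dotp x (unormal N P F) + lam = 0].

Definition PNh (N : set V) (P : set V) (h : set V -> R) : set V :=
  [set x | forall F, facet P F -> 0 <= dotp x (unormal N P F) + lambdaN N P F + h F].

Definition dpartial (F : set V) (g : (set V -> R) -> R) (h : set V -> R) : R :=
  derive1 (fun t : R => g (fun G => h G + (if `[< G = F >] then t else 0))) 0.

Fixpoint dpartial_iter (m : nat) (F : set V) (g : (set V -> R) -> R) : (set V -> R) -> R :=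
  match m with
  | 0 => g
  | m'.+1 => dpartial F (dpartial_iter m' F g)
  end.

(** d_f^pi = prod_{F ⊇ f} (d/dh_F)^{pi(F)}, the facets containing f being
    enumerated as Fs 0, ..., Fs (r-1) *)
Definition dop (r : nat) (Fs : 'I_r -> set V) (pi : 'I_r -> nat)
    (g : (set V -> R) -> R) : (set V -> R) -> R :=
  foldr (fun i acc => dpartial_iter (pi i) (Fs i) acc) g (enum 'I_r).

Definition dvol (N P : set V) (r : nat) (Fs : 'I_r -> set V) (pi : 'I_r -> nat) : R :=
  dop Fs pi (fun h => VolN N (PNh N P h)) (fun _ => 0).

(** c(a,m): x / (1 - a e^{-x}) = sum_m c(a,m) x^m as formal power series,
    i.e. x = (1 - a e^{-x}) * sum_m c(a,m) x^m coefficientwise *)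
Definition todd_expansion (a : R[i]) (c : nat -> R[i]) : Prop :=
  forall m : nat, ((m == 1%N)%:R : R[i]) =
    c m - a * \sum_(j < m.+1) ((-1) ^+ j / (j`!)%:R) * c (m - j)%N.

Definition ccoef (a : R[i]) (m : nat) : R[i] :=
  xget (fun _ => 0) [set c | todd_expansion a c] m.

Definition Gamma_rep (N P : set V) (r : nat) (Fs : 'I_r -> set V) (g : V) (rho : 'rV[R]_r) :=
  (forall i, 0 <= rho 0 i < 1) /\ g = \sum_i rho 0 i *: unormal N P (Fs i).

Definition Gamma (N P : set V) (r : nat) (Fs : 'I_r -> set V) : set V :=
  [set g | dual_lattice N g /\ exists rho, Gamma_rep N P Fs g rho].

Definition rhoF (N P : set V) (r : nat) (Fs : 'I_r -> set V) (g : V) : 'rV[R]_r :=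
  xget 0 [set rho | Gamma_rep N P Fs g rho].

Definition expi2pi (t : R) : R[i] := (cos (2 * pi * t) +i* sin (2 * pi * t))%C.

Definition AN (N P : set V) (r : nat) (Fs : 'I_r -> set V) (pi : 'I_r -> nat) : R[i] :=
  \sum_(g \in Gamma N P Fs) \prod_(i < r) ccoef (expi2pi (rhoF N P Fs g 0 i)) (pi i).

(** The lattices M with L ⊆ M ⊆ p^{-1}L correspond to the subspaces W of
    p^{-1}L/L ≅ F_p^n (coordinates w.r.t. the chosen basis of L):
    M_W = { p^{-1} c B : c ∈ Z^n, (c mod p) ∈ W }. *)
Definition sublattice (p : nat) (L : set V) (W : 'M['F_p]_n) : set V :=
  [set (p%:R)^-1 *: (intvec c *m lattice_basis L) |
     c in [set c : 'rV[int]_n | (map_mx (fun z : int => z%:~R : 'F_p) c <= W)%MS]].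

End Defs.

(** subspaces of F_p^n, represented canonically by <<W>>%MS = W *)
Definition subspace_k (p n k : nat) (W : 'M['F_p]_n) : bool :=
  (<<W>>%MS == W) && (\rank W == k).

(** nu_{n,k,j}(p) with U = the span of the first j coordinate vectors *)
Definition nu (n k j p : nat) : nat :=
  (\sum_(W : 'M['F_p]_n | subspace_k k W) p ^ \rank (W :&: (pid_mx j : 'M['F_p]_n))%MS)%N.

(* Main.v *)
Require Import Defs.
From HB Require Import structures.
From mathcomp Require Import all_boot all_order all_algebra.
From mathcomp Require Import all_classical all_reals all_analysis.
From mathcomp Require Import complex.
From mathcomp Require Import measurable_realfun zify ring lra.
Import Order.TTheory GRing.Theory Num.Theory.
Import numFieldNormedType.Exports.
Local Open Scope classical_set_scope.
Local Open Scope ring_scope.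

Set Implicit Arguments.
Unset Strict Implicit.
Unset Printing Implicit Defensive.

(** Let [u_1, ..., u_r] be the primitive inward normals of the facets through
    [f]. At a vertex [v] of [f] they belong to the basis of the dual lattice
    which is dual to the basis of [L] formed by the edges at [v]. With respect to
    an intermediate lattice [M], given by a subspace [W] of [F_p^n], the normal
    [u_i] is multiplied by [1] or [p], according as it lies in the dual of [M] or
    not. Hence [d^pi Vol_M] is [d^pi Vol_L] times [p^k] and some powers of [1/p],
    and since [sum_(m < p) c(zeta^m, s) = p^s c(1, s)] these powers combine with
    [A_M] into [p^(k-l)] times the sum of [prod_i c(zeta^(m_i), pi_i)] over the
    [m] in [F_p^r] such that [sum_i m_i u_i] is orthogonal to [W] modulo [p].
    Summing over [W], each [m <> 0] occurs as often as there are [k]-dimensional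
    subspaces orthogonal to a given nonzero vector; this gives [nu].

    For [l > n], where [n - l] is truncated to [0] in [nu], both sides vanish as
    [d^pi Vol_L = 0]: the volume is a piecewise polynomial of degree at most [n]
    in [h], with affine walls, and along a sequence of infinitesimals
    [t_1 >> t_2 >> ... >> t_r] each derivative lowers the degree, even at a wall,
    as [derive1] is [0] where the derivative does not exist. Thus the smoothness
    of the volume at [h = 0] is not needed. *)

(** * Iterated integrals of piecewise polynomial functions *)

(** The volume is an iterated integral in fixed coordinates, so the covolumes of [L] and [M] are
    compared by translations alone: a fundamental domain of [L] is cut along the [M]-translates of
    one of [M], and the pieces are reassembled into [p ^ k] copies of the latter. Piecewise
    polynomials with affine walls serve both here and in the degree argument, because they are
    stable under integration over one variable after another. The rescaling of heights passes
    through the iterated derivatives because [derive1] is compatible with dilations even at points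
    where it takes its default value. The dual basis at a vertex must be extracted from definitions
    in which edges and facets are merely faces of a convex hull. The key fact is that the edge
    directions generate the cone at the vertex: if the cone stuck out, there would be a further
    edge. The subspaces orthogonal to a nonzero vector and those containing one are counted by
    incident pairs: invertible matrices permute the nonzero vectors transitively, so each count is a
    multiple of the number of all subspaces, which then factors out. *)

Section PolynomialFunctions.
Variable R : realType.
Local Notation env := (nat -> R).
Local Notation mu := (@lebesgue_measure R).

Definition upd (e : env) (k : nat) (y : R) : env :=
  fun i => if i == k then y else e i.

Lemma updE e k y : upd e k y k = y.
Proof. by rewrite /upd eqxx. Qed.

Lemma upd_upd e k x y : upd (upd e k x) k y = upd e k y.
Proof. by apply/funext => i; rewrite /upd; case: eqP. Qed.

Lemma upd_id e k : upd e k (e k) = e.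
Proof. by apply/funext => i; rewrite /upd; case: eqP => [->|]. Qed.

(** The index is an upper bound for the total degree. Variables are numbered by [nat] so that the
    heights and the coordinates of a point can share one environment. *)
Inductive polyf : nat -> (env -> R) -> Prop :=
| polyf_cst d c : polyf d (fun=> c)
| polyf_var d i : polyf d.+1 (fun e => e i)
| polyf_add d f g : polyf d f -> polyf d g -> polyf d (fun e => f e + g e)
| polyf_mul d1 d2 f g : polyf d1 f -> polyf d2 g ->
    polyf (d1 + d2) (fun e => f e * g e).

Lemma polyfW d d' f : (d <= d')%N -> polyf d f -> polyf d' f.
Proof.
move=> dd' pf; have -> : f = (fun e => f e * 1) by apply/funext => e; rewrite mulr1.
by rewrite -(subnKC dd'); apply: polyf_mul => //; exact: polyf_cst.
Qed.

Lemma polyfM d d1 d2 f g : (d1 + d2 <= d)%N -> polyf d1 f -> polyf d2 g ->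
  polyf d (fun e => f e * g e).
Proof. by move=> le pf pg; apply: polyfW le _; exact: polyf_mul. Qed.

Lemma polyfZ d c f : polyf d f -> polyf d (fun e => c * f e).
Proof. by move=> pf; apply: (polyfM (d1 := 0) _ (polyf_cst _ _) pf). Qed.

Lemma polyfN d f : polyf d f -> polyf d (fun e => - f e).
Proof.
move=> /(polyfZ (-1)); congr polyf; apply/funext => e; exact: mulN1r.
Qed.

Lemma polyfB d f g : polyf d f -> polyf d g -> polyf d (fun e => f e - g e).
Proof. by move=> pf pg; apply: polyf_add => //; exact: polyfN. Qed.

Lemma polyf_sum d n (F : 'I_n -> env -> R) :
  (forall i, polyf d (F i)) -> polyf d (fun e => \sum_i F i e).
Proof.
elim: n F => [|n IH] F pF.
  by under [X in polyf d X]eq_fun do rewrite big_ord0; exact: polyf_cst.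
under [X in polyf d X]eq_fun do rewrite big_ord_recl.
by apply: polyf_add => //; exact: IH.
Qed.

Lemma polyf_exp d f m : polyf d f -> polyf (m * d) (fun e => f e ^+ m).
Proof.
move=> pf; elim: m => [|m IH].
  by under [X in polyf _ X]eq_fun do rewrite expr0; exact: polyf_cst.
under [X in polyf _ X]eq_fun do rewrite exprS.
by rewrite mulSn; exact: polyf_mul.
Qed.

Lemma polyf0_cst f : polyf 0 f -> exists c, f = fun=> c.
Proof.
move E : 0%N => d pf; elim: pf E => {d f} [d c _|//|d f g _ IHf _ IHg E|].
- by exists c.
- have [[a ->] [b ->]] := (IHf E, IHg E); by exists (a + b).
- move=> d1 d2 f g _ IHf _ IHg /esym/eqP; rewrite addn_eq0 => /andP[/eqP d0 /eqP d0'].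
  have [[a ->] [b ->]] := (IHf (esym d0), IHg (esym d0')); by exists (a * b).
Qed.

Lemma polyf_upd d f k c : polyf d f -> polyf d (fun e => f (upd e k c)).
Proof.
elim=> {d f} [d a|d i|d f g _ pf _ pg|d1 d2 f g _ pf _ pg]; first exact: polyf_cst.
- rewrite /upd; case: eqP => _; [exact: polyf_cst|exact: polyf_var].
- exact: polyf_add.
- exact: polyf_mul.
Qed.

(* [q] displays a polynomial function as a univariate polynomial in the
   variable [k] whose coefficients do not involve [k]. *)
Definition is_poly_in (d k : nat) (f : env -> R) (q : env -> {poly R}) : Prop :=
  [/\ forall e, (size (q e) <= d.+1)%N,
      forall e y, q (upd e k y) = q e,
      forall j, polyf (d - j) (fun e => (q e)`_j)
    & forall e, f e = (q e).[e k]].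

Lemma polyf_poly_in d f k : polyf d f -> exists q, is_poly_in d k f q.
Proof.
elim=> {d f} [d c|d i|d f g _ [q [sq uq cq fq]] _ [q' [sq' uq' cq' fq']]|
  d1 d2 f g _ [q [sq uq cq fq]] _ [q' [sq' uq' cq' fq']]].
- exists (fun=> c%:P); split => // [e|j|e].
  + by rewrite (leq_trans (size_polyC_leq1 _)).
  + by under [X in polyf _ X]eq_fun do rewrite coefC; exact: polyf_cst.
  + by rewrite hornerC.
- have [->|ik] := eqVneq i k.
    exists (fun=> 'X); split => // [e|j|e]; last by rewrite hornerX.
      by rewrite size_polyX.
    by under [X in polyf _ X]eq_fun do rewrite coefX; exact: polyf_cst.
  exists (fun e => (e i)%:P); split => // [e|e y|j|e]; last by rewrite hornerC.
  + by rewrite (leq_trans (size_polyC_leq1 _)).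
  + by rewrite /upd (negbTE ik).
  + under [X in polyf _ X]eq_fun do rewrite coefC.
    case: j => [|j] /=; [exact: polyf_var|exact: polyf_cst].
- exists (fun e => q e + q' e); split => [e|e y|j|e].
  + by rewrite (leq_trans (size_polyD _ _))// geq_max sq sq'.
  + by rewrite uq uq'.
  + by under [X in polyf _ X]eq_fun do rewrite coefD; exact: polyf_add.
  + by rewrite hornerD fq fq'.
- exists (fun e => q e * q' e); split => [e|e y|j|e].
  + rewrite (leq_trans (size_polyMleq _ _))//.
    by have := sq e; have := sq' e; lia.
  + by rewrite uq uq'.
  + under [X in polyf _ X]eq_fun do rewrite coefM.
    apply: polyf_sum => i; case: (leqP i d1) => [id1|d1i]; last first.
      rewrite [X in polyf _ X](_ : _ = fun=> 0); first exact: polyf_cst.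
      by apply/funext => e; rewrite nth_default ?mul0r// (leq_trans (sq e)).
    case: (leqP (j - i) d2) => [jd2|d2j]; last first.
      rewrite [X in polyf _ X](_ : _ = fun=> 0); first exact: polyf_cst.
      by apply/funext => e; rewrite [X in _ * X]nth_default ?mulr0// (leq_trans (sq' e)).
    apply: (polyfM _ (cq i) (cq' _)).
    by have := ltn_ord i; lia.
  + by rewrite hornerM fq fq'.
Qed.

Lemma polyf_horner d (q : env -> {poly R}) (a : env -> R) :
  (forall e, (size (q e) <= d.+1)%N) ->
  (forall j, polyf (d - j) (fun e => (q e)`_j)) -> polyf 1 a ->
  polyf d (fun e => (q e).[a e]).
Proof.
move=> sq cq pa.
rewrite [X in polyf _ X](_ : _ = fun e => \sum_(j < d.+1) (q e)`_j * a e ^+ j).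
  apply: polyf_sum => j; apply: (polyfM _ (cq j) (polyf_exp j pa)).
  by have := ltn_ord j; lia.
by apply/funext => e; rewrite (horner_coef_wide _ (sq e)).
Qed.

Definition antideriv (q : {poly R}) : {poly R} :=
  \poly_(j < (size q).+1) (if j is i.+1 then q`_i / i.+1%:R else 0).

Lemma coef_antideriv q j :
  (antideriv q)`_j = if j is i.+1 then q`_i / i.+1%:R else 0.
Proof.
rewrite coef_poly; case: j => [|j]; first by rewrite ltn0Sn.
by rewrite ltnS; case: ltnP => // h; rewrite nth_default// mul0r.
Qed.

Lemma deriv_antideriv q : (antideriv q)^`() = q.
Proof.
apply/polyP => i; rewrite coef_deriv coef_antideriv.
by rewrite -[_ *+ _]mulr_natr divfK// pnatr_eq0.
Qed.

Lemma size_antideriv q : (size (antideriv q) <= (size q).+1)%N.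
Proof. exact: size_poly. Qed.

Lemma Rintegral_poly (q : {poly R}) (a b : R) :
  Rintegral mu `[a, b] (horner q) =
  if a <= b then (antideriv q).[b] - (antideriv q).[a] else 0.
Proof.
case: (ltgtP a b) => [ab|ba|<-]; last first.
- by rewrite set_itv1 Rintegral_set1 subrr.
- by rewrite set_itv_ge ?Rintegral_set0// bnd_simp -ltNge.
- rewrite /Rintegral (@continuous_FTC2 _ _ (horner (antideriv q)))//.
  + by apply: continuous_subspaceT => x; exact: continuous_horner.
  + split => [x _||]; first exact: derivable_horner.
      by apply: cvg_at_right_filter; exact: continuous_horner.
    by apply: cvg_at_left_filter; exact: continuous_horner.
  + by move=> x _; rewrite -derivE deriv_antideriv.
Qed.

Lemma polyf_measurable d f e k : polyf d f ->
  measurable_fun setT (fun y => f (upd e k y)).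
Proof.
elim=> {d f} [d c|d i|d f g _ mf _ mg|d1 d2 f g _ mf _ mg].
- exact: measurable_cst.
- by rewrite /upd; case: eqP => _; [exact: measurable_id|exact: measurable_cst].
- exact: measurable_funD.
- exact: measurable_funM.
Qed.

Definition locally_bounded_in k (f : env -> R) :=
  forall e B, exists C, forall y, `|y| <= B -> `|f (upd e k y)| <= C.

Lemma polyf_bounded d f k : polyf d f -> locally_bounded_in k f.
Proof.
move=> pf e B; elim: pf => {d f} [d c|d i|d f g _ [C hf] _ [D hg]|
   d1 d2 f g _ [C hf] _ [D hg]].
- by exists `|c|.
- rewrite /upd; case: eqP => _; first by exists B.
  by exists `|e i|.
- by exists (C + D) => y yB; rewrite (le_trans (ler_normD _ _))// lerD ?hf ?hg.
- by exists (C * D) => y yB; rewrite normrM ler_pM ?hf ?hg.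
Qed.

End PolynomialFunctions.

(** * Piecewise polynomial functions with affine walls and their integrals *)

Section PiecewisePolynomial.
Variable R : realType.
Local Notation env := (nat -> R).
Local Notation mu := (@lebesgue_measure R).
Implicit Types (f g a b : env -> R).

(** Sums of polynomials of degree at most [d], cut off by closed affine half-spaces. The walls are
    affine so that each can be solved for the variable of integration, with an affine solution. *)
Inductive pwpoly : nat -> (env -> R) -> Prop :=
| pwpoly_poly d f : polyf d f -> pwpoly d f
| pwpoly_if d a f : polyf 1 a -> pwpoly d f -> pwpoly d (fun e => if 0 <= a e then f e else 0)
| pwpoly_add d f g : pwpoly d f -> pwpoly d g -> pwpoly d (fun e => f e + g e).

Lemma pwpoly_cst d c : pwpoly d (fun=> c).
Proof. by apply: pwpoly_poly; exact: polyf_cst. Qed.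

Lemma pwpolyZ d c f : pwpoly d f -> pwpoly d (fun e => c * f e).
Proof.
elim=> {d f} [d f pf|d a f pa _ IH|d f g _ IHf _ IHg].
- by apply: pwpoly_poly; exact: polyfZ.
- rewrite [X in pwpoly _ X](_ : _ = fun e => if 0 <= a e then c * f e else 0).
    exact: pwpoly_if.
  by apply/funext => e; case: ifP; rewrite ?mulr0.
- under [X in pwpoly _ X]eq_fun do rewrite mulrDr.
  exact: pwpoly_add.
Qed.

Lemma pwpolyN d f : pwpoly d f -> pwpoly d (fun e => - f e).
Proof.
by move=> /(pwpolyZ (-1)); congr pwpoly; apply/funext => e; exact: mulN1r.
Qed.

Lemma pwpoly_ite d a f g : polyf 1 a -> pwpoly d f -> pwpoly d g ->
  pwpoly d (fun e => if 0 <= a e then f e else g e).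
Proof.
move=> pa pf pg; rewrite [X in pwpoly _ X](_ : _ = fun e => ((if 0 <= a e then f e else 0)
  + g e) + - (if 0 <= a e then g e else 0)).
  apply: pwpoly_add; last by apply: pwpolyN; exact: pwpoly_if.
  by apply: pwpoly_add => //; exact: pwpoly_if.
by apply/funext => e; case: ifP => _; [rewrite addrK|rewrite add0r subr0].
Qed.

Lemma pwpoly_le d a b f g : polyf 1 a -> polyf 1 b -> pwpoly d f -> pwpoly d g ->
  pwpoly d (fun e => if a e <= b e then f e else g e).
Proof.
move=> pa pb pf pg; under [X in pwpoly _ X]eq_fun do rewrite -subr_ge0.
by apply: pwpoly_ite => //; exact: polyfB.
Qed.

Lemma pwpoly_lt d a b f g : polyf 1 a -> polyf 1 b -> pwpoly d f -> pwpoly d g ->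
  pwpoly d (fun e => if a e < b e then f e else g e).
Proof.
move=> pa pb pf pg; under [X in pwpoly _ X]eq_fun do rewrite ltNge if_neg.
exact: pwpoly_le.
Qed.

Lemma pwpoly_shift d f (a : env) : pwpoly d f -> pwpoly d (fun e => f (fun i => e i + a i)).
Proof.
have pshift d' h : polyf d' h -> polyf d' (fun e => h (fun i => e i + a i)).
  elim=> {d' h} [d' c|d' i|d' h h' _ ? _ ?|d1 d2 h h' _ ? _ ?].
  - exact: polyf_cst.
  - by apply: polyf_add; [exact: polyf_var|exact: polyf_cst].
  - exact: polyf_add.
  - exact: polyf_mul.
elim=> {d f} [d f pf|d c f pc _ IH|d f g _ IHf _ IHg].
- by apply: pwpoly_poly; exact: pshift.
- by apply: (pwpoly_if (pshift _ _ pc) IH).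
- exact: pwpoly_add.
Qed.

Lemma pwpoly_measurable d f e k : pwpoly d f ->
  measurable_fun setT (fun y => f (upd e k y)).
Proof.
elim=> {d f} [d f pf|d a f pa _ mf|d f g _ mf _ mg].
- exact: polyf_measurable pf.
- apply: measurable_fun_if => //.
  + apply: measurable_fun_ler; first exact: measurable_cst.
    exact: polyf_measurable pa.
  + exact: measurable_funTS.
- exact: measurable_funD.
Qed.

Lemma pwpoly_bounded d f k : pwpoly d f -> locally_bounded_in k f.
Proof.
move=> pf e B; elim: pf => {d f} [d f pf|d a f pa _ [C hf]|d f g _ [C hf] _ [D hg]].
- exact: polyf_bounded pf _ _.
- exists C => y yB; case: ifP => _; first exact: hf.
  by rewrite normr0 (le_trans _ (hf _ yB)).
- by exists (C + D) => y yB; rewrite (le_trans (ler_normD _ _))// lerD ?hf ?hg.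
Qed.

Lemma pwpoly_integrable d f e k (u v : R) : pwpoly d f ->
  mu.-integrable `[u, v] (EFin \o (fun y => f (upd e k y))).
Proof.
move=> pf; apply: measurable_bounded_integrable => //=.
- by rewrite lebesgue_measure_itv/=; case: ifPn => // _; rewrite -EFinB ltry.
- by apply: measurable_funTS; exact: pwpoly_measurable pf.
- have [C hC] := pwpoly_bounded k pf e (`|u| + `|v|).
  exists C; split; first exact: num_real.
  move=> M CM y /=; rewrite in_itv/= => /andP[uy yv].
  apply: (le_trans (hC _ _) (ltW CM)); rewrite ler_norml.
  have := ler_norm v; have := ler_norm (- u); rewrite normrN.
  have := normr_ge0 u; have := normr_ge0 v; lra.
Qed.

(** The coefficient of [y] has degree 0, hence is a constant: the sign of the slope does not vary
    with the other variables, and [pwpoly_int] can distinguish the three signs once and for all. *)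
Lemma polyf1_split a k : polyf 1 a -> exists2 al : R,
  polyf 1 (fun e => a (upd e k 0)) &
  forall e y, a (upd e k y) = al * y + a (upd e k 0).
Proof.
move=> pa; have [q [sq uq cq fq]] := polyf_poly_in k pa.
have [al alE] := polyf0_cst (cq 1%N); exists al; first exact: polyf_upd.
move=> e y; rewrite !fq !uq !updE !(horner_coef_wide _ (sq e)).
rewrite !big_ord_recl !big_ord0/= !expr0 !expr1 !mulr1 mulr0 !addr0.
by have := congr1 (fun h => h e) alE => /= ->; rewrite addrC.
Qed.

Lemma Rintegral_if_itv (u v al c : R) (h : R -> R) : 0 < al ->
  Rintegral mu `[u, v] (fun y => if 0 <= al * y + c then h y else 0) =
  Rintegral mu `[Num.max u (- c / al), v] h.
Proof.
move=> al0; rewrite Rintegral_mkcond [RHS]Rintegral_mkcond.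
apply: eq_Rintegral => y _; rewrite /patch !mem_setE !in_itv/= ge_max.
have -> : (0 <= al * y + c) = (- c / al <= y).
  by rewrite ler_pdivrMr//; apply/idP/idP; lra.
by case: (u <= y); case: (_ <= y); case: (y <= v).
Qed.

Lemma Rintegral_if_itvN (u v al c : R) (h : R -> R) : al < 0 ->
  Rintegral mu `[u, v] (fun y => if 0 <= al * y + c then h y else 0) =
  Rintegral mu `[u, Num.min v (- c / al)] h.
Proof.
move=> al0; rewrite Rintegral_mkcond [RHS]Rintegral_mkcond.
apply: eq_Rintegral => y _; rewrite /patch !mem_setE !in_itv/= le_min.
have -> : (0 <= al * y + c) = (y <= - c / al).
  by rewrite ler_ndivlMr//; apply/idP/idP; lra.
by case: (u <= y); case: (y <= _); case: (y <= v).
Qed.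

(** A wall of positive slope raises the lower limit, one of negative slope lowers the upper limit,
    and one of slope 0 comes out of the integral. The new limits are affine again, so the induction
    has to be over arbitrary affine limits [a] and [b]. *)
Lemma pwpoly_int d f k : pwpoly d f -> forall a b, polyf 1 a -> polyf 1 b ->
  pwpoly d.+1 (fun e => Rintegral mu `[a e, b e] (fun y => f (upd e k y))).
Proof.
elim=> {d f} [d f pf|d c f pc pwf IH|d f g pf IHf pg IHg] a b pa pb.
- have [q [sq uq cq fq]] := polyf_poly_in k pf.
  rewrite [X in pwpoly _ X](_ : _ = fun e => if a e <= b e then
    (antideriv (q e)).[b e] - (antideriv (q e)).[a e] else 0); last first.
    apply/funext => e; rewrite -Rintegral_poly; apply: eq_Rintegral => y _.
    by rewrite fq uq updE.
  have pQ (h : env -> R) : polyf 1 h -> polyf d.+1 (fun e => (antideriv (q e)).[h e]).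
    move=> ph; apply: polyf_horner => // [e|j].
      by rewrite (leq_trans (size_antideriv _))// ltnS.
    under [X in polyf _ X]eq_fun do rewrite coef_antideriv.
    case: j => [|j]; first exact: polyf_cst.
    rewrite subSS; under [X in polyf _ X]eq_fun do rewrite mulrC.
    exact: polyfZ.
  apply: pwpoly_le => //; last exact: pwpoly_cst.
  by apply: pwpoly_poly; apply: polyfB; exact: pQ.
- have [al pc0 cE] := polyf1_split k pc.
  under [X in pwpoly _ X]eq_fun do under eq_Rintegral do rewrite cE.
  have [al0|al0|->] := ltgtP al 0; last first.
  + rewrite [X in pwpoly _ X](_ : _ = fun e => if 0 <= c (upd e k 0) then
      Rintegral mu `[a e, b e] (fun y => f (upd e k y)) else 0).
      by apply: pwpoly_if => //; exact: IH.
    apply/funext => e.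
    under eq_Rintegral do rewrite mul0r add0r.
    by case: ifP => //= _; rewrite Rintegral_cst//= mul0r.
  + under [X in pwpoly _ X]eq_fun do rewrite Rintegral_if_itv//.
    have pl : polyf 1 (fun e => - c (upd e k 0) / al).
      by under [X in polyf _ X]eq_fun do rewrite mulrC; apply: polyfZ; exact: polyfN.
    rewrite [X in pwpoly _ X](_ : _ = fun e => if a e <= - c (upd e k 0) / al
       then Rintegral mu `[- c (upd e k 0) / al, b e] (fun y => f (upd e k y))
       else Rintegral mu `[a e, b e] (fun y => f (upd e k y))).
      by apply: pwpoly_le => //; exact: IH.
    by apply/funext => e; case: leP.
  + under [X in pwpoly _ X]eq_fun do rewrite Rintegral_if_itvN//.
    have pl : polyf 1 (fun e => - c (upd e k 0) / al).
      by under [X in polyf _ X]eq_fun do rewrite mulrC; apply: polyfZ; exact: polyfN.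
    rewrite [X in pwpoly _ X](_ : _ = fun e => if b e <= - c (upd e k 0) / al
       then Rintegral mu `[a e, b e] (fun y => f (upd e k y))
       else Rintegral mu `[a e, - c (upd e k 0) / al] (fun y => f (upd e k y))).
      by apply: pwpoly_le => //; exact: IH.
    by apply/funext => e; case: leP.
- rewrite [X in pwpoly _ X](_ : _ = fun e =>
    Rintegral mu `[a e, b e] (fun y => f (upd e k y)) +
    Rintegral mu `[a e, b e] (fun y => g (upd e k y))).
    by apply: pwpoly_add; [exact: IHf|exact: IHg].
  apply/funext => e; rewrite RintegralD//; [exact: pwpoly_integrable pf|exact: pwpoly_integrable pg].
Qed.

(** The variables from [m] to [m + k - 1] are integrated, the others remain parameters. This is the
    counterpart of [iint] on environments. *)
Fixpoint iterint (k m : nat) f (e : env) : R :=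
  if k is k'.+1 then Rintegral mu setT (fun y => iterint k' m.+1 f (upd e m y)) else f e.

Definition supp (B : R) (i : nat) f := forall e, B < `|e i| -> f e = 0.

Lemma supp_iterint B i k m f : supp B i f -> (i < m)%N -> supp B i (iterint k m f).
Proof.
elim: k m => [//|k IH] m sf im e Be /=.
under eq_Rintegral do rewrite (IH m.+1 sf (ltnW im))/= ?/upd ?ltn_eqF//.
by rewrite Rintegral_cst// mul0r.
Qed.

Lemma Rintegral_supp B (h : R -> R) : (forall y, B < `|y| -> h y = 0) ->
  Rintegral mu setT h = Rintegral mu `[- B, B] h.
Proof.
move=> h0; rewrite [RHS]Rintegral_mkcond; apply: eq_Rintegral => y _.
rewrite /patch mem_setE in_itv/= -ler_norml.
by case: leP => // /h0.
Qed.

Definition supp_block B k m f := forall i, (m <= i < m + k)%N -> supp B i f.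

Lemma supp_blockS B k m f : supp_block B k.+1 m f -> supp B m f /\ supp_block B k m.+1 f.
Proof.
move=> sf; split; first by apply: sf; lia.
by move=> i im; apply: sf; lia.
Qed.

Lemma iterint_pwpoly B k m d f : pwpoly d f -> supp_block B k m f -> pwpoly (d + k) (iterint k m f).
Proof.
elim: k m => [|k IH] m pf sf; first by rewrite addn0.
have [sm sf'] := supp_blockS sf; rewrite addnS /=.
rewrite [X in pwpoly _ X](_ : _ = fun e =>
  Rintegral mu `[- B, B] (fun y => iterint k m.+1 f (upd e m y))).
  apply: (pwpoly_int m (IH _ pf sf')); exact: polyf_cst.
apply/funext => e; apply: Rintegral_supp => y By.
by apply: (supp_iterint k sm (ltnSn m)); rewrite updE.
Qed.

Lemma iterint_integrable B k m d f e : pwpoly d f -> supp_block B k.+1 m f ->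
  mu.-integrable setT (EFin \o (fun y => iterint k m.+1 f (upd e m y))).
Proof.
move=> pf sf; have [sm sf'] := supp_blockS sf.
have := pwpoly_integrable e m (- B) B (iterint_pwpoly pf sf').
rewrite integrable_mkcond//=.
apply: eq_integrable => //= y _; rewrite /patch mem_setE /= in_itv/= -ler_norml.
case: leP => //= By; congr EFin; apply/esym.
by apply: (supp_iterint k sm (ltnSn m)); rewrite updE.
Qed.

Lemma iterint_add B k m d f g : pwpoly d f -> pwpoly d g -> supp_block B k m f -> supp_block B k m g ->
  iterint k m (fun e => f e + g e) = (fun e => iterint k m f e + iterint k m g e).
Proof.
elim: k m => [//|k IH] m pf pg sf sg; apply/funext => e /=.
have [_ sf'] := supp_blockS sf; have [_ sg'] := supp_blockS sg.
rewrite -RintegralD//; [|exact: iterint_integrable pf sf|exact: iterint_integrable pg sg].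
by apply: eq_Rintegral => y _; rewrite IH.
Qed.

(** The pushforward of Lebesgue measure under the translation gives each half-open interval its
    length, so it is Lebesgue measure by uniqueness. *)
Lemma Rintegral_shift (h : R -> R) (a : R) :
  measurable_fun setT h ->
  Rintegral mu setT (fun y => h (y + a)) = Rintegral mu setT h.
Proof.
move=> mh; rewrite /Rintegral; congr fine.
pose phi : measurableTypeR R -> measurableTypeR R := fun y => y + a.
have mphi : measurable_fun setT phi by exact: measurable_funD.
transitivity (\int[pushforward mu phi]_y (h y)%:E)%E.
  rewrite [LHS]integralE [RHS]integralE.
  rewrite !ge0_integral_pushforward//; first last.
  - exact/measurable_funepos/measurable_EFinP.
  - exact/measurable_funeneg/measurable_EFinP.
  by rewrite -!funepos_comp -!funeneg_comp.
apply: (@eq_measure_integral _ _ _ setT mu (pushforward mu phi)) => A mA _ /=; apply/esym.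
have muphi : forall X, ocitv X -> mu X = pushforward mu phi X.
  move=> _ [[u v]] _ <-; rewrite /pushforward/=.
  rewrite (_ : phi @^-1` _ = `]u - a, v - a]%classic).
    rewrite !lebesgue_measure_itv/= !lte_fin ltrD2r.
    by case: ifP => // _; rewrite -!EFinB; congr EFin; lra.
  by apply/seteqP; split => y; rewrite /= !in_itv/= /phi ltrBlDr lerBrDr.
exact: (lebesgue_measure_unique muphi).
Qed.

Lemma iterint_shift B k m d f (a : env) e : pwpoly d f -> supp_block B k m f ->
  iterint k m (fun e => f (fun i => e i + a i)) e = iterint k m f (fun i => e i + a i).
Proof.
elim: k m e => [//|k IH] m e pf sf /=; have [_ sf'] := supp_blockS sf.
pose h y := iterint k m.+1 f (upd (fun i => e i + a i) m y).
have updD y : (fun i => upd e m y i + a i) = upd (fun i => e i + a i) m (y + a m).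
  by apply/funext => i; rewrite /upd; case: eqP => [->|].
transitivity (Rintegral mu setT (fun y => h (y + a m))).
  by apply: eq_Rintegral => y _; rewrite IH// updD.
rewrite Rintegral_shift//.
exact: pwpoly_measurable (iterint_pwpoly pf sf').
Qed.

Lemma iterint_ext k m f e e' : (forall i, ~~ (m <= i < m + k)%N -> e i = e' i) ->
  iterint k m f e = iterint k m f e'.
Proof.
elim: k m e e' => [|k IH] m e e' ee'.
  by rewrite (_ : e = e')//; apply/funext => i; apply: ee'; lia.
apply: eq_Rintegral => y _; apply: IH => i im; rewrite /upd.
by case: eqP => // im'; apply: ee'; lia.
Qed.

End PiecewisePolynomial.

(** * Derivatives of piecewise polynomial functions *)

Section LexGerms.
Variable R : realType.
Local Notation env := (nat -> R).
Implicit Types (f g a b : env -> R).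

(** A variable tends to 0 from the left, stays at 0, or tends to 0 from the right. The middle case
    is what allows a germ to be evaluated on a coordinate hyperplane, which may be a wall. *)
Inductive side := Neg | Zero | Pos.

Definition side_filter (s : side) : set_system R :=
  match s with
  | Neg => (0 : R)^'-
  | Zero => globally [set 0]
  | Pos => (0 : R)^'+
  end.

#[local] Instance side_filter_proper s : ProperFilter (side_filter s).
Proof.
case: s => /=; [exact: at_left_proper_filter| |exact: at_right_proper_filter].
exact: (@globally_properfilter _ _ 0).
Qed.

Lemma side_filter_nbhs s (P : set R) : nbhs 0 P -> side_filter s P.
Proof.
case: s => /= P0.
- exact: cvg_within P0.
- by move=> y ->; exact: nbhs_singleton.
- exact: cvg_within P0.
Qed.

(* The last variable is infinitely small compared to the previous ones. *)
Fixpoint lex_near (k : nat) (s : nat -> side) (P : set env) : Prop :=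
  if k is k'.+1 then
    lex_near k' s [set e | side_filter (s k') [set y | P (upd e k' y)]]
  else P (fun=> 0).

Lemma lex_nearS k s (P Q : set env) : (forall e, P e -> Q e) ->
  lex_near k s P -> lex_near k s Q.
Proof.
elim: k P Q => [|k IH] P Q PQ /=; first exact: PQ.
by apply: IH => e; apply: filterS => y; exact: PQ.
Qed.

Lemma lex_nearI k s (P Q : set env) :
  lex_near k s P -> lex_near k s Q -> lex_near k s (P `&` Q).
Proof.
elim: k P Q => [//|k IH] P Q /= /IH{}IH /IH.
by apply: lex_nearS => e [Pe Qe]; exact: filterI.
Qed.

Lemma lex_nearT k s (P : set env) : (forall e, P e) -> lex_near k s P.
Proof.
elim: k P => [|k IH] P PT /=; first exact: PT.
by apply: IH => e; apply: filterE => y; exact: PT.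
Qed.

Lemma lex_near_eq_side k s s' (P : set env) : (forall i, (i < k)%N -> s i = s' i) ->
  lex_near k s P -> lex_near k s' P.
Proof.
elim: k P => [//|k IH] P ss' /=; rewrite ss'//.
by apply: IH => i ik; apply: ss'; exact: ltnW.
Qed.

Lemma lex_near_zero k s : lex_near k s [set e | forall i, (k <= i)%N -> e i = 0].
Proof.
elim: k => [//|k IH] /=; apply: lex_nearS IH => e e0.
apply: filterE => y i ki; rewrite /upd gtn_eqF//; apply: e0; exact: ltnW.
Qed.

Lemma lex_near_bound k s (eps : R) : 0 < eps ->
  lex_near k s [set e | forall i, `|e i| < eps].
Proof.
move=> eps0; elim: k => [|k IH] /=; first by move=> i; rewrite normr0.
apply: lex_nearS IH => e eB; apply: side_filter_nbhs.
apply: filterS (nbhs0_lt eps0) => y yeps i.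
by rewrite /upd; case: eqP => // _; exact: eB.
Qed.

Definition has_sign (P : set env -> Prop) f :=
  [\/ P [set e | f e = 0], P [set e | 0 < f e] | P [set e | f e < 0]].

Lemma lex_near_last k s : lex_near k.+1 s
  [set e | match s k with Neg => e k < 0 | Zero => e k = 0 | Pos => 0 < e k end].
Proof.
apply: (@lex_nearT k) => e /=.
have -> : [set y | match s k with Neg => upd e k y k < 0 | Zero => upd e k y k = 0
      | Pos => 0 < upd e k y k end] =
    [set y | match s k with Neg => y < 0 | Zero => y = 0 | Pos => 0 < y end].
  by apply/seteqP; split => y /=; rewrite updE.
case: (s k) => //=; [exact: nbhs_left_lt|exact: nbhs_right_gt].
Qed.

(** As [e k] is infinitesimal compared to the coefficients, the lowest coefficient decides the sign
    by continuity. If it vanishes, a factor [e k] of sign [s k] is split off, and the induction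
    continues with one coefficient fewer. *)
Lemma lex_near_sum_sign k s m (c : nat -> env -> R) :
  (forall j e y, c j (upd e k y) = c j e) ->
  (forall j, has_sign (lex_near k s) (c j)) ->
  has_sign (lex_near k.+1 s) (fun e => \sum_(j < m) c j e * e k ^+ j).
Proof.
elim: m c => [|m IH] c uc hc.
  by constructor 1; apply: lex_nearT => e /=; rewrite big_ord0.
have c0E e : \sum_(j < m.+1) c j e * 0 ^+ j = c 0%N e.
  rewrite big_ord_recl /= expr0 mulr1 big1 ?addr0// => i _.
  by rewrite expr0n/= mulr0.
have cts e : (fun y : R => \sum_(j < m.+1) c j e * y ^+ j) @ (0 : R) --> c 0%N e.
  have -> : c 0%N e = (\poly_(j < m.+1) c j e).[0] by rewrite horner_poly c0E.
  rewrite (_ : (fun y : R => \sum_(j < m.+1) c j e * y ^+ j) =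
    horner (\poly_(j < m.+1) c j e)); last first.
    by apply/funext => y; rewrite horner_poly.
  exact: continuous_horner.
have updsum e y : \sum_(j < m.+1) c j (upd e k y) * upd e k y k ^+ j =
    \sum_(j < m.+1) c j e * y ^+ j.
  by apply: eq_bigr => i _; rewrite uc updE.
have [c0|c0|c0] := hc 0%N.
- have sumE e : c 0%N e = 0 -> \sum_(j < m.+1) c j e * e k ^+ j =
      e k * \sum_(j < m) c j.+1 e * e k ^+ j.
    move=> ce; rewrite big_ord_recl /= ce mul0r add0r mulr_sumr.
    by apply: eq_bigr => i _; rewrite /bump /= exprS; ring.
  have {}c0 : lex_near k.+1 s [set e | c 0%N e = 0].
    by apply: lex_nearS c0 => e /= c0; apply: filterE => y; rewrite /= uc.
  have := lex_near_last k s; case sk : (s k) => ek.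
  + have [t|t|t] := IH (fun j => c j.+1) (fun j => uc j.+1) (fun j => hc j.+1).
    * constructor 1; apply: lex_nearS (lex_nearI c0 t) => e /= [/sumE -> ->].
      by rewrite mulr0.
    * constructor 3; apply: lex_nearS (lex_nearI ek (lex_nearI c0 t)).
      by move=> e /= [ek0 [/sumE -> t0]]; rewrite nmulr_rlt0.
    * constructor 2; apply: lex_nearS (lex_nearI ek (lex_nearI c0 t)).
      by move=> e /= [ek0 [/sumE -> t0]]; rewrite nmulr_rgt0.
  + constructor 1; apply: lex_nearS (lex_nearI ek c0) => e /= [ek0 /sumE ->].
    by rewrite ek0 mul0r.
  + have [t|t|t] := IH (fun j => c j.+1) (fun j => uc j.+1) (fun j => hc j.+1).
    * constructor 1; apply: lex_nearS (lex_nearI c0 t) => e /= [/sumE -> ->].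
      by rewrite mulr0.
    * constructor 2; apply: lex_nearS (lex_nearI ek (lex_nearI c0 t)).
      by move=> e /= [ek0 [/sumE -> t0]]; rewrite mulr_gt0.
    * constructor 3; apply: lex_nearS (lex_nearI ek (lex_nearI c0 t)).
      by move=> e /= [ek0 [/sumE -> t0]]; rewrite pmulr_rlt0.
- constructor 2; apply: lex_nearS c0 => e /= e0; apply: side_filter_nbhs.
  have h : nbhs (0 : R) (fun y => 0 < \sum_(j < m.+1) c j e * y ^+ j) by exact: cvgr_gt (cts e) _ e0.
  by apply: filterS h => y /=; rewrite updsum.
- constructor 3; apply: lex_nearS c0 => e /= e0; apply: side_filter_nbhs.
  have h : nbhs (0 : R) (fun y => \sum_(j < m.+1) c j e * y ^+ j < 0) by exact: cvgr_lt (cts e) _ e0.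
  by apply: filterS h => y /=; rewrite updsum.
Qed.

Lemma polyf_sign d f k s : polyf d f -> has_sign (lex_near k s) f.
Proof.
elim: k d f => [|k IH] d f pf.
  by rewrite /has_sign/=; case: (ltgtP (f (fun=> 0)) 0) => h; [constructor 3|constructor 2|constructor 1].
have [q [sq uq cq fq]] := polyf_poly_in k pf.
have := @lex_near_sum_sign k s d.+1 (fun j e => (q e)`_j) _ (fun j => IH _ _ (cq j)).
rewrite (_ : (fun _ => _) = f); first by apply => j e y; rewrite uq.
by apply/funext => e; rewrite fq (horner_coef_wide _ (sq e)).
Qed.

(* [m] counts coefficients, so that [m = 0] stands for the zero function. *)
Definition polyf_lt m f := if m is d.+1 then polyf d f else f = fun=> 0.

Lemma polyf_ltP m f : polyf_lt m f -> exists d, polyf d f.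
Proof.
case: m => [->|d]; [by exists 0%N; exact: polyf_cst|by exists d].
Qed.

Lemma polyf_lt0 m : polyf_lt m (fun=> 0).
Proof. by case: m => [//|d]; exact: polyf_cst. Qed.

Lemma polyf_lt_poly_in m k f : polyf_lt m f -> exists q : env -> {poly R},
  [/\ forall e y, q (upd e k y) = q e, forall e, f e = (q e).[e k]
    & polyf_lt m.-1 (fun e => ((q e)^`()).[e k])].
Proof.
case: m => [->|d pf].
  exists (fun=> 0); split => // [e|/=]; first by rewrite horner0.
  by apply/funext => e; rewrite deriv0 horner0.
have [q [sq uq cq fq]] := polyf_poly_in k pf; exists q; split => //.
case: d pf sq cq => [|d] pf sq cq /=.
  apply/funext => e; rewrite [q e]size1_polyC ?sq// derivC horner0//.
apply: polyf_horner => [e|j|].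
- rewrite (leq_trans (size_poly _ _))//; have := sq e; case: (size (q e)) => [|n]/=; lia.
- under [X in polyf _ X]eq_fun do rewrite coef_deriv -mulr_natl.
  by apply: polyfZ; have := cq j.+1; rewrite subSS.
- exact: polyf_var.
Qed.

(** The polynomial may depend on the sides [s], so nothing is claimed about continuity across a
    wall; [m] bounds its degree strictly. *)
Definition germ m k f :=
  forall s, exists2 Q, polyf_lt m Q & lex_near k s [set e | f e = Q e].

Lemma germ_eq m k f g eps : 0 < eps -> germ m k f ->
  (forall e, (forall i, `|e i| < eps) -> f e = g e) -> germ m k g.
Proof.
move=> eps0 gf fg s; have [Q pQ fQ] := gf s; exists Q => //.
apply: lex_nearS (lex_nearI (lex_near_bound k s eps0) fQ) => e /= [eB <-].
by rewrite fg.
Qed.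

(** By [polyf_sign] each wall function has a constant sign on a germ, so each condition is decided
    there. *)
Lemma pwpoly_germ d k f : pwpoly d f -> germ d.+1 k f.
Proof.
elim=> {d f} [d f pf|d a f pa _ IH|d f g _ IHf _ IHg] s.
- by exists f => //; exact: lex_nearT.
- have [Q pQ fQ] := IH s.
  have [a0|a0|a0] := polyf_sign k s pa.
  + exists Q => //; apply: lex_nearS (lex_nearI a0 fQ) => e /= [-> ->].
    by rewrite lexx.
  + exists Q => //; apply: lex_nearS (lex_nearI a0 fQ) => e /= [/ltW -> ->]//.
  + exists (fun=> 0); first exact: polyf_cst.
    by apply: lex_nearS a0 => e /=; rewrite ltNge => /negbTE ->.
- have [Q pQ fQ] := IHf s; have [Q' pQ' gQ'] := IHg s.
  exists (fun e => Q e + Q' e); first exact: polyf_add.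
  by apply: lex_nearS (lex_nearI fQ gQ') => e /= [-> ->].
Qed.

Definition dvar (k : nat) f : env -> R :=
  fun e => derive1 (fun t => f (upd e k (e k + t))) 0.

Lemma poly_diff_quotient (p : {poly R}) :
  (fun h : R => h^-1 * (p.[h] - p.[0])) @ 0^' --> p^`().[0].
Proof.
have [+ _] := is_derive_poly p 0.
rewrite /derivable => /= cp.
have := derive1E (horner p) 0; rewrite -derivE /derive => ->.
apply: cvg_trans cp; apply: near_eq_cvg; near=> h.
by rewrite /= addr0 [h%:A]mulr1.
Unshelve. all: end_near. Qed.

Lemma derive1_sides_eq (phi : R -> R) (p q : {poly R}) :
  (\forall y \near 0^'+, phi y = p.[y]) -> (\forall y \near 0^'-, phi y = q.[y]) ->
  phi 0 = p.[0] -> phi 0 = q.[0] -> p^`().[0] = q^`().[0] ->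
  derive1 phi 0 = p^`().[0].
Proof.
move=> hp hq p0 q0 pq; apply: cvg_lim => //; apply: (@cvg_at_right_left_dnbhs _ R^o).
- apply: cvg_trans (cvg_dnbhs_at_right (@poly_diff_quotient p)).
  apply: near_eq_cvg; near=> h; rewrite addr0 p0; congr (_ * (_ - _)); apply/esym.
  by near: h.
- rewrite pq; apply: cvg_trans (cvg_dnbhs_at_left (@poly_diff_quotient q)).
  apply: near_eq_cvg; near=> h; rewrite addr0 q0; congr (_ * (_ - _)); apply/esym.
  by near: h.
Unshelve. all: end_near. Qed.

Lemma side_lim_unique s (f : R -> R) (l l' : R) :
  f @ side_filter s --> l -> f @ side_filter s --> l' -> l = l'.
Proof.
exact: (@norm_cvg_unique R R^o (fmap f (side_filter s))
  (fmap_proper_filter f (side_filter_proper s))).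
Qed.

(** A convergent difference quotient, multiplied by [h], shows that [phi h] tends to [phi 0]; hence
    [p] takes the value [phi 0] at 0 and the quotient is eventually that of [p]. The first
    hypothesis restricts [s] to the two proper sides. *)
Lemma side_quotient_lim (s : side) (phi : R -> R) (p : {poly R}) (l : R) :
  (forall P : set R, 0^' P -> side_filter s P) ->
  (\forall y \near side_filter s, phi y = p.[y]) ->
  (fun h : R => h^-1 * (phi h - phi 0)) @ side_filter s --> l ->
  phi 0 = p.[0] /\ l = p^`().[0].
Proof.
move=> sd hp hl; have FF : Filter (side_filter s) by exact: filter_filter.
have p0 : phi 0 = p.[0].
  have h0 : (fun h : R => h) @ side_filter s --> (0 : R).
    move=> P hP; exact: (@side_filter_nbhs s P hP).
  have := cvgM h0 hl; rewrite mul0r => hphi.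
  have ctsp : horner p @ side_filter s --> p.[0].
    move=> P hP; have pP := @continuous_horner R p 0 P hP.
    exact: (@side_filter_nbhs s (fun y => P p.[y]) pP).
  have : (fun h : R => p.[h] - phi 0) @ side_filter s --> (0 : R).
    have E : {near side_filter s,
        (fun h : R => h * (h^-1 * (phi h - phi 0))) =1 (fun h => p.[h] - phi 0)}.
      near=> h; have hn0 : h != 0 by near: h; exact: (sd _ (@nbhs_dnbhs_neq R 0)).
      rewrite /= mulrA divff// mul1r; congr (_ - _).
      by near: h.
    have E' := near_eq_cvg E; exact: cvg_trans (E' FF) (hphi FF).
  have ctsp' := cvgB ctsp (cvg_cst (phi 0)).
  move=> lim0; have /eqP := side_lim_unique (ctsp' FF FF) lim0.
  by rewrite subr_eq0 => /eqP.
split => //.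
have : (fun h : R => h^-1 * (p.[h] - p.[0])) @ side_filter s --> l.
  have E : {near side_filter s, (fun h : R => h^-1 * (phi h - phi 0)) =1
       (fun h => h^-1 * (p.[h] - p.[0]))}.
    by near=> h; rewrite p0; congr (_ * (_ - _)); near: h.
  have E' := near_eq_cvg E; exact: cvg_trans (E' FF) hl.
move=> hl'; apply: (side_lim_unique hl') => P hP; apply: sd.
exact: (@poly_diff_quotient p P hP).
Unshelve. all: end_near. Qed.

(* Junk value: [derive1] is [0] at a point where the derivative does not exist. *)
Lemma derive1_sides_neq (phi : R -> R) (p q : {poly R}) :
  (\forall y \near 0^'+, phi y = p.[y]) -> (\forall y \near 0^'-, phi y = q.[y]) ->
  ~ (phi 0 = p.[0] /\ phi 0 = q.[0] /\ p^`().[0] = q^`().[0]) ->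
  derive1 phi 0 = 0.
Proof.
move=> hp hq ne; apply: dvgP => cv; apply: ne.
have {cv} [l hl] : exists l : R, (fun h : R => h^-1 * (phi h - phi 0)) @ 0^' --> l.
  move/cvg_ex : cv => [l hl]; exists l; apply: cvg_trans hl.
  by apply: near_eq_cvg; near=> h; rewrite addr0.
have pos (P : set R) : (0 : R)^' P -> side_filter Pos P.
  by move=> hP; apply: (@filterS _ (nbhs (0 : R)) _ _ _ _ hP) => y Py y0; apply: Py; rewrite gt_eqF.
have neg (P : set R) : (0 : R)^' P -> side_filter Neg P.
  by move=> hP; apply: (@filterS _ (nbhs (0 : R)) _ _ _ _ hP) => y Py y0; apply: Py; rewrite lt_eqF.
have [p0 lp] := @side_quotient_lim Pos phi p l pos hp (cvg_dnbhs_at_right hl).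
have [q0 lq] := @side_quotient_lim Neg phi q l neg hq (cvg_dnbhs_at_left hl).
by rewrite -lp -lq.
Unshelve. all: end_near. Qed.

(** Choosing the side [Zero] for the last variable fixes it at 0, which is its value anyway on a
    germ of length [k]. *)
Lemma germ_restrict m k f : germ m k.+1 f -> germ m k f.
Proof.
move=> gf s; have [Q pQ fQ] := gf (fun i => if i == k then Zero else s i).
exists Q => //.
have {}fQ : lex_near k s [set e | f (upd e k 0) = Q (upd e k 0)].
  apply: (@lex_near_eq_side _ (fun i => if i == k then Zero else s i)).
    by move=> i ik; rewrite ltn_eqF.
  move: fQ; rewrite /= eqxx => fQ.
  by apply: lex_nearS fQ => e /= he; exact: he.
apply: lex_nearS (lex_nearI fQ (lex_near_zero k s)) => e /= [fe e0].
by rewrite -(upd_id e k) e0.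
Qed.

Lemma dvar_upd k f e y : dvar k f (upd e k y) = derive1 (fun t => f (upd e k t)) y.
Proof.
rewrite /dvar updE /derive1.
rewrite (_ : (fun h => _) = (fun h => h^-1 *: (f (upd e k (h + y)) - f (upd e k y))))//.
by apply/funext => h; rewrite !upd_upd !addr0 [h + y]addrC.
Qed.

Lemma derive1_near_poly (phi : R -> R) (p : {poly R}) (y : R) :
  (\forall z \near y, phi z = p.[z]) -> derive1 phi y = p^`().[y].
Proof.
move=> h; have := congr1 (fun f : R -> R => f y) (@derivE R p) => /= ->.
by rewrite !derive1E; exact: near_eq_derive.
Qed.

(** A derivative at a small [y > 0] depends on a full neighbourhood of [y]; a property that holds to
    the right of 0 holds on such neighbourhoods. *)
Lemma at_right_join (P : set R) : (0 : R)^'+ P -> (0 : R)^'+ [set y | nbhs y P].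
Proof.
move=> h; have /near_join {}h : \forall y \near (0 : R), 0 < y -> P y by exact: h.
apply: (@filterS _ (nbhs (0 : R)) _ _ _ _ h) => y hy y0.
have hy' : nbhs (y : R) (fun z : R => (0 < z -> P z) /\ 0 < z).
  exact: (filterI hy (lt_nbhsr y0)).
by apply: filterS hy' => z [hz z0]; exact: hz.
Qed.

Lemma at_left_join (P : set R) : (0 : R)^'- P -> (0 : R)^'- [set y | nbhs y P].
Proof.
move=> h; have /near_join {}h : \forall y \near (0 : R), y < 0 -> P y by exact: h.
apply: (@filterS _ (nbhs (0 : R)) _ _ _ _ h) => y hy y0.
have hy' : nbhs (y : R) (fun z : R => (z < 0 -> P z) /\ z < 0).
  exact: (filterI hy (lt_nbhsl y0)).
by apply: filterS hy' => z [hz z0]; exact: hz.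
Qed.

(** Off the hyperplane [e k = 0] a single polynomial is differentiated. On it, either the one-sided
    polynomials and the value fit together to first order and the derivative is that of [qp], or
    they do not and [derive1] is 0. Which case occurs does not vary along the germ, and the degree
    drops in both. *)
Lemma germ_dvar m k f : germ m k.+1 f -> germ m.-1 k.+1 (dvar k f).
Proof.
move=> gf s.
(* Since [germ] quantifies over all sides, the side of the variable [k] may be overridden: the
   polynomials to the left, at 0 and to the right are all available, whatever [s k] is. *)
have gs s0 : exists q : env -> {poly R}, [/\ forall e y, q (upd e k y) = q e,
    exists d, polyf d (fun e => (q e).[e k]),
    polyf_lt m.-1 (fun e => ((q e)^`()).[e k]) &
    lex_near k s [set e | side_filter s0 [set y | f (upd e k y) = (q e).[y]]]].
  have [Q pQ fQ] := gf (fun i => if i == k then s0 else s i).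
  have [q [uq Qq pq]] := polyf_lt_poly_in k pQ.
  exists q; split => //.
    have [d pd] := polyf_ltP pQ; exists d; congr polyf: pd; exact/funext.
  apply: (@lex_near_eq_side _ (fun i => if i == k then s0 else s i)).
    by move=> i ik; rewrite ltn_eqF.
  move: fQ; rewrite /= eqxx => fQ.
  apply: lex_nearS fQ => e /= he; apply: filterS he => y /= ->.
  by rewrite Qq uq updE.
have [qp [uqp [dp pqp] dqp fqp]] := gs Pos.
have [qn [uqn [dn pqn] dqn fqn]] := gs Neg.
have [q0 [uq0 [d0 pq0] _ fq0]] := gs Zero.
case sk : (s k).
- exists (fun e => ((qn e)^`()).[e k]) => //=; rewrite sk.
  apply: lex_nearS fqn => e /= h.
  apply: filterS (at_left_join h) => y hy.
  by rewrite /= dvar_upd updE uqn; exact: derive1_near_poly hy.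
- have at0 d (h : env -> {poly R}) : (forall e y, h (upd e k y) = h e) ->
      polyf d (fun e => (h e).[e k]) -> polyf d (fun e => (h e).[0]).
    move=> uh /(polyf_upd k 0); congr polyf; apply/funext => e.
    by rewrite uh updE.
  have [dp' pdp'] := polyf_ltP dqp; have [dn' pdn'] := polyf_ltP dqn.
  (* The difference of two polynomial functions has a constant sign on the germ, so they agree
     throughout it or nowhere on it. *)
  have diff_sign d d' (h h' : env -> R) : polyf d h -> polyf d' h' ->
      lex_near k s [set e | h e = h' e] \/ lex_near k s [set e | h e <> h' e].
    move=> ph ph'; have pB : polyf (d + d') (fun e => h e - h' e).
      by apply: polyfB; [exact: polyfW (leq_addr _ _) ph|exact: polyfW (leq_addl _ _) ph'].
    have [e0|e0|e0] := polyf_sign k s pB.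
    + by left; apply: lex_nearS e0 => e /eqP /=; rewrite subr_eq0 => /eqP.
    + by right; apply: lex_nearS e0 => e /= + hh'; rewrite hh' subrr ltxx.
    + by right; apply: lex_nearS e0 => e /= + hh'; rewrite hh' subrr ltxx.
  have uder (h : env -> {poly R}) : (forall e y, h (upd e k y) = h e) ->
      forall e y, (h (upd e k y))^`() = (h e)^`().
    by move=> uh e y; rewrite uh.
  have P1 := diff_sign _ _ _ _ (at0 _ _ uq0 pq0) (at0 _ _ uqp pqp).
  have P2 := diff_sign _ _ _ _ (at0 _ _ uq0 pq0) (at0 _ _ uqn pqn).
  have P3 := diff_sign _ _ _ _ (at0 _ _ (uder _ uqp) pdp') (at0 _ _ (uder _ uqn) pdn').
  have germs := lex_nearI fqp (lex_nearI fqn fq0).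
  have zero : lex_near k s [set e | ~ ((q0 e).[0] = (qp e).[0] /\
      (q0 e).[0] = (qn e).[0] /\ (qp e)^`().[0] = (qn e)^`().[0])] ->
      exists2 Q, polyf_lt m.-1 Q & lex_near k.+1 s [set e | dvar k f e = Q e].
    move=> ne; exists (fun=> 0); first exact: polyf_lt0.
    rewrite /= sk; apply: lex_nearS (lex_nearI germs ne) => e /= [[hp [hn h0]] ne'] y ->.
    rewrite dvar_upd; apply: derive1_sides_neq hp hn _.
    by rewrite h0.
  case: P1 => [P1|ne]; last by apply: zero; apply: lex_nearS ne => e ? [].
  case: P2 => [P2|ne]; last by apply: zero; apply: lex_nearS ne => e ? [? []].
  case: P3 => [P3|ne]; last by apply: zero; apply: lex_nearS ne => e ? [? []].
  exists (fun e => ((qp e)^`()).[e k]) => //=; rewrite sk.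
  apply: lex_nearS (lex_nearI germs (lex_nearI P1 (lex_nearI P2 P3))).
  move=> e /= [[hp [hn h0]] [p1 [p2 p3]]] y ->.
  by rewrite dvar_upd updE uqp; apply: derive1_sides_eq hp hn _ _ _ => //; rewrite h0.
- exists (fun e => ((qp e)^`()).[e k]) => //=; rewrite sk.
  apply: lex_nearS fqp => e /= h.
  apply: filterS (at_right_join h) => y hy.
  by rewrite /= dvar_upd updE uqp; exact: derive1_near_poly hy.
Qed.

End LexGerms.

(** * Volumes as iterated integrals, and equidecomposable sets *)

Section IteratedIntegral.
Variable R : realType.
Local Notation env := (nat -> R).

Lemma iint_iterint k m (g : seq R -> R) (f : env -> R) e :
  (forall e', (forall i, (i < m)%N -> e' i = e i) ->
    f e' = g (mkseq (fun j => e' (m + j)%N) k)) ->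
  iint k g = iterint k m f e.
Proof.
elim: k m g e => [|k IH] m g e fg /=; first by rewrite fg.
apply: eq_Rintegral => y _; apply: IH => e' ee'; rewrite fg.
  congr g; rewrite /mkseq /= addn0; congr cons.
    by rewrite ee' ?updE.
  by rewrite -[1%N]addn0 iotaDl -map_comp; apply: eq_map => j /=; rewrite addnS.
by move=> i im; have := ee' i (ltnW im); rewrite /upd ltn_eqF.
Qed.

Lemma vol_iterint n m (S : set 'rV[R]_n) (f : env -> R) e :
  (forall e', (forall i, (i < m)%N -> e' i = e i) ->
    f e' = if `[< S (\row_i e' (m + i)%N) >] then 1 else 0) ->
  vol S = iterint n m f e.
Proof.
move=> fS; apply: iint_iterint => e' ee'; rewrite fS//.
rewrite (_ : (\row_i nth 0 _ i) = \row_i e' (m + i)%N)//.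
by apply/rowP => i; rewrite !mxE nth_mkseq.
Qed.

Lemma pwpoly_mul d1 d2 f g : @pwpoly R d1 f -> pwpoly d2 g -> pwpoly (d1 + d2) (fun e => f e * g e).
Proof.
move=> pf pg; elim: pf => {d1 f} [d1 f pf|d1 a f pa _ IH|d1 f f' _ IHf _ IHf'].
- elim: pg => {d2 g} [d2 g pg|d2 a g pa _ IH|d2 g g' _ IHg _ IHg'].
  + by apply: pwpoly_poly; exact: polyf_mul.
  + under [X in pwpoly _ X]eq_fun do rewrite (fun_if (fun y => f _ * y)) mulr0.
    exact: pwpoly_if.
  + under [X in pwpoly _ X]eq_fun do rewrite mulrDr.
    exact: pwpoly_add.
- rewrite [X in pwpoly _ X](_ : _ = fun e => if 0 <= a e then f e * g e else 0).
    exact: pwpoly_if.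
  by apply/funext => e; case: ifP; rewrite ?mul0r.
- under [X in pwpoly _ X]eq_fun do rewrite mulrDl.
  exact: pwpoly_add.
Qed.

Lemma pwpoly_sum (I : Type) (s : seq I) d (F : I -> env -> R) :
  (forall i, pwpoly d (F i)) -> pwpoly d (fun e => \sum_(i <- s) F i e).
Proof.
move=> pF; elim: s => [|i s IH].
  by under [X in pwpoly _ X]eq_fun do rewrite big_nil; exact: pwpoly_cst.
by under [X in pwpoly _ X]eq_fun do rewrite big_cons; exact: pwpoly_add.
Qed.

Lemma iterint_sum (I : Type) (s : seq I) B k m d (F : I -> env -> R) e :
  (forall i, pwpoly d (F i)) -> (forall i, supp_block B k m (F i)) ->
  iterint k m (fun e => \sum_(i <- s) F i e) e = \sum_(i <- s) iterint k m (F i) e.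
Proof.
move=> pF sF; elim: s => [|i s IH].
  rewrite big_nil (_ : (fun _ => _) = fun=> 0); last first.
    by apply/funext => e'; rewrite big_nil.
  elim: k m e {pF sF} => [//|k IH] m e /=.
  by under eq_Rintegral do rewrite IH; rewrite Rintegral_cst// mul0r.
rewrite big_cons -IH (_ : (fun _ => _) = (fun e => F i e + \sum_(j <- s) F j e)).
  rewrite (iterint_add (pF i) (pwpoly_sum s pF) (sF i))// => j jm e' Be'.
  by rewrite big1// => l _; exact: sF Be'.
by apply/funext => e'; rewrite big_cons.
Qed.

Lemma pwpoly_all d (s : seq (env -> R)) f : (forall a, List.In a s -> polyf 1 a) ->
  pwpoly d f -> pwpoly d (fun e => if all (fun a => 0 <= a e) s then f e else 0).
Proof.
move=> + pf; elim: s => [_ //|a s IH] sP /=.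
rewrite [X in pwpoly _ X](_ : _ = fun e => if 0 <= a e then
    (if all (fun a => 0 <= a e) s then f e else 0) else 0).
  by apply: pwpoly_if; [apply: sP; left|apply: IH => b bs; apply: sP; right].
by apply/funext => e; case: (0 <= a e).
Qed.

Definition indic n (A : set 'rV[R]_n) (e : env) : R :=
  if `[< A (\row_i e i) >] then 1 else 0.

(** These two conditions make iterated integrals of the indicator, and of its products with
    translated indicators, additive and translation invariant. *)
Definition polyhedral n (A : set 'rV[R]_n) : Prop :=
  pwpoly 0 (indic A) /\ exists B, forall x, A x -> forall i, `|x 0 i| <= B.

Lemma vol_indic n (A : set 'rV[R]_n) e : vol A = iterint n 0 (indic A) e.
Proof. by apply: vol_iterint => e' _. Qed.

(* [A] is cut into the pieces [A `&` (C + x w z)], whose translates by [- x w z]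
   cover [C] exactly once for each [w]. *)
Lemma vol_equidecomposable n (A C : set 'rV[R]_n) (T Z : finType)
    (x : T -> Z -> 'rV[R]_n) : polyhedral A -> polyhedral C ->
  (forall q, A q -> exists wz, forall w z, C (q - x w z) <-> (w, z) = wz) ->
  (forall q w, C q -> exists z0, forall z, A (q + x w z) <-> z = z0) ->
  vol A = #|T|%:R * vol C.
Proof.
move=> [pA [BA hA]] [pC [BC hC]] tileA tileC.
pose B := Num.max BA BC.
pose sh (v : 'rV[R]_n) : env := fun i => if insub i is Some j then v 0 j else 0.
have shE v (e : env) : \row_(i < n) (e i + sh v i) = \row_i e i + v.
  apply/rowP => i; rewrite !mxE /sh insubT //= => p.
  by rewrite (_ : Sub _ _ = i)//; apply: val_inj.
pose e0 : env := fun=> 0.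
have suppA (f : env -> R) : supp_block B n 0 (fun e => indic A e * f e).
  move=> i; rewrite add0n /= => im e Be; rewrite /indic.
  case: asboolP => [/hA/(_ (Ordinal im))|]; last by rewrite mul0r.
  by rewrite mxE /= leNgt (le_lt_trans _ Be)// le_max lexx.
have suppC (f : env -> R) : supp_block B n 0 (fun e => f e * indic C e).
  move=> i; rewrite add0n /= => im e Be; rewrite /indic.
  case: asboolP => [/hC/(_ (Ordinal im))|]; last by rewrite mulr0.
  by rewrite mxE /= leNgt (le_lt_trans _ Be)// le_max lexx orbT.
pose f w z e := indic A e * indic C (fun i => e i + sh (- x w z) i).
pose g w z e := indic A (fun i => e i + sh (x w z) i) * indic C e.
(* [f w z] and [g w z] are indicators of the same piece, before and after translation by [- x w z].
   Summing [f] over all pieces gives [A]; summing [g] over [z] gives [C], once for each [w]. *)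
have fg w z : iterint n 0 (f w z) e0 = iterint n 0 (g w z) e0.
  have pg : pwpoly 0 (g w z) by apply: (@pwpoly_mul 0 0) => //; exact: (pwpoly_shift _ pA).
  have -> : f w z = fun e => g w z (fun i => e i + sh (- x w z) i).
    apply/funext => e; rewrite /f /g; congr (indic A _ * _).
    apply/funext => i; rewrite /sh; case: insubP => [j _ _|_]; last by rewrite !addr0.
    by rewrite mxE addrNK.
  rewrite (iterint_shift _ _ pg (suppC (fun e => indic A (fun i => e i + sh (x w z) i)))).
  apply: iterint_ext => i; rewrite add0n /= -leqNgt => ni.
  by rewrite /sh insubF ?addr0// ltnNge ni.
have sumf : indic A = fun e => \sum_w \sum_z f w z e.
  apply/funext => e; rewrite /f; under eq_bigr do rewrite -mulr_sumr.
  rewrite -mulr_sumr /indic; case: asboolP => [Ae|_]; last by rewrite mul0r.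
  have [[w0 z0] wz0] := tileA _ Ae.
  rewrite mul1r pair_bigA /= (bigD1 (w0, z0))//= big1 => [|[w z] /= ne].
    rewrite addr0; case: asboolP => // /=; rewrite shE => /(_ _)[].
    by apply/wz0.
  by case: asboolP => //; rewrite shE => /wz0 E; rewrite E eqxx in ne.
have sumg w : indic C = fun e => \sum_z g w z e.
  apply/funext => e; rewrite /g -mulr_suml /indic.
  case: asboolP => [Ce|_]; last by rewrite mulr0.
  have [z0 hz0] := tileC _ w Ce.
  rewrite mulr1 (bigD1 z0)//= big1 => [|z /= ne].
    rewrite addr0; case: asboolP => // /=; rewrite shE => /(_ _)[].
    by apply/hz0.
  by case: asboolP => //; rewrite shE => /hz0 E; rewrite E eqxx in ne.
have pf w z : pwpoly 0 (f w z) by apply: (@pwpoly_mul 0 0) => //; exact: (pwpoly_shift _ pC).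
have pg w z : pwpoly 0 (g w z) by apply: (@pwpoly_mul 0 0) => //; exact: (pwpoly_shift _ pA).
rewrite (vol_indic _ e0) sumf (@iterint_sum _ _ B _ _ 0); first last.
- move=> w i im e Be; rewrite big1// => z _.
  exact: (suppA (fun e => indic C (fun i => e i + sh (- x w z) i)) i im e Be).
- by move=> w; apply: pwpoly_sum.
rewrite (eq_bigr (fun=> vol C)) ?big_const ?iter_addr_0 ?sumr_const ?mulr_natl//.
move=> w _; rewrite (@iterint_sum _ _ B _ _ 0)//; last first.
  by move=> z; exact: (suppA (fun e => indic C (fun i => e i + sh (- x w z) i))).
under eq_bigr do rewrite fg.
rewrite (vol_indic _ e0) (sumg w) (@iterint_sum _ _ B _ _ 0)// => z.
exact: (suppC (fun e => indic A (fun i => e i + sh (x w z) i))).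
Qed.

End IteratedIntegral.

(** * Vanishing of derivatives of high order *)

Section DerivativeOperator.
Variables (R : realType) (n r : nat) (Fs : 'I_r -> set 'rV[R]_n).
Hypothesis Fs_inj : injective Fs.

(** [dop] varies only the heights of the facets [Fs i], so all other heights are kept at 0. *)
Definition heights (e : nat -> R) (G : set 'rV[R]_n) : R :=
  \sum_(i < r) (if `[< G = Fs i >] then e i else 0).

Lemma heights_Fs e i : heights e (Fs i) = e i.
Proof.
rewrite /heights (bigD1 i)//= big1 ?addr0; first by case: asboolP.
by move=> j ji; case: asboolP => // /Fs_inj ij; rewrite ij eqxx in ji.
Qed.

Lemma heights_other e G : (forall i, G <> Fs i) -> heights e G = 0.
Proof. by move=> nG; rewrite /heights big1// => i _; case: asboolP => // /nG. Qed.

Lemma dpartial_heights g e i :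
  dpartial (Fs i) g (heights e) = dvar i (fun e => g (heights e)) e.
Proof.
rewrite /dpartial /dvar; congr (derive1 _ 0); apply/funext => t; congr g.
apply/funext => G; have [[j ->]|nG] := pselect (exists j, G = Fs j).
  rewrite !heights_Fs /upd; case: asboolP => [/Fs_inj ->|ji].
    by rewrite eqxx.
  by rewrite addr0; case: eqP => // /val_inj ij; rewrite ij in ji.
rewrite !heights_other; [|by move=> i0 E; apply: nG; exists i0..].
by case: asboolP => [E|]; [case: nG; exists i|rewrite addr0].
Qed.

(** [foldr] applies the operator of the last index first, and the last variable is the one that
    [germ_dvar] can differentiate. Once its derivatives are taken, it is set to 0 and the germ
    becomes shorter by one. At the end the bound [m] has reached 0, which leaves the zero
    function. *)
Lemma dop_eq0 (pi : 'I_r -> nat) m g :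
  germ m r (fun e => g (heights e)) -> (m <= \sum_i pi i)%N ->
  dop Fs pi g (fun=> 0) = 0.
Proof.
move=> gg mpi; rewrite /dop.
pose G j := foldr (fun i acc => dpartial_iter (pi i) (Fs i) acc) g (drop j (enum 'I_r)).
pose w j := (\sum_(i <- drop j (enum 'I_r)) pi i)%N.
have key j : (j <= r)%N -> germ (m - w (r - j)%N)%N (r - j)%N (fun e => G (r - j)%N (heights e)).
  elim: j => [|j IH] jr.
    by rewrite subn0 /G /w drop_oversize ?size_enum_ord// big_nil subn0.
  have jr' : (r - j.+1 < r)%N by lia.
  pose i : 'I_r := Ordinal jr'.
  have dE : drop (r - j.+1) (enum 'I_r) = i :: drop (r - j) (enum 'I_r).
    rewrite (drop_nth i) ?size_enum_ord//; congr cons; last by congr drop; lia.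
    by apply: val_inj; rewrite /= nth_enum_ord.
  rewrite /G /w dE big_cons /=.
  have rj : (r - j = i.+1)%N by rewrite /=; lia.
  have := IH (ltnW jr); rewrite rj -/(G _) -/(w _) => {}IH.
  have -> : (r - j.+1 = i)%N by [].
  apply: germ_restrict.
  have -> : (m - (pi i + w i.+1) = m - w i.+1 - pi i)%N by lia.
  elim: (pi i) => [|p IHp]; first by rewrite subn0.
  have := germ_dvar IHp; rewrite -subnS; congr germ.
  by apply/funext => e; rewrite -dpartial_heights.
have := key r (leqnn r) (fun=> Zero); rewrite subnn /G /w drop0 big_enum /=.
have -> : (m - \sum_i pi i = 0)%N by lia.
move=> [Q /= ->]; rewrite (_ : heights _ = fun=> 0)//.
by apply/funext => F; rewrite /heights big1// => i _; case: ifP.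
Qed.

End DerivativeOperator.

(** * Polytopes and their vertices *)

Section Pairing.
Variables (R : realType) (n : nat).
Local Notation V := 'rV[R]_n.
Implicit Types (x y u v : V).

Lemma dotpE x u : dotp x u = \sum_i x 0 i * u 0 i.
Proof. by rewrite /dotp mxE; apply: eq_bigr => i _; rewrite mxE. Qed.

Lemma dotpC x u : dotp x u = dotp u x.
Proof. by rewrite !dotpE; apply: eq_bigr => i _; rewrite mulrC. Qed.

Lemma dotpDl x y u : dotp (x + y) u = dotp x u + dotp y u.
Proof. by rewrite /dotp mulmxDl mxE. Qed.

Lemma dotpZl c x u : dotp (c *: x) u = c * dotp x u.
Proof. by rewrite /dotp -scalemxAl mxE. Qed.

Lemma dotpNl x u : dotp (- x) u = - dotp x u.
Proof. by rewrite /dotp mulNmx mxE. Qed.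

Lemma dotpBl x y u : dotp (x - y) u = dotp x u - dotp y u.
Proof. by rewrite dotpDl dotpNl. Qed.

Lemma dotp0l u : dotp 0 u = 0.
Proof. by rewrite /dotp mul0mx mxE. Qed.

Lemma dotpDr x u v : dotp x (u + v) = dotp x u + dotp x v.
Proof. by rewrite !(dotpC x) dotpDl. Qed.

Lemma dotpZr c x u : dotp x (c *: u) = c * dotp x u.
Proof. by rewrite !(dotpC x) dotpZl. Qed.

Lemma dotpNr x u : dotp x (- u) = - dotp x u.
Proof. by rewrite !(dotpC x) dotpNl. Qed.

Lemma dotpBr x u v : dotp x (u - v) = dotp x u - dotp x v.
Proof. by rewrite !(dotpC x) dotpBl. Qed.

Lemma dotp0r x : dotp x 0 = 0.
Proof. by rewrite dotpC dotp0l. Qed.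

Lemma dotp_suml (I : Type) (s : seq I) (P : pred I) (F : I -> V) u :
  dotp (\sum_(i <- s | P i) F i) u = \sum_(i <- s | P i) dotp (F i) u.
Proof. by rewrite /dotp mulmx_suml summxE. Qed.

Lemma dotp_sumr (I : Type) (s : seq I) (P : pred I) (F : I -> V) x :
  dotp x (\sum_(i <- s | P i) F i) = \sum_(i <- s | P i) dotp x (F i).
Proof. by rewrite dotpC dotp_suml; apply: eq_bigr => i _; rewrite dotpC. Qed.

Lemma dotp_self_gt0 x : x != 0 -> 0 < dotp x x.
Proof.
move=> x0; rewrite lt_neqAle dotpE sumr_ge0 ?andbT; last by move=> i _; exact: sqr_ge0.
apply: contra x0; rewrite eq_sym psumr_eq0; last by move=> i _; exact: sqr_ge0.
move=> /allP h; apply/eqP/rowP => i; apply/eqP; rewrite mxE -sqrf_eq0.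
by rewrite expr2; apply: h; rewrite mem_index_enum.
Qed.

Lemma seq_argmin (T : eqType) (s : seq T) (f : T -> R) : s != [::] ->
  exists2 t, t \in s & forall t', t' \in s -> f t <= f t'.
Proof.
elim: s => [//|x s IH] _; have [->|s0] := eqVneq s [::].
  by exists x; rewrite ?mem_head// => y; rewrite inE => /eqP ->.
have [y ys hy] := IH s0; have [xy|yx] := leP (f x) (f y).
  exists x; rewrite ?mem_head// => z; rewrite inE => /predU1P[->//|/hy].
  exact: le_trans.
exists y; first by rewrite inE ys orbT.
by move=> z; rewrite inE => /predU1P[->|/hy//]; exact: ltW.
Qed.

(* Among the minimizers of [a], one of maximal norm is the unique minimizer of
   [s *: a - q] for [s] large. *)
Lemma exposed_min (qs : seq V) (a : V) : qs != [::] ->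
  exists q z, [/\ q \in qs, forall y, y \in qs -> dotp q a <= dotp y a &
    forall y, y \in qs -> y != q -> dotp q z < dotp y z].
Proof.
move=> qs0; have [q0 q0s min0] := seq_argmin (fun y => dotp y a) qs0.
pose A := [seq y <- qs | dotp y a == dotp q0 a].
have A0 : A != [::].
  by apply/eqP => A0; have : q0 \in A; [rewrite mem_filter eqxx|rewrite A0].
have [q + maxq] := seq_argmin (fun y => - dotp y y) A0.
rewrite mem_filter => /andP[/eqP qa qs_q].
(* Every point that is not a minimizer imposes a lower bound on [s]; the sum of these bounds serves
   all points. *)
have [s s0 hs] : exists2 s : R, 0 <= s & forall y, y \in qs -> dotp q a < dotp y a ->
    dotp y q - dotp q q < s * (dotp y a - dotp q a).
  elim: {+}qs => [|y l [s s0 IH]]; first by exists 0.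
  pose s1 := `|dotp y q - dotp q q| / (dotp y a - dotp q a) + 1.
  have [ya|ya] := ltP (dotp q a) (dotp y a); last first.
    exists s => // y'; rewrite inE => /predU1P[->|/IH//].
    by rewrite ltNge ya.
  have s10 : 0 <= s1 by rewrite addr_ge0// divr_ge0// subr_ge0 ltW.
  exists (s + s1) => [|y']; first exact: addr_ge0.
  rewrite inE mulrDl => /predU1P[-> _|/IH {}IH /[dup] y'a /IH y'h]; last first.
    by rewrite (lt_le_trans y'h)// lerDl mulr_ge0// subr_ge0 ltW.
  rewrite (@lt_le_trans _ _ (s1 * (dotp y a - dotp q a)))//; last first.
    by rewrite lerDr mulr_ge0// subr_ge0 ltW.
  rewrite mulrDl divfK ?subr_eq0 ?gt_eqF// mul1r.
  by rewrite (le_lt_trans (ler_norm _))// ltrDl subr_gt0.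
exists q, (s *: a - q); split => // [y ys|y ys yq]; first by rewrite qa min0.
rewrite !dotpBr !dotpZr.
have := min0 _ ys; rewrite -qa le_eqVlt => /predU1P[ya|/(hs _ ys)]; last lra.
have : 0 < dotp (y - q) (y - q) by apply: dotp_self_gt0; rewrite subr_eq0.
have := maxq y; rewrite mem_filter -ya qa eqxx ys => /(_ isT).
by rewrite !dotpBl !dotpBr (dotpC q y); lra.
Qed.

End Pairing.

Section Polytope.
Local Notation conv := Defs.conv.
Variables (R : realType) (n : nat).
Local Notation V := 'rV[R]_n.
Variable vs : seq V.
Implicit Types (x y u v z : V).

Lemma conv_mem y : y \in vs -> conv vs y.
Proof.
move=> yv; have iv : (index y vs < size vs)%N by rewrite index_mem.
exists (fun i => (i == Ordinal iv)%:R); split => [i||]; first exact: ler0n.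
  by rewrite (bigD1 (Ordinal iv))//= eqxx big1 ?addr0// => i /negbTE ->.
rewrite (bigD1 (Ordinal iv))//= eqxx scale1r nth_index// big1 ?addr0//.
by move=> i /negbTE ->; rewrite scale0r.
Qed.

Lemma conv_ge x u c : conv vs x -> (forall y, y \in vs -> c <= dotp y u) ->
  c <= dotp x u.
Proof.
move=> [w [w0 w1 ->]] h; rewrite dotp_suml -[c]mul1r -w1 mulr_suml.
by apply: ler_sum => i _; rewrite dotpZl ler_wpM2l// h// mem_nth.
Qed.

Lemma conv_segment x y t : conv vs x -> conv vs y -> 0 <= t <= 1 ->
  conv vs ((1 - t) *: x + t *: y).
Proof.
move=> [w [w0 w1 ->]] [w' [w0' w1' ->]] /andP[t0 t1].
exists (fun i => (1 - t) * w i + t * w' i); split => [i||].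
- by rewrite addr_ge0// mulr_ge0// subr_ge0.
- by rewrite big_split/= -!mulr_sumr w1 w1'; lra.
- rewrite !scaler_sumr -big_split/=; apply: eq_bigr => i _.
  by rewrite !scalerA -scalerDl.
Qed.

(* In a convex combination lying on a supporting hyperplane, only the points of
   that hyperplane have nonzero weight. *)
Lemma conv_face_weights x u c : conv vs x -> (forall y, y \in vs -> c <= dotp y u) ->
  dotp x u = c -> exists w : 'I_(size vs) -> R,
    [/\ forall i, 0 <= w i, \sum_i w i = 1, x = \sum_i w i *: vs`_i &
      forall i, w i != 0 -> dotp vs`_i u = c].
Proof.
move=> [w [w0 w1 xE]] h xc; exists w; split => // i wi.
have : \sum_i w i * (dotp vs`_i u - c) = 0.
  under eq_bigr do rewrite mulrBr.
  rewrite sumrB -mulr_suml w1 mul1r -xc xE dotp_suml; apply/eqP; rewrite subr_eq0.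
  by apply/eqP; apply: eq_bigr => j _; rewrite dotpZl.
move=> /eqP; rewrite psumr_eq0; last first.
  by move=> j _; rewrite mulr_ge0// subr_ge0 h// mem_nth.
move=> /allP /(_ i (mem_index_enum _)); rewrite /= mulf_eq0 (negbTE wi) /=.
by rewrite subr_eq0 => /eqP.
Qed.

(** [exposed_min] yields a minimizer [q] of [a] that is also the strict minimizer of some [z] on
    [vs]. On the convex hull the minimum of [z] is then attained only at [q], so [q] is a face. *)
Lemma min_vertex a : conv vs !=set0 -> exists v, [/\ v \in vs, conv vs v,
  vertex (conv vs) v & forall x, conv vs x -> dotp v a <= dotp x a].
Proof.
move=> [x0 [w [_ w1 _]]].
have vs0 : vs != [::].
  apply/eqP => vs0; move: w w1; rewrite vs0 => w; rewrite big_ord0 => /eqP.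
  by rewrite eq_sym oner_eq0.
have [q [z [qs mina exz]]] := exposed_min a vs0.
have qP := conv_mem qs.
have exz' y : y \in vs -> dotp q z <= dotp y z.
  by move=> ys; have [->//|/exz h] := eqVneq y q; exact/ltW/h.
have uniqz x : conv vs x -> dotp x z = dotp q z -> x = q.
  move=> xP xz; have [w' [_ w1' -> wE]] := conv_face_weights xP exz' xz.
  rewrite (eq_bigr (fun i => w' i *: q)) => [|i _].
    by rewrite -scaler_suml w1' scale1r.
  have [->|/wE h] := eqVneq (w' i) 0; first by rewrite !scale0r.
  have [->//|/(exz _ (mem_nth 0 (ltn_ord i)))] := eqVneq (vs`_i) q.
  by rewrite h ltxx.
exists q; split => // [|x xP]; last exact: conv_ge xP mina.
split; [by exists q|split; first by move=> x /= ->].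
(* A supporting functional must be nonzero. If [z] is 0, the polytope is the single point [q], which
   is a face as the whole of [P]. *)
have [z0|z0] := eqVneq z 0.
  left; apply/seteqP; split => x; first by move=> /= ->.
  by move=> xP; apply: uniqz => //; rewrite z0 !dotp0r.
right; exists z, (dotp q z); split => //; split; first by move=> x xP; exact: conv_ge xP exz'.
apply/seteqP; split => x; first by move=> /= ->.
by move=> [xP xz]; exact: uniqz.
Qed.

Lemma face_vertex f : face (conv vs) f -> exists v,
  [/\ v \in vs, f v & vertex (conv vs) v].
Proof.
move=> [[x fx] [fP fE]]; have P0 : conv vs !=set0 by exists x; exact: fP.
case: fE => [->|[u [c [u0 [uc fE]]]]].
  by have [v [vs_v Pv vv _]] := min_vertex 0 P0; exists v.
have [v [vs_v Pv vv vmin]] := min_vertex u P0; exists v; split => //.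
rewrite fE; split => //; apply/le_anti; rewrite uc// andbT.
by move: fx; rewrite fE => -[xP <-]; exact: vmin.
Qed.

End Polytope.

Section DualBasis.
Variables (R : realType) (n : nat) (W : 'M[R]_n).
Hypothesis Wu : W \in unitmx.
Local Notation V := 'rV[R]_n.
Implicit Types x u : V.

Definition dualvec j : V := row j (invmx W)^T.

Lemma dotp_dualvecE x j : dotp x (dualvec j) = (x *m invmx W) 0 j.
Proof. by rewrite dotpE mxE; apply: eq_bigr => i _; rewrite !mxE. Qed.

Lemma dotp_dualvec i j : dotp (row i W) (dualvec j) = (i == j)%:R.
Proof. by rewrite dotp_dualvecE -row_mul mulmxV// !mxE. Qed.

Lemma dualvec_neq0 j : dualvec j != 0.
Proof.
apply/eqP => d0; have := dotp_dualvec j j.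
by rewrite d0 dotp0r eqxx => /eqP; rewrite eq_sym oner_eq0.
Qed.

Lemma basis_expand x : x = \sum_i dotp x (dualvec i) *: row i W.
Proof.
rewrite -[LHS](mulmxKV Wu) mulmx_sum_row; apply: eq_bigr => i _.
by rewrite dotp_dualvecE.
Qed.

Lemma dotp_expand x u : dotp x u = \sum_i dotp x (dualvec i) * dotp (row i W) u.
Proof.
by rewrite {1}[x]basis_expand dotp_suml; apply: eq_bigr => i _; rewrite dotpZl.
Qed.

Lemma basis_eq0 u : (forall i, dotp (row i W) u = 0) -> u = 0.
Proof.
move=> h; apply/eqP/negPn/negP => /dotp_self_gt0.
by rewrite dotp_expand big1 ?ltxx// => i _; rewrite h mulr0.
Qed.

End DualBasis.

(** Both vectors are orthogonal to the [n - 1] independent directions of the facet, and the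
    orthogonal space of these is a line. *)
Lemma facet_normal_parallel (R : realType) n (P F : set 'rV[R]_n) (u w : 'rV[R]_n) c c' :
  facet P F -> (forall x, F x -> dotp x u = c) -> (forall x, F x -> dotp x w = c') ->
  w != 0 -> exists a, u = a *: w.
Proof.
move=> [_ [_ [x0 [X [Fx0 FX rX]]]]] hu hw w0.
have orth z d : (forall x, F x -> dotp x z = d) -> (z <= kermx X^T)%MS.
  move=> hz; apply/sub_kermxP/rowP => i; rewrite [RHS]mxE.
  have <- : dotp (row i X) z = 0.
    by have := hz _ (FX i); rewrite dotpDl (hz _ Fx0) => /eqP; rewrite addrC -subr_eq0 addrK => /eqP.
  by rewrite dotpE !mxE; apply: eq_bigr => k _; rewrite !mxE mulrC.
have n0 : (0 < n)%N by case: n w w0 {u hu hw X FX rX orth x0 Fx0 F P} => // w; rewrite thinmx0 eqxx.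
have rw : \rank w = 1%N.
  by apply/eqP; rewrite eqn_leq rank_leq_row lt0n mxrank_eq0.
have := orth _ _ hw; move/mxrank_leqif_sup => [_].
rewrite mxrank_ker mxrank_tr rX rw; have -> : (n - n.-1 = 1)%N by lia.
rewrite eqxx => /esym kw; apply/sub_rVP; apply: submx_trans kw; exact: orth hu.
Qed.

(** * The cone of a polytope at a vertex *)

Section VertexCone.
Local Notation conv := Defs.conv.
Variables (R : realType) (n : nat).
Local Notation V := 'rV[R]_n.
Variables (vs : seq V) (v : V) (E : 'I_n -> set V) (b : 'I_n -> V) (W : 'M[R]_n).
Local Notation P := (conv vs).
Hypothesis vP : vertex P v.
Hypothesis P_neq : P <> [set v].
Hypothesis Wu : W \in unitmx.
Hypothesis edgeE : forall i, edge P (E i) /\ E i = segment v (b i).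
Hypothesis edge_at : forall E', edge P E' -> E' v -> exists i, E' = E i.
Hypothesis rowW : forall i, exists2 t : R, 0 < t & row i W = t *: (b i - v).
Implicit Types (x y u : V).

Local Notation dv := (dualvec W).

Lemma vertexP : P v.
Proof. by case: vP => _ [h _]; exact: h. Qed.

Lemma edge_endP i : P (b i).
Proof.
have [[[_ [h _]] _] Ei] := edgeE i; apply: h; rewrite Ei; exists 1.
  by rewrite /= in_itv/= ler01 lexx.
by rewrite subrr scale0r add0r scale1r.
Qed.

Lemma row_ge0 u c i : (forall x, P x -> c <= dotp x u) -> dotp v u = c ->
  0 <= dotp (row i W) u.
Proof.
move=> h vc; have [t t0 ->] := rowW i; rewrite dotpZl dotpBl.
by rewrite mulr_ge0 ?(ltW t0)// subr_ge0 vc h//; exact: edge_endP.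
Qed.

Lemma vertex_support : exists u, forall x, P x -> x <> v -> dotp v u < dotp x u.
Proof.
case: vP => _ [_ [E0|[u [c [_ [h E0]]]]]]; first by case: P_neq.
have vc : dotp v u = c by have : [set v] v by []; rewrite E0 => -[].
exists u => x xP xv; rewrite vc lt_neqAle h// andbT; apply/eqP => xc.
by apply: xv; have : [set v] x by rewrite E0.
Qed.

(* If some generator of the cone has a negative coordinate [j], the vertex
   figure has a vertex with negative coordinate [j], hence there is an edge of
   [P] at [v] with this property; but the edges are the rows of [W]. *)
Lemma vertex_cone x j : P x -> 0 <= dotp (x - v) (dv j).
Proof.
have [u hu] := vertex_support.
suff vs_ge y : y \in vs -> 0 <= dotp (y - v) (dv j).
  move=> xP; rewrite dotpBl subr_ge0; apply: (conv_ge xP) => y /vs_ge.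
  by rewrite dotpBl subr_ge0.
move=> yvs; rewrite leNgt; apply/negP => yneg.
(* The directions from [v] are normalized to the hyperplane on which [u] is 1; their convex hull
   there is the vertex figure. *)
pose dir y := (dotp (y - v) u)^-1 *: (y - v).
pose vs' := [seq y <- vs | y != v].
have vs'P y' : y' \in vs' -> 0 < dotp (y' - v) u.
  rewrite mem_filter => /andP[/eqP yv' /conv_mem yP].
  by rewrite dotpBl subr_gt0; exact: hu.
have yvs' : y \in vs'.
  by rewrite mem_filter yvs andbT; apply: contraTneq yneg => ->; rewrite subrr dotp0l ltxx.
have dirs0 : map dir vs' != [::].
  by apply: contraTneq (map_f dir yvs') => ->.
have [q [z [qdir qmin qz]]] := exposed_min (dv j) dirs0.
have dirneg : dotp q (dv j) < 0.
  apply: (le_lt_trans (qmin _ (map_f dir yvs'))).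
  by rewrite dotpZl nmulr_llt0// invr_gt0 vs'P.
(* As [u] is 1 on all normalized directions, [u'] vanishes on [q] and is positive on the others.
   Hence it supports [P] at [v], and the face that it cuts out lies on the ray from [v] along
   [q]. *)
pose u' := z - dotp q z *: u.
have dir_u y' : y' \in vs' -> dotp (dir y') u = 1.
  by move=> /vs'P h; rewrite dotpZl mulVf// gt_eqF.
have dirK y' : y' \in vs' -> y' - v = dotp (y' - v) u *: dir y'.
  by move=> /vs'P h; rewrite scalerA divff ?scale1r// gt_eqF.
have u'_ge0 y' : y' \in vs -> 0 <= dotp (y' - v) u' /\
    (dotp (y' - v) u' = 0 -> y' - v = dotp (y' - v) u *: q).
  move=> y's; have [->|yv] := eqVneq y' v.
    by rewrite subrr !dotp0l scale0r.
  have y's' : y' \in vs' by rewrite mem_filter yv.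
  have gt0 := vs'P _ y's'.
  have -> : dotp (y' - v) u' = dotp (y' - v) u * (dotp (dir y') z - dotp q z).
    by rewrite {1}dirK// dotpZl dotpBr dotpZr dir_u// mulr1.
  have [dq|/(qz _ (map_f dir y's')) dq] := eqVneq (dir y') q.
    by rewrite dq subrr mulr0; split => // _; rewrite -dq -dirK.
  have pos : 0 < dotp (y' - v) u * (dotp (dir y') z - dotp q z).
    by rewrite mulr_gt0// subr_gt0.
  by split; [exact: ltW|move=> h; rewrite h ltxx in pos].
have u'c y' : y' \in vs -> dotp v u' <= dotp y' u'.
  by move=> /u'_ge0[+ _]; rewrite dotpBl subr_ge0.
have [y0 y0s' qE] := mapP qdir.
have qu : dotp q u = 1 by rewrite qE dir_u.
pose Eset := [set x | P x /\ dotp x u' = dotp v u'].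
pose vsE := [seq y <- vs | dotp y u' == dotp v u'].
have y0E : y0 \in vsE.
  rewrite mem_filter; have := y0s'; rewrite mem_filter => /andP[_ ->].
  rewrite andbT -subr_eq0 -dotpBl dirK// dotpZl -qE dotpBr dotpZr.
  by rewrite qu mulr1 subrr mulr0.
have vsE0 : vsE != [::] by apply: contraTneq y0E => ->.
(* The point of [vs] farthest from [v] on that ray is the other end of the edge. *)
have [be beE bmin] := seq_argmin (fun y => - dotp (y - v) u) vsE0.
have [bes beu'] : be \in vs /\ dotp be u' = dotp v u'.
  by move: beE; rewrite mem_filter => /andP[/eqP].
have be_gt0 : 0 < dotp (be - v) u.
  have := bmin _ y0E; rewrite lerN2; apply: lt_le_trans; exact: vs'P.
have beq : be - v = dotp (be - v) u *: q.
  by apply: (u'_ge0 _ bes).2; rewrite dotpBl beu' subrr.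
have bev : v != be.
  by apply: contraTneq be_gt0 => <-; rewrite subrr dotp0l ltxx.
have E_seg : Eset = segment v be.
  apply/seteqP; split => x' /=.
    move=> [xP' xu']; have [w [w0 w1 xE wE]] := conv_face_weights xP' u'c xu'.
    have wq i : w i *: (vs`_i - v) = (w i * dotp (vs`_i - v) u) *: q.
      have [->|/wE h] := eqVneq (w i) 0; first by rewrite mul0r !scale0r.
      rewrite -scalerA -(u'_ge0 _ (mem_nth 0 (ltn_ord i))).2//.
      by rewrite dotpBl h subrr.
    have xq : x' - v = (\sum_i w i * dotp (vs`_i - v) u) *: q.
      rewrite scaler_suml -(eq_bigr _ (fun i _ => wq i)).
      under eq_bigr do rewrite scalerBr.
      by rewrite sumrB -xE -scaler_suml w1 scale1r.
    set s := \sum_i _ in xq; exists (s / dotp (be - v) u).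
      rewrite /= in_itv/= divr_ge0 ?(ltW be_gt0)//=; last first.
        apply: sumr_ge0 => i _; rewrite mulr_ge0//.
        have := mem_nth 0 (ltn_ord i); have [->|ne] := eqVneq (vs`_i) v.
          by rewrite subrr dotp0l.
        by move=> h; apply/ltW/vs'P; rewrite mem_filter ne.
      rewrite ler_pdivrMr// mul1r -[leRHS]mul1r -w1 mulr_suml; apply: ler_sum => i _.
      have [->|/wE h] := eqVneq (w i) 0; first by rewrite !mul0r.
      rewrite ler_wpM2l//; have := bmin vs`_i; rewrite lerN2; apply.
      by rewrite mem_filter h eqxx mem_nth.
    have -> : x' = v + s *: q by rewrite -xq addrC subrK.
    have -> : s *: q = (s / dotp (be - v) u) *: (be - v).
      have := congr1 ( *:%R (s / dotp (be - v) u)) beq.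
      by rewrite scalerA divfK ?lt0r_neq0.
    by rewrite scalerBl scale1r scalerBr -addrA (addrC (- _)).
  move=> [t]; rewrite /= in_itv/= => t01 <-; split.
    apply: conv_segment => //; [exact: vertexP|exact: conv_mem].
  by rewrite dotpDl !dotpZl beu'; lra.
have edgeEset : edge P Eset.
  split; last by exists v, be.
  split; first by exists v; split => //; exact: vertexP.
  split; first by move=> x' [].
  have [u'0|u'0] := eqVneq u' 0.
    by left; apply/seteqP; split => x'; [by case|by rewrite /Eset /= u'0 !dotp0r].
  right; exists u', (dotp v u'); split => //; split => // x' xP'.
  exact: conv_ge xP' u'c.
have [i Ei] := edge_at edgeEset (conj vertexP erefl).
have [t t0 rowi] := rowW i.
have [s s0 biq] : exists2 s, 0 <= s & b i - v = s *: q.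
  have : Eset (b i).
    have [_ Eib] := edgeE i; rewrite Ei Eib; exists 1.
      by rewrite /= in_itv/= ler01 lexx.
    by rewrite subrr scale0r add0r scale1r.
  rewrite E_seg => -[s]; rewrite /= in_itv/= => /andP[s0 s1] bs.
  exists (s * dotp (be - v) u); first by rewrite mulr_ge0// ltW.
  rewrite -scalerA -beq -bs scalerBl scale1r scalerBr.
  by rewrite addrAC [_ + _ - v]addrAC subrr add0r addrC.
(* Row [i] of [W] is [t * s] times [q], and its coordinate [j] is 0 or 1, while that of [q] is
   negative. So [t * s] is 0, although no row of [W] is 0. *)
have := dotp_dualvec Wu i j; rewrite rowi biq !dotpZl => ij.
have ts0 : t * s = 0.
  apply/le_anti; rewrite mulr_ge0 ?(ltW t0)// andbT.
  by rewrite -(nmulr_lge0 _ dirneg) -mulrA ij ler0n.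
have /eqP := dotp_dualvec Wu i i; rewrite rowi biq scalerA ts0 scale0r dotp0l.
by rewrite eqxx eq_sym oner_eq0.
Qed.

Definition dual_facet j : set V := [set x | P x /\ dotp x (dv j) = dotp v (dv j)].

Lemma dual_facetE j x : dual_facet j x <-> P x /\ dotp (x - v) (dv j) = 0.
Proof. by rewrite dotpBl; split=> -[xP h]; split => //; [rewrite h subrr|apply/eqP; rewrite -subr_eq0 h]. Qed.

(** A normal of [F] pairs nonnegatively with every row of [W], and positively with some row [j]. On
    [F] a sum of nonnegative terms vanishes, so coordinate [j] is constant on [F]; both normals are
    then orthogonal to the facet, hence parallel. *)
Lemma facet_at_vertex F : facet P F -> F v -> exists j, F = dual_facet j.
Proof.
move=> fF Fv; case: (fF) => [[_ [_ FE]] [FP _]].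
case: FE => [//|[u [c [u0 [uc FE]]]]].
have vc : dotp v u = c by move: Fv; rewrite FE => -[].
have [j uj] : exists j, 0 < dotp (row j W) u.
  apply: contrapT => /forallNP h; move/eqP: u0; apply; apply: (basis_eq0 Wu) => i.
  apply/le_anti; rewrite (row_ge0 _ uc vc) andbT leNgt; exact/negP/h.
have Fj x : F x -> dotp x (dv j) = dotp v (dv j).
  rewrite FE => -[xP xc]; apply/eqP; rewrite -subr_eq0 -dotpBl.
  have : dotp (x - v) u = 0 by rewrite dotpBl xc vc subrr.
  rewrite (dotp_expand Wu) => /eqP; rewrite psumr_eq0; last first.
    by move=> i _; rewrite mulr_ge0 ?vertex_cone// (row_ge0 _ uc vc).
  move=> /allP /(_ j (mem_index_enum _)); rewrite mulf_eq0 => /orP[//|].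
  by rewrite (gt_eqF uj).
have Fu x : F x -> dotp x u = c by rewrite FE => -[].
have [a ua] := facet_normal_parallel fF Fu Fj (dualvec_neq0 Wu j).
exists j; apply/seteqP; split => x.
  by move=> Fx; split; [move: Fx; rewrite FE => -[]|exact: Fj].
by move=> [xP xj]; rewrite FE; split => //; rewrite -vc ua !dotpZr xj.
Qed.

Lemma facet_normal j u c : facet P (dual_facet j) -> u != 0 ->
  (forall x, P x -> c <= dotp x u) -> dual_facet j = [set x | P x /\ dotp x u = c] ->
  exists2 a, 0 < a & u = a *: dv j.
Proof.
move=> fF u0 uc FE.
have Fv : dual_facet j v by split => //; exact: vertexP.
have vc : dotp v u = c by move: Fv; rewrite FE => -[].
have Fu x : dual_facet j x -> dotp x u = c by rewrite FE => -[].
have Fj x : dual_facet j x -> dotp x (dv j) = dotp v (dv j) by case.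
have [a ua] := facet_normal_parallel fF Fu Fj (dualvec_neq0 Wu j).
exists a => //; rewrite lt_neqAle; apply/andP; split.
  by apply: contra u0 => /eqP a0; rewrite ua -a0 scale0r.
by have := row_ge0 j uc vc; rewrite ua dotpZr dotp_dualvec// eqxx mulr1.
Qed.

Lemma facet_dualvec j : facet P (dual_facet j).
Proof.
have bj i k : dotp (b i - v) (dv k) = 0 <-> i != k.
  have [t t0 rowi] := rowW i; have := dotp_dualvec Wu i k; rewrite rowi dotpZl.
  case: eqVneq => _ /= h; split => // h0.
    by move/eqP: h; rewrite h0 mulr0 eq_sym oner_eq0.
  by move/eqP: h; rewrite mulf_eq0 (gt_eqF t0) => /eqP.
have Fv : dual_facet j v by split => //; exact: vertexP.
split.
  split; first by exists v.
  split; first by move=> x [].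
  right; exists (dv j), (dotp v (dv j)); split; first exact: dualvec_neq0.
  split => // x xP; have := vertex_cone j xP.
  by rewrite dotpBl subr_ge0.
split.
  move=> FP; have : dual_facet j (b j) by rewrite FP; exact: edge_endP.
  by move=> /dual_facetE[_ /bj]; rewrite eqxx.
have [t ht] : exists t : 'I_n -> R, forall i, 0 < t i /\ row i W = t i *: (b i - v).
  have h i : exists t, 0 < t /\ row i W = t *: (b i - v).
    by have [t t0 rowi] := rowW i; exists t.
  by have [t ht] := boolp.choice h; exists t.
pose X : 'M[R]_(n.-1, n) := \matrix_i (b (lift j i) - v).
exists v, X; split => // [i|].
  rewrite rowK addrC subrK; apply/dual_facetE; split; first exact: edge_endP.
  by apply/bj; rewrite eq_sym neq_lift.
apply/eqP; apply/row_freeP.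
(* A right inverse made of dual vectors: row [i] of [W] is [t i] times the edge vector, so the
   factor [t] makes the pairing 1. *)
exists (\matrix_(k, i) (t (lift j i) * dv (lift j i) 0 k)).
apply/matrixP => i i'; rewrite !mxE.
transitivity (dotp (row i X) (t (lift j i') *: dv (lift j i'))).
  by rewrite dotpE; apply: eq_bigr => k _; rewrite !mxE.
rewrite rowK dotpZr; have [->|ii'] := eqVneq i i'.
  have [_ rowi] := ht (lift j i').
  by rewrite -dotpZl -rowi dotp_dualvec// eqxx.
suff -> : dotp (b (lift j i) - v) (dv (lift j i')) = 0 by rewrite mulr0.
by apply/bj; apply: contra ii' => /eqP /lift_inj ->.
Qed.

End VertexCone.

(** * Lattices and facet normals *)

Section Lattices.
Variables (R : realType) (n : nat).
Local Notation V := 'rV[R]_n.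
Implicit Types (x y u : V) (N : set V) (W B : 'M[R]_n).

Lemma dual_latticeD N u u' : dual_lattice N u -> dual_lattice N u' -> dual_lattice N (u + u').
Proof. by move=> hu hu' x Nx; rewrite dotpDr rpredD ?hu ?hu'. Qed.

Lemma dual_latticeN N u : dual_lattice N u -> dual_lattice N (- u).
Proof. by move=> hu x Nx; rewrite dotpNr rpredN hu. Qed.

Lemma dual_latticeMn N u m : dual_lattice N u -> dual_lattice N (m%:R *: u).
Proof. by move=> hu x Nx; rewrite dotpZr rpredM ?hu// rpred_nat. Qed.

Lemma intvecE (c : 'rV[int]_n) i : intvec R c 0 i = (c 0 i)%:~R.
Proof. by rewrite mxE. Qed.

Lemma lattice_of_row W i : lattice_of W (row i W).
Proof.
exists (delta_mx 0 i) => //; rewrite (_ : intvec R _ = delta_mx 0 i) -?rowE//.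
by apply/rowP => j; rewrite !mxE; case: andP.
Qed.

Lemma dual_lattice_ofP W u :
  dual_lattice (lattice_of W) u <-> forall i, dotp (row i W) u \is a Num.int.
Proof.
split=> [h i|h x [c _ <-]]; first by apply: h; exact: lattice_of_row.
rewrite mulmx_sum_row dotp_suml rpred_sum// => i _.
by rewrite dotpZl intvecE rpredM// intr_int.
Qed.

Lemma dual_lattice_dualvec W j : W \in unitmx -> dual_lattice (lattice_of W) (dualvec W j).
Proof.
by move=> Wu; apply/dual_lattice_ofP => i; rewrite dotp_dualvec// rpred_nat.
Qed.

Lemma lattice_of_unitmx B W : B \in unitmx -> lattice_of B = lattice_of W -> W \in unitmx.
Proof.
move=> Bu BW; have /boolp.choice[c hc] i : exists c, row i B = intvec R c *m W.
  by have := lattice_of_row B i; rewrite BW => -[c _ <-]; exists c.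
have : B = (\matrix_i intvec R (c i)) *m W.
  by apply/row_matrixP => i; rewrite row_mul rowK.
by move=> BE; move: Bu; rewrite BE unitmx_mul => /andP[].
Qed.

Lemma lattice_basisP N : is_lattice N ->
  lattice_basis N \in unitmx /\ N = lattice_of (lattice_basis N).
Proof. by move=> [B Bu NB]; apply: (@xgetPex _ 0 [set B | B \in unitmx /\ N = lattice_of B]); exists B. Qed.

(* [N] plays the role of [L] or of a lattice between [L] and [p^-1 L]. *)
Definition between (p : nat) L N :=
  L `<=` N /\ forall u, dual_lattice L u -> dual_lattice N (p%:R *: u).

Definition eps (p : nat) N u : nat := if `[< dual_lattice N u >] then 1%N else p.

Lemma eps_gt0 p N u : prime p -> (0 < eps p N u)%N.
Proof. by move=> pp; rewrite /eps; case: ifP => // _; exact: prime_gt0. Qed.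

Lemma dual_lattice_eps p L N u : between p L N -> dual_lattice L u ->
  dual_lattice N ((eps p N u)%:R *: u).
Proof.
move=> [_ hp] hu; rewrite /eps; case: asboolP => [?|_]; last exact: hp.
by rewrite scale1r.
Qed.

(** The integers [m] with [m u] in the dual of [N] form an ideal containing the prime [p]; it is
    generated by 1 or by [p]. *)
Lemma dual_lattice_dvdn p L N u m : prime p -> between p L N -> dual_lattice L u ->
  dual_lattice N (m%:R *: u) -> (eps p N u %| m)%N.
Proof.
move=> pp bw Lu Nm; rewrite /eps; case: asboolP => [//|nN].
apply/negPn/negP => npm; apply: nN.
have cop : coprime m p by rewrite coprime_sym prime_coprime.
have m0 : (0 < m)%N by rewrite lt0n; apply: contraNneq npm => ->; rewrite dvdn0.
have := egcdnP p m0; case: egcdnP => // a c; rewrite (eqP cop) => ac _ _.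
have -> : u = a%:R *: (m%:R *: u) - c%:R *: (p%:R *: u).
  by rewrite !scalerA -!natrM ac natrD scalerDl scale1r addrC addKr.
apply: dual_latticeD; first exact: dual_latticeMn.
by apply: dual_latticeN; apply: dual_latticeMn; exact: bw.2.
Qed.

(** Pairing with [w] shows that [a] is a natural number. It is a multiple of [eps p N u], and
    primitivity leaves only the quotient 1. *)
Lemma primitive_eps p L N u w a : prime p -> between p L N -> dual_lattice L u ->
  N w -> dotp w u = 1 -> 0 < a -> primitive (dual_lattice N) (a *: u) ->
  a = (eps p N u)%:R.
Proof.
move=> pp bw Lu Nw wu a0 [Na _ hprim].
have /natrP[m am] : a \is a Num.nat.
  by rewrite natrEint (ltW a0) andbT; have := Na _ Nw; rewrite dotpZr wu mulr1.
have Nm : dual_lattice N (m%:R *: u) by rewrite -am.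
have /dvdnP[m' mE] := dual_lattice_dvdn pp bw Lu Nm.
have := hprim ((eps p N u)%:R *: u) m' (dual_lattice_eps bw Lu).
by rewrite am mE natrM -scalerA => /(_ erefl) ->; rewrite mul1r.
Qed.

(** Pairing with [w] turns a divisor of the vector into a divisor of [eps p N u], which is 1 or [p].
    The divisor [p] would put [u] itself into the dual of [N]. *)
Lemma eps_primitive p L N u w : prime p -> between p L N -> dual_lattice L u ->
  N w -> dotp w u = 1 -> primitive (dual_lattice N) ((eps p N u)%:R *: u).
Proof.
move=> pp bw Lu Nw wu; split.
- exact: dual_lattice_eps bw Lu.
- rewrite scaler_eq0 negb_or pnatr_eq0 -lt0n eps_gt0//=.
  by apply: contra_eq_neq wu => ->; rewrite dotp0r eq_sym oner_eq0.
- move=> v m Nv uE.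
  have := congr1 (dotp w) uE; rewrite !dotpZr wu mulr1 => eE.
  have /intrP[z zE] := Nv _ Nw.
  have {}eE : (eps p N u = m * `|z|)%N.
    move: eE; rewrite zE -[X in X = _]/((eps p N u)%:~R) -[m%:R]/(m%:~R) -intrM => /eqP.
    by rewrite eqr_int => /eqP/(congr1 absz); rewrite abszM.
  move: eE uE; rewrite /eps; case: asboolP => [_ /esym/eqP|nN].
    by rewrite muln_eq1 => /andP[/eqP].
  move=> pE; have : (m %| p)%N by rewrite pE dvdn_mulr.
  have [_ hp] := primeP pp; move=> /hp /orP[/eqP//|/eqP mp].
  move=> uv; case: nN; suff -> : u = v by [].
  apply: (scalerI (a := p%:R)); first by rewrite pnatr_eq0 -lt0n prime_gt0.
  by rewrite uv mp.
Qed.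

End Lattices.

Section Normals.
Local Notation conv := Defs.conv.
Variables (R : realType) (n : nat).
Local Notation V := 'rV[R]_n.
Variables (vs : seq V) (v : V) (E : 'I_n -> set V) (b : 'I_n -> V) (W : 'M[R]_n).
Local Notation P := (conv vs).
Hypothesis vP : vertex P v.
Hypothesis P_neq : P <> [set v].
Hypothesis Wu : W \in unitmx.
Hypothesis edgeE : forall i, edge P (E i) /\ E i = segment v (b i).
Hypothesis edge_at : forall E', edge P E' -> E' v -> exists i, E' = E i.
Hypothesis rowW : forall i, exists2 t : R, 0 < t & row i W = t *: (b i - v).
Variables (p : nat) (N : set V).
Hypothesis pp : prime p.
Hypothesis bw : between p (lattice_of W) N.

Lemma unormal_dual_facet j : unormal N P (dual_facet vs v W j) =
  (eps p N (dualvec W j))%:R *: dualvec W j.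
Proof.
set u := dualvec W j; set e := (eps p N u)%:R : R.
have fF := facet_dualvec vP P_neq Wu edgeE edge_at rowW j.
have Lu : dual_lattice (lattice_of W) u by exact: dual_lattice_dualvec.
have Nw : N (row j W) by apply: bw.1; exact: lattice_of_row.
have wu : dotp (row j W) u = 1 by rewrite dotp_dualvec// eqxx.
have e0 : 0 < e by rewrite ltr0n eps_gt0.
apply: xget_unique.
  split; first exact: (eps_primitive pp bw Lu Nw wu).
  exists (dotp v (e *: u)); split.
    move=> x xP; rewrite !dotpZr ler_pM2l// -subr_ge0 -dotpBl.
    exact: (vertex_cone vP P_neq Wu edgeE edge_at rowW).
  apply/seteqP; split => x [xP].
    by rewrite -/u => xj; split => //; rewrite !dotpZr xj.
  by rewrite !dotpZr => /(mulfI (lt0r_neq0 e0)) xj; split.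
move=> u' [u'prim [c [u'c FE]]].
have u'0 : u' != 0 by case: u'prim.
have [a a0 u'E] := facet_normal vP Wu edgeE rowW fF u'0 u'c FE.
by rewrite u'E in u'prim *; congr (_ *: _); exact: (primitive_eps pp bw Lu Nw wu).
Qed.

Lemma lambdaN_dual_facet j : lambdaN N P (dual_facet vs v W j) =
  - ((eps p N (dualvec W j))%:R * dotp v (dualvec W j)).
Proof.
apply: xget_unique => /=; rewrite unormal_dual_facet.
  by move=> x [_ xj]; rewrite dotpZr xj subrr.
move=> lam /(_ v) h; apply/eqP; rewrite -addr_eq0 addrC -dotpZr; apply/eqP/h.
by split => //; exact: (vertexP vP).
Qed.

End Normals.

Section FacetNormals.
Local Notation conv := Defs.conv.
Variables (R : realType) (n : nat).
Local Notation V := 'rV[R]_n.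
Variables (vs : seq V) (L : set V).
Local Notation P := (conv vs).
Hypothesis latL : is_lattice L.
Hypothesis nsP : nonsingular L P.
Hypothesis P_thick : exists2 x, P x & exists2 y, P y & x != y.

Lemma P_not_point v : P <> [set v].
Proof.
move=> Pv; have [x + [y +]] := P_thick; rewrite Pv => -> ->.
by rewrite eqxx.
Qed.

Lemma vertex_frame v : vertex P v ->
  exists (E : 'I_n -> set V) (b : 'I_n -> V) (W : 'M[R]_n),
  [/\ W \in unitmx /\ L = lattice_of W,
    forall i, edge P (E i) /\ E i = segment v (b i),
    forall E', edge P E' -> E' v -> exists i, E' = E i &
    forall i, exists2 t : R, 0 < t & row i W = t *: (b i - v)].
Proof.
move=> /nsP [E [b [W [_ hE hE' hW LW]]]]; exists E, b, W; split => //.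
  split => //; have [B Bu LB] := latL.
  by apply: (lattice_of_unitmx Bu); rewrite -LB.
by move=> i; have [] := hW i.
Qed.

Lemma facet_vertex F : facet P F -> exists v, [/\ v \in vs, vertex P v & F v].
Proof. by move=> [/face_vertex[v [vs_v Fv vP]] _]; exists v. Qed.

Lemma between_refl p : between p L L.
Proof. by split => // u; exact: dual_latticeMn. Qed.

(** At a vertex of [F] its normals for [N] and for [L] are multiples of the same dual basis vector;
    for [L] the factor is 1. *)
Lemma facet_normal_data p N F : prime p -> between p L N -> facet P F ->
  unormal N P F = (eps p N (unormal L P F))%:R *: unormal L P F /\
  lambdaN N P F = (eps p N (unormal L P F))%:R * lambdaN L P F.
Proof.
move=> pp bw fF; have [v [_ vP Fv]] := facet_vertex fF.
have [E [b [W [[Wu LW] hE hE' hW]]]] := vertex_frame vP.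
have [j FE] := facet_at_vertex vP (@P_not_point v) Wu hE hE' hW fF Fv.
have bwL := between_refl p; rewrite LW in bw bwL *.
have uL : unormal (lattice_of W) P F = dualvec W j.
  rewrite FE (unormal_dual_facet vP (@P_not_point v) Wu hE hE' hW pp bwL).
  rewrite /eps; case: asboolP => [_|[]]; first by rewrite scale1r.
  exact: dual_lattice_dualvec.
have lL : lambdaN (lattice_of W) P F = - dotp v (dualvec W j).
  rewrite FE (lambdaN_dual_facet vP (@P_not_point v) Wu hE hE' hW pp bwL).
  rewrite /eps; case: asboolP => [_|[]]; first by rewrite mul1r.
  exact: dual_lattice_dualvec.
rewrite uL lL FE (unormal_dual_facet vP (@P_not_point v) Wu hE hE' hW pp bw).
by rewrite (lambdaN_dual_facet vP (@P_not_point v) Wu hE hE' hW pp bw) mulrN.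
Qed.

End FacetNormals.

(** * Derivatives of the volume *)

Section ScaledDerivatives.
Variable R : realType.
Implicit Types (k : R -> R) (c a l : R).

Local Notation quot k := (fun h : R => h^-1 *: (k (h + 0) - k 0)).

Lemma dnbhs0_scale a (P : set R) : a != 0 -> (0 : R)^' P -> (0 : R)^' (fun h => P (a * h)).
Proof.
move=> a0 hP.
have ctsa : (fun h : R => a * h) @ (0 : R) --> (0 : R).
  rewrite -[X in _ --> X](mulr0 a); apply: cvgM; [exact: cvg_cst|exact: cvg_id].
have := ctsa _ hP; apply: (@filterS _ (nbhs (0 : R))) => h Ph h0.
by apply: Ph; rewrite mulf_neq0.
Qed.

Lemma quot_scale k c a l : a != 0 -> quot k @ 0^' --> l ->
  quot (fun t => c * k (a * t)) @ 0^' --> c * a * l.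
Proof.
move=> a0 kl.
have kal : (fun h => quot k (a * h)) @ 0^' --> l.
  by move=> P hP; exact: (dnbhs0_scale a0 (kl P hP)).
have K : (fun h => c * a * quot k (a * h)) @ 0^' --> c * a * l.
  by apply: cvgM; [exact: cvg_cst|exact: kal].
have E : {near 0^', (fun h => c * a * quot k (a * h)) =1 quot (fun t => c * k (a * t))}.
  near=> h; have h0 : h != 0 by near: h; exact: (@nbhs_dnbhs_neq R 0).
  rewrite /= !addr0 mulr0 -mulrBr /GRing.scale /=.
  by field; rewrite h0 a0.
exact: cvg_trans (near_eq_cvg E) K.
Unshelve. all: end_near. Qed.

(** If the derivative of [k] does not exist, neither does that of the scaled function, as the
    scaling can be inverted. Both sides are then 0, the default value of the limit. *)
Lemma derive1_scale k c a : a != 0 -> c != 0 ->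
  derive1 (fun t => c * k (a * t)) 0 = c * a * derive1 k 0.
Proof.
move=> a0 c0; rewrite /derive1.
have [/cvg_ex[l kl]|nk] := pselect (cvg (quot k @ 0^')).
  have kl' := @quot_scale k c a l a0 kl.
  by rewrite (cvg_lim _ kl)// (cvg_lim _ kl').
have /= -> := dvgP nk; transitivity (point : R); last by rewrite mulr0.
apply: dvgP; move=> /cvg_ex[l kl]; apply: nk.
have kl' := @quot_scale (fun t => c * k (a * t)) c^-1 a^-1 l (invr_neq0 a0) kl.
have kE : k = fun t => c^-1 * (fun t => c * k (a * t)) (a^-1 * t).
  by apply/funext => t; rewrite mulVKf// mulKf.
rewrite kE; exact: cvgP kl'.
Qed.

Variable n : nat.
Variable s : set 'rV[R]_n -> R.
Hypothesis s_neq0 : forall F, s F != 0.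
Implicit Types (g : (set 'rV[R]_n -> R) -> R).

Definition rescale g : (set 'rV[R]_n -> R) -> R := fun h => g (fun G => s G * h G).

Lemma dpartial_rescale F g c : c != 0 ->
  dpartial F (fun h => c * rescale g h) = fun h => (c * s F) * rescale (dpartial F g) h.
Proof.
move=> c0; apply/funext => h; rewrite /dpartial /rescale -derive1_scale//.
congr (derive1 _ 0); apply/funext => t; congr (c * g _).
by apply/funext => G; rewrite mulrDr; case: asboolP => [->//|_]; rewrite !mulr0.
Qed.

Lemma dpartial_iter_rescale m F g c : c != 0 ->
  dpartial_iter m F (fun h => c * rescale g h) =
  fun h => (c * s F ^+ m) * rescale (dpartial_iter m F g) h.
Proof.
move=> c0; elim: m => [|m IH] /=; first by rewrite expr0 mulr1.
rewrite IH dpartial_rescale; last by rewrite mulf_neq0// expf_neq0.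
by rewrite exprSr mulrA.
Qed.

Lemma dop_rescale r (Fs : 'I_r -> set 'rV[R]_n) (pi : 'I_r -> nat) g c : c != 0 ->
  dop Fs pi (fun h => c * rescale g h) (fun=> 0) =
  c * (\prod_i s (Fs i) ^+ pi i) * dop Fs pi g (fun=> 0).
Proof.
move=> c0; rewrite -big_enum /dop /=.
suff -> : foldr (fun i acc => dpartial_iter (pi i) (Fs i) acc)
    (fun h => c * rescale g h) (enum 'I_r) =
    (fun h => (c * \prod_(i <- enum 'I_r) s (Fs i) ^+ pi i) *
      rescale (foldr (fun i acc => dpartial_iter (pi i) (Fs i) acc) g (enum 'I_r)) h).
  rewrite /rescale (_ : (fun G => s G * 0) = fun=> 0)//.
  by apply/funext => G; rewrite mulr0.
elim: (enum 'I_r) => [|i l IH] /=; first by rewrite big_nil mulr1.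
rewrite IH dpartial_iter_rescale.
  by rewrite big_cons [s (Fs i) ^+ _ * _]mulrC mulrA.
rewrite mulf_neq0//; elim: l {IH} => [|j l IH]; first by rewrite big_nil oner_neq0.
by rewrite big_cons mulf_neq0// expf_neq0.
Qed.

End ScaledDerivatives.

Lemma all_InP (T : Type) (p : pred T) s :
  all p s <-> forall t, List.In t s -> p t.
Proof.
elim: s => [//|t s IH] /=; split=> [/andP[pt /IH h] t' [<-//|/h]//|h].
by apply/andP; split; [apply: h; left|apply/IH => t' ts; apply: h; right].
Qed.

(** * The polytopes with shifted facets and their volume *)

Section ShiftedPolytope.
Local Notation conv := Defs.conv.
Variables (R : realType) (n : nat).
Local Notation V := 'rV[R]_n.
Variables (vs : seq V) (L : set V).
Local Notation P := (conv vs).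
Hypothesis latL : is_lattice L.
Hypothesis nsP : nonsingular L P.
Hypothesis P_thick : exists2 x, P x & exists2 y, P y & x != y.

Definition eps_inv p N F : R := (eps p N (unormal L P F))%:R^-1.

Lemma eps_inv_neq0 p N F : prime p -> eps_inv p N F != 0.
Proof. by move=> pp; rewrite invr_neq0// pnatr_eq0 -lt0n eps_gt0. Qed.

(** Normal and constant of a facet are both multiplied by [eps], so dividing its inequality by [eps]
    only rescales the height. *)
Lemma PNh_rescale p N h : prime p -> between p L N ->
  PNh N P h = PNh L P (fun F => eps_inv p N F * h F).
Proof.
move=> pp bw; apply/seteqP; split => x hx F fF; have := hx F fF.
all: have [-> ->] := facet_normal_data latL nsP P_thick pp bw fF.
all: rewrite /eps_inv dotpZr; set e := (eps _ _ _)%:R.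
all: have e0 : 0 < e by rewrite ltr0n eps_gt0.
all: have -> : e * dotp x (unormal L P F) + e * lambdaN L P F + h F =
  e * (dotp x (unormal L P F) + lambdaN L P F + e^-1 * h F) by field; rewrite lt0r_neq0.
all: by rewrite pmulr_rge0.
Qed.

(** Each facet contains a vertex taken from [vs], where it is one of [n] dual facets. The list may
    contain sets that are not facets, whence the test in the constraints of [vol_germ]. *)
Lemma facets_finite : exists (T : Type) (s : seq T) (g : T -> set V),
  forall F, facet P F -> exists2 t, List.In t s & F = g t.
Proof.
have /boolp.choice[W hW] v : exists W : 'M[R]_n, vertex P v -> forall F, facet P F -> F v ->
    exists j, F = dual_facet vs v W j.
  have [vP|nv] := pselect (vertex P v); last by exists 0 => /nv.
  have [E [b [W [[Wu LW] hE hE' hW]]]] := vertex_frame latL nsP vP.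
  by exists W => _; exact: (facet_at_vertex vP (@P_not_point _ _ _ P_thick v) Wu hE hE' hW).
exists (V * 'I_n)%type, (allpairs pair vs (enum 'I_n)).
exists (fun vj => dual_facet vs vj.1 (W vj.1) vj.2) => F fF.
have [v [vs_v vP Fv]] := facet_vertex fF; have [j Fj] := hW v vP F fF Fv.
exists (v, j) => //.
suff in_List (T : eqType) (s : seq T) t : t \in s -> List.In t s.
  by apply: in_List; rewrite allpairs_f// mem_enum.
by elim: s => [//|t' s IH]; rewrite inE => /predU1P[->|/IH]; [left|right].
Qed.

(** At a vertex that minimizes [a] on [P], the [n] facet inequalities bound the coordinates of
    [x - v] below by -1, and [a] pairs nonnegatively with the edge directions. *)
Lemma PNh_lower_bound a : exists c, forall h, (forall F, `|h F| <= 1) ->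
  forall x, PNh L P h x -> c <= dotp x a.
Proof.
have P0 : P !=set0 by have [x xP _] := P_thick; exists x.
have [v [_ vin vP vmin]] := min_vertex a P0.
have [E [b [W [[Wu LW] hE hE' hW]]]] := vertex_frame latL nsP vP.
exists (dotp v a - \sum_j dotp (row j W) a) => h h1 x hx.
suff : - \sum_j dotp (row j W) a <= dotp (x - v) a by rewrite dotpBl; lra.
rewrite (dotp_expand Wu) -sumrN; apply: ler_sum => j _.
(* The description of normals is stated for a prime; for [L] itself any prime will do, and 2 is
   chosen. *)
have bw : between 2 (lattice_of W) L by rewrite -LW; exact: between_refl.
have e1 : eps 2 L (dualvec W j) = 1%N.
  by rewrite /eps; case: asboolP => // -[]; rewrite LW; exact: dual_lattice_dualvec.
have npt := @P_not_point _ _ _ P_thick v.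
have := hx _ (facet_dualvec vP npt Wu hE hE' hW j).
rewrite (unormal_dual_facet vP npt Wu hE hE' hW (isT : prime 2) bw).
rewrite (lambdaN_dual_facet vP npt Wu hE hE' hW (isT : prime 2) bw).
rewrite e1 scale1r mul1r -dotpBl; set F := dual_facet _ _ _ _ => hF.
have := h1 F; rewrite ler_norml => /andP[_ hF1].
have W0 : 0 <= dotp (row j W) a by exact: (row_ge0 hE hW j vmin).
by rewrite -[leLHS]mulN1r ler_wpM2r//; lra.
Qed.

Lemma PNh_bounded : exists B, forall h, (forall F, `|h F| <= 1) ->
  forall x, PNh L P h x -> forall i, `|x 0 i| <= B.
Proof.
have /boolp.choice[c hc] a := PNh_lower_bound a.
pose d i : V := delta_mx 0 i.
have dE x i : dotp x (d i) = x 0 i.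
  rewrite dotpE (bigD1 i)//= big1 => [|j ji]; first by rewrite mxE !eqxx mulr1 addr0.
  by rewrite mxE (negbTE ji) andbF mulr0.
exists (\sum_i (`|c (d i)| + `|c (- d i)|)) => h h1 x hx i.
rewrite (bigD1 i)//= -[leLHS]addr0; apply: lerD; last first.
  by apply: sumr_ge0 => j _; exact: addr_ge0.
have := hc (d i) h h1 x hx; have := hc (- d i) h h1 x hx.
rewrite dotpNr dE ler_norml => u1 u2.
have := ler_norm (- c (d i)); have := ler_norm (- c (- d i)).
have := normr_ge0 (c (d i)); have := normr_ge0 (c (- d i)).
by rewrite !normrN => ? ? ? ?; apply/andP; split; lra.
Qed.

Variables (r : nat) (Fs : 'I_r -> set V).
Hypothesis Fs_inj : injective Fs.

(** The variables below [r] are the heights and the next [n] are the coordinates of the point. Its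
    indicator has degree 0, and each of the [n] integrations raises the degree by at most 1. *)
Lemma vol_germ : germ n.+1 r (fun e => vol (PNh L P (heights Fs e))).
Proof.
have [T [s [g sg]]] := facets_finite; have [B hB] := PNh_bounded.
pose cstr t (e : nat -> R) := if `[< facet P (g t) >] then
  dotp (\row_(i < n) e (r + i)%N) (unormal L P (g t)) + lambdaN L P (g t) +
  heights Fs e (g t) else 0.
(* [B] bounds the polytope only for heights of absolute value at most 1. The box makes the support
   bounded for all heights and changes nothing near 0. *)
pose box (e : nat -> R) := if all (fun a : (nat -> R) -> R => 0 <= a e)
  (map (fun (i : 'I_n) (e : nat -> R) => B - e (r + i)%N) (enum 'I_n) ++
   map (fun (i : 'I_n) (e : nat -> R) => B + e (r + i)%N) (enum 'I_n)) then 1 else 0 : R.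
pose f (e : nat -> R) := if all (fun a : (nat -> R) -> R => 0 <= a e) (map cstr s)
  then box e else 0.
have affine_cstr t : polyf 1 (cstr t).
  rewrite /cstr; case: (asboolP (facet P (g t))) => _; last exact: polyf_cst.
  apply: polyf_add; [apply: polyf_add|].
  - under [X in polyf _ X]eq_fun do rewrite dotpE.
    apply: polyf_sum => i; under [X in polyf _ X]eq_fun do rewrite mxE mulrC.
    by apply: polyfZ; exact: polyf_var.
  - exact: polyf_cst.
  - apply: polyf_sum => i; case: (asboolP (g t = Fs i)) => _; [exact: polyf_var|exact: polyf_cst].
have pwf : pwpoly 0 f.
  apply: pwpoly_all => [a /List.in_map_iff[t [<- _]]//|].
  apply: pwpoly_all => [a /List.in_app_iff[]/List.in_map_iff[i [<- _]]|].
  - by apply: polyfB; [exact: polyf_cst|exact: polyf_var].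
  - by apply: polyf_add; [exact: polyf_cst|exact: polyf_var].
  - exact: pwpoly_cst.
have boxP (e : nat -> R) : box e = if `[< forall i : 'I_n, `|e (r + i)%N| <= B >] then 1 else 0.
  rewrite /box all_cat !all_map; congr (if _ then _ else _).
  apply/idP/asboolP => [/andP[/allP h1 /allP h2] i|h].
    have ie : i \in Finite.enum 'I_n by rewrite -enumT mem_enum.
    have := h1 i ie; have := h2 i ie => /= ? ?.
    by rewrite ler_norml; apply/andP; split; lra.
  by apply/andP; split; apply/allP => i _ /=; have := h i; rewrite ler_norml => /andP[? ?]; lra.
have suppf : supp_block B n r f.
  move=> i /andP[ri im] e Be; rewrite /f boxP.
  have ir : (i - r < n)%N by lia.
  case: (asboolP (forall i : 'I_n, _)) => [/(_ (Ordinal ir))|_]; last by case: ifP.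
  by rewrite /= subnKC// leNgt Be.
have := @pwpoly_germ R _ r _ (iterint_pwpoly pwf suppf); rewrite add0n => gJ.
apply: (germ_eq (ltr01 : 0 < 1 :> R) gJ) => e e1; apply/esym; apply: vol_iterint => e' ee'.
have hE : heights Fs e' = heights Fs e.
  by apply/funext => F; apply: eq_bigr => i _; rewrite ee'.
have h1 F : `|heights Fs e F| <= 1.
  have [[i ->]|nF] := pselect (exists i, F = Fs i).
    by rewrite heights_Fs// ltW.
  by rewrite heights_other ?normr0// => i Fi; apply: nF; exists i.
have allE : all (fun a : (nat -> R) -> R => 0 <= a e') (map cstr s) <->
    PNh L P (heights Fs e) (\row_i e' (r + i)%N).
  rewrite all_map; split => [h F fF|h].
    have [t ts Ft] := sg F fF.
    have := (all_InP _ _).1 h t ts.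
    by rewrite /= /cstr -Ft hE; case: (asboolP (facet P F)).
  apply/all_InP => t ts /=.
  by rewrite /cstr; case: (asboolP (facet P (g t))) => // fF; rewrite hE; exact: h.
rewrite /f boxP; case: (asboolP (PNh _ _ _ _)) => [inP|nP].
  rewrite (allE.2 inP); case: asboolP => // nb; case: nb => i.
  by have := hB _ h1 _ inP i; rewrite mxE.
by case: ifP => // /allE.
Qed.

End ShiftedPolytope.

(** * Todd coefficients *)

Section ToddCoefficients.
Variable R : realType.
Local Notation C := R[i].
Implicit Types (a : C) (c : nat -> C).

Definition expN (j : nat) : C := (-1) ^+ j / (j`!)%:R.

Lemma todd_expansionE a c : todd_expansion a c <-> forall m,
  ((m == 1%N)%:R : C) = (1 - a) * c m - a * \sum_(j < m) expN j.+1 * c (m - j.+1)%N.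
Proof.
have E m : c m - a * \sum_(j < m.+1) (-1) ^+ j / j`!%:R * c (m - j)%N =
    (1 - a) * c m - a * \sum_(j < m) expN j.+1 * c (m - j.+1)%N.
  by rewrite big_ord_recl /= expr0 fact0 divr1 mul1r subn0 mulrDr opprD addrA mulrBl mul1r.
by split=> h m; rewrite (h m) E.
Qed.

Lemma expN1 : expN 1 = -1.
Proof. by rewrite /expN expr1 factS fact0 divr1. Qed.

(** For [a != 1] the equation of index [m] determines [c m]. For [a = 1] its leading coefficient is
    0, and [c m] is determined by the equation of index [m + 1], where its coefficient is 1. *)
Lemma todd_unique a c c' : todd_expansion a c -> todd_expansion a c' -> c = c'.
Proof.
rewrite !todd_expansionE => hc hc'; apply/funext => m.
have [m' mm'] : exists m', (m < m')%N by exists m.+1.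
elim: m' m mm' => [//|m' IH] m; rewrite ltnS leq_eqVlt => /predU1P[->|]; last exact: IH.
have [a1|a1] := eqVneq a 1.
  have := hc m'.+1; rewrite (hc' m'.+1) a1 subrr !mul0r !sub0r !mul1r.
  rewrite !big_ord_recl /= expN1 subSS subn0 => /oppr_inj.
  rewrite (eq_bigr (fun i : 'I_m' => expN (bump 0 i).+1 * c (m'.+1 - (bump 0 i).+1)%N)).
    by move=> /addIr; rewrite !mulN1r => /oppr_inj ->.
  by move=> i _; rewrite IH//; have := ltn_ord i; rewrite /bump /=; lia.
have := hc m'; rewrite (hc' m') (eq_bigr (fun j : 'I_m' => expN j.+1 * c (m' - j.+1)%N)).
  by move=> /addIr /mulfI ->//; rewrite subr_eq0 eq_sym.
by move=> i _; rewrite IH//; have := ltn_ord i; lia.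
Qed.

Fixpoint table (G : (nat -> C) -> nat -> C) (m : nat) : seq C :=
  if m is m'.+1 then rcons (table G m') (G (nth 0 (table G m')) m') else [::].

Lemma strong_recursion (G : (nat -> C) -> nat -> C) :
  (forall f f' m, (forall i, (i < m)%N -> f i = f' i) -> G f m = G f' m) ->
  exists f, forall m, f m = G f m.
Proof.
move=> Gloc; have st m : size (table G m) = m.
  by elim: m => //= m IH; rewrite size_rcons IH.
exists (fun m => nth 0 (table G m.+1) m) => m /=.
rewrite nth_rcons st ltnn eqxx; apply: Gloc => i.
elim: m => [//|m IH]; rewrite ltnS leq_eqVlt => /predU1P[->|im].
  by rewrite /= !nth_rcons st ltnn eqxx.
by rewrite -(IH im) /= [in LHS]nth_rcons st im.
Qed.

(** The equations are solved for [c m] with the same shift of the index for [a = 1]; there the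
    equation of index 0 reads 0 = 0. *)
Lemma todd_exists a : exists c, todd_expansion a c.
Proof.
have [a1|a1] := eqVneq a 1.
  pose G (f : nat -> C) m := (m == 0%N)%:R +
    \sum_(i < m) expN i.+2 * f (m.+1 - i.+2)%N : C.
  have [f fG] : exists f, forall m, f m = G f m.
    apply: strong_recursion => f f' m ff'; rewrite /G; congr (_ + _).
    by apply: eq_bigr => i _; rewrite ff'//; have := ltn_ord i; lia.
  exists f; apply/todd_expansionE => m; rewrite a1 subrr mul0r sub0r mul1r.
  case: m => [|m]; first by rewrite big_ord0 oppr0.
  rewrite big_ord_recl /= expN1 subSS subn0 {1}fG /G mulN1r eqSS.
  rewrite (eq_bigr (fun i : 'I_m => expN i.+2 * f (m.+1 - i.+2)%N)).
    by rewrite opprD opprK addrK.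
  by move=> i _; rewrite /bump /=.
have a1' : 1 - a != 0 by rewrite subr_eq0 eq_sym.
pose G (f : nat -> C) m := (1 - a)^-1 *
  ((m == 1%N)%:R + a * \sum_(i < m) expN i.+1 * f (m - i.+1)%N).
have [f fG] : exists f, forall m, f m = G f m.
  apply: strong_recursion => f f' m ff'; rewrite /G; congr (_ * (_ + _ * _)).
  by apply: eq_bigr => i _; rewrite ff'//; have := ltn_ord i; lia.
exists f; apply/todd_expansionE => m.
by rewrite {1}fG /G mulVKf// addrK.
Qed.

Lemma ccoefP a : todd_expansion a (ccoef a).
Proof.
have [c hc] := todd_exists a.
exact: (@xgetPex _ (fun=> 0) [set c | todd_expansion a c]) (ex_intro _ c hc).
Qed.

Lemma ccoef_eq a c : todd_expansion a c -> ccoef a = c.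
Proof. by move=> hc; apply: todd_unique hc; exact: ccoefP. Qed.

(** Congruence modulo the [K]-th power of ['X]: polynomials stand for truncated power series. *)
Definition cong_below (K : nat) (u v : {poly C}) := forall s, (s < K)%N -> u`_s = v`_s.

Lemma cong_belowM K (w u v : {poly C}) : cong_below K u v -> cong_below K (w * u) (w * v).
Proof.
move=> h s sK; rewrite !coefM; apply: eq_bigr => j _.
by rewrite h// (leq_ltn_trans (leq_subr _ _)).
Qed.

Definition exp_poly (K : nat) : {poly C} := \poly_(j < K) expN j.

Lemma coef_exp_polyX K i s : (s < K)%N ->
  (exp_poly K ^+ i)`_s = (- i%:R) ^+ s / (s`!)%:R.
Proof.
elim: i s => [|i IH] s sK.
  rewrite expr0 coef1 oppr0 expr0n; case: s sK => [|s] _ /=; last by rewrite mul0r.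
  by rewrite fact0 divr1.
rewrite exprSr coefM -[i.+1]add1n natrD opprD exprDn mulr_suml; apply: eq_bigr => j _.
have js : (j <= s)%N by rewrite -ltnS.
have sjK : (s - j < K)%N by exact: leq_ltn_trans (leq_subr _ _) sK.
have fact_neq0 t : (t`!)%:R != 0 :> C by rewrite pnatr_eq0 -lt0n fact_gt0.
rewrite IH ?(leq_ltn_trans js)// coef_poly sjK /expN -mulr_natr -(bin_fact js) !natrM.
have bin0 : ('C(s, j))%:R != 0 :> C by rewrite pnatr_eq0 -lt0n bin_gt0.
by field; rewrite !fact_neq0 bin0.
Qed.

(** With [q] the series of [exp (- x)], the quotient of [1 - q ^ p] by [1 - z ^ m q] is the sum of
    the [(z ^ m q) ^ i] for [i < p]. Summed over [m], only [i = 0] survives, so the series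
    [x / (1 - z ^ m q)] add up to [p x / (1 - exp (- p x))]. This is the series for [a = 1]
    evaluated at [p x]. *)
Lemma sum_ccoef_roots p (z : C) s : (0 < p)%N -> z ^+ p = 1 ->
  (forall i, (0 < i < p)%N -> \sum_(m < p) (z ^+ m) ^+ i = 0) ->
  \sum_(m < p) ccoef (z ^+ m) s = p%:R ^+ s * ccoef 1 s.
Proof.
move=> p0 zp zsum; pose d s := \sum_(m < p) ccoef (z ^+ m) s.
have pn0 : p%:R != 0 :> C by rewrite pnatr_eq0 -lt0n.
suff : todd_expansion 1 (fun s => d s / p%:R ^+ s).
  by move=> /ccoef_eq ->; rewrite mulrC divfK// expf_neq0.
move=> {}s; pose K := s.+1; pose q := exp_poly K.
pose cp m := \poly_(j < K) ccoef (z ^+ m) j.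
have h1 m : cong_below K ((1 - (z ^+ m) *: q) * cp m) 'X.
  move=> t tK; rewrite coefX (ccoefP (z ^+ m) t) mulrBl mul1r -scalerAl coefB coefZ.
  rewrite coef_poly tK coefM; congr (_ - _ * _); apply: eq_bigr => j _.
  rewrite !coef_poly (leq_ltn_trans (leq_subr _ _) tK).
  by rewrite (leq_ltn_trans _ tK)// -ltnS.
have h2 m : cong_below K ((1 - q ^+ p) * cp m) ((\sum_(i < p) (z ^+ m) ^+ i *: q ^+ i) * 'X).
  have -> : 1 - q ^+ p = (\sum_(i < p) (z ^+ m) ^+ i *: q ^+ i) * (1 - z ^+ m *: q).
    have -> : 1 - q ^+ p = 1 - (z ^+ m *: q) ^+ p.
      by rewrite exprZn -exprM mulnC exprM zp expr1n scale1r.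
    rewrite -[in LHS](expr1n _ p) subrXX mulrC; congr (_ * _); apply: eq_bigr => i _.
    by rewrite expr1n mul1r exprZn.
  by rewrite -mulrA; apply: cong_belowM; exact: h1.
have h3 : cong_below K ((1 - q ^+ p) * \sum_(m < p) cp m) (p%:R *: 'X).
  move=> t tK; rewrite mulr_sumr coef_sum.
  rewrite (eq_bigr (fun m : 'I_p => ((\sum_(i < p) (z ^+ m) ^+ i *: q ^+ i) * 'X)`_t)).
    rewrite -coef_sum -mulr_suml exchange_big /=.
    have -> : \sum_(j < p) \sum_(i < p) (z ^+ i) ^+ j *: q ^+ j = p%:R%:P.
      rewrite (bigD1 (Ordinal p0))//= [X in _ + X]big1 => [|j j0].
        rewrite addr0; under eq_bigr do rewrite !expr0 scale1r.
        by rewrite sumr_const card_ord -polyC_natr.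
      rewrite -scaler_suml zsum ?scale0r// ltn_ord andbT lt0n.
      by apply: contra j0 => /eqP j0; apply/eqP/val_inj.
    by rewrite mul_polyC.
  by move=> m _; exact: h2.
have := h3 s (ltnSn s).
rewrite mulrBl !mul1r coefB coefZ coefX.
have cpE t : (t < K)%N -> (\sum_(m < p) cp m)`_t = d t.
  by move=> tK; rewrite coef_sum; apply: eq_bigr => m _; rewrite coef_poly tK.
rewrite cpE// coefM => E.
have -> : (s == 1%N)%:R = p%:R ^- s * (p%:R * (s == 1%N)%:R) :> C.
  by case: eqP => [->|_]; rewrite ?mulr0// mulr1 expr1 mulVf.
rewrite -E mulrBr [d s / _]mulrC; congr (_ - _).
rewrite mulr_sumr; apply: eq_bigr => j _.
have js : (j <= s)%N by rewrite -ltnS.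
rewrite coef_exp_polyX// cpE ?ltnS ?leq_subr//.
have fact_neq0 t : (t`!)%:R != 0 :> C by rewrite pnatr_eq0 -lt0n fact_gt0.
have -> : p%:R ^+ s = p%:R ^+ (s - j) * p%:R ^+ j :> C by rewrite -exprD subnK.
rewrite exprNn; by field; rewrite !fact_neq0 ?expf_neq0.
Qed.

Lemma expi2piD (s t : R) : expi2pi (s + t) = expi2pi s * expi2pi t.
Proof.
rewrite /expi2pi mulrDr cosD sinD; apply/eqP; rewrite eq_complex /=.
by rewrite eqxx /= addrC [cos _ * _]mulrC; apply/eqP; ring.
Qed.

Lemma expi2pi0 : expi2pi (0 : R) = 1.
Proof. by rewrite /expi2pi mulr0 cos0 sin0. Qed.

Lemma expi2pi1 : expi2pi (1 : R) = 1.
Proof. by rewrite /expi2pi mulr1 mulr_natl cos2pi sin2pi. Qed.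

Lemma expi2piMn (t : R) m : expi2pi (m%:R * t) = expi2pi t ^+ m.
Proof.
elim: m => [|m IH]; first by rewrite mul0r expi2pi0 expr0.
by rewrite -natr1 mulrDl mul1r expi2piD IH exprSr.
Qed.

Lemma expi2pi_neq1 (t : R) : 0 < t < 1 -> expi2pi t != 1.
Proof.
move=> /andP[t0 t1]; apply/eqP => -[+ _].
rewrite (_ : 2 * pi * t = pi * t + pi * t); last by ring.
rewrite cosD -!expr2 cos2sin2 => h.
have : 0 < sin (pi * t).
  by apply: sin_gt0_pi; rewrite mulr_gt0 ?pi_gt0//= -[ltRHS]mulr1 ltr_pM2l ?pi_gt0.
have /eqP : sin (pi * t) ^+ 2 = 0 by lra.
by rewrite sqrf_eq0 => /eqP ->; rewrite ltxx.
Qed.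

Lemma sum_ccoef_Fp p s : prime p ->
  \sum_(m : 'F_p) ccoef (expi2pi ((m : nat)%:R / p%:R : R)) s = p%:R ^+ s * ccoef 1 s.
Proof.
move=> pp; have p0 := prime_gt0 pp.
have pn0 : p%:R != 0 :> R by rewrite pnatr_eq0 -lt0n.
pose z : C := expi2pi (p%:R^-1).
have zp : z ^+ p = 1 by rewrite -expi2piMn divff// expi2pi1.
rewrite -(sum_ccoef_roots s p0 zp) => [|i /andP[i0 ip]].
  have E N (G : nat -> C) : N = p -> \sum_(m < N) G m = \sum_(m < p) G m by move=> ->.
  rewrite -(E _ (fun m => ccoef (z ^+ m) s) (Fp_cast pp)).
  by apply: eq_bigr => m _; rewrite -expi2piMn.
under eq_bigr do rewrite exprAC.
have zi : z ^+ i != 1.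
  rewrite -expi2piMn; apply: expi2pi_neq1; rewrite divr_gt0 ?ltr0n//=.
  by rewrite ltr_pdivrMr ?ltr0n// mul1r ltr_nat.
apply: (mulfI (_ : z ^+ i - 1 != 0)); first by rewrite subr_eq0.
by rewrite -subrX1 -exprM mulnC exprM zp expr1n subrr mulr0.
Qed.

End ToddCoefficients.

(** * Lattices between L and its multiple by 1/p *)

Section Reduction.
Variable p : nat.
Hypothesis pp : prime p.
Implicit Types m n : nat.

Definition modp m n (c : 'M[int]_(m, n)) : 'M['F_p]_(m, n) :=
  map_mx (fun z : int => z%:~R : 'F_p) c.
Definition liftp m n (w : 'M['F_p]_(m, n)) : 'M[int]_(m, n) :=
  map_mx (fun a : 'F_p => Posz a) w.

Lemma modpM m n q (A : 'M[int]_(m, n)) (C : 'M[int]_(n, q)) : modp (A *m C) = modp A *m modp C.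
Proof. exact: (map_mxM (intmul (1 : 'F_p))). Qed.

Lemma modpD m n (A C : 'M[int]_(m, n)) : modp (A + C) = modp A + modp C.
Proof. exact: (map_mxD (intmul (1 : 'F_p))). Qed.

Lemma modpB m n (A C : 'M[int]_(m, n)) : modp (A - C) = modp A - modp C.
Proof. exact: (map_mxB (intmul (1 : 'F_p))). Qed.

Lemma liftpK m n : cancel (@liftp m n) (@modp m n).
Proof. by move=> w; apply/matrixP => i j; rewrite !mxE -pmulrn natr_Zp. Qed.

Lemma int_Fp_eq0 (z : int) : (z%:~R == 0 :> 'F_p) = (p %| z)%Z.
Proof. by rewrite (dvdz_pcharf (pchar_Fp pp)). Qed.

Lemma modp_eq0 m n (c : 'M[int]_(m, n)) : modp c = 0 -> exists d, c = p%:Z *: d.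
Proof.
move=> c0; exists (map_mx (fun z => (z %/ p)%Z) c); apply/matrixP => i j; rewrite !mxE.
by rewrite mulrC divzK// -int_Fp_eq0; have /matrixP/(_ i j) := c0; rewrite !mxE => ->.
Qed.

Lemma modpZp m n (d : 'M[int]_(m, n)) : modp (p%:Z *: d) = 0.
Proof.
apply/matrixP => i j; rewrite !mxE; apply/eqP; rewrite int_Fp_eq0; exact: dvdz_mulr.
Qed.

Lemma card_rowspace n (S : 'M['F_p]_n) :
  #|[pred w : 'rV['F_p]_n | (w <= S)%MS]| = (p ^ \rank S)%N.
Proof.
have -> : (p ^ \rank S)%N = #|{: 'M['F_p]_(1, \rank S)}|.
  by rewrite card_mx card_Fp// mul1n.
rewrite -(card_imset _ (row_free_inj (row_base_free S))).
apply: eq_card => w; rewrite inE -(eq_row_base S).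
apply/submxP/imsetP => [[y ->]|[y _ ->]]; first by exists y; rewrite ?inE.
by exists y.
Qed.

(** The preimage of the row space is generated by lifts of the rows of [S] and the multiples of [p].
    These are [2 n] generators, from which [is_lattice_sublattice] extracts a basis. *)
Lemma modp_span n (S : 'M['F_p]_n) (c : 'rV[int]_n) :
  (modp c <= S)%MS <-> exists y : 'rV[int]_(n + n), c = y *m col_mx (liftp S) (p%:Z)%:M.
Proof.
split=> [/submxP[w wE]|[y ->]].
  have [d dE] : exists d, c - liftp w *m liftp S = p%:Z *: d.
    by apply: modp_eq0; rewrite modpB modpM !liftpK wE subrr.
  exists (row_mx (liftp w) d); rewrite mul_row_col mul_mx_scalar -dE.
  by rewrite addrC subrK.
rewrite -[y]hsubmxK mul_row_col mul_mx_scalar modpD modpZp addr0 modpM liftpK.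
exact: submxMl.
Qed.

End Reduction.

Section IntermediateLattice.
Variables (R : realType) (n p : nat).
Hypothesis pp : prime p.
Local Notation V := 'rV[R]_n.
Variables (L : set V).
Hypothesis latL : is_lattice L.
Local Notation B := (lattice_basis L).
Local Notation imx := (map_mx (intmul (1 : R))).

Let Bu : B \in unitmx. Proof. exact: (lattice_basisP latL).1. Qed.
Let LB : L = lattice_of B. Proof. exact: (lattice_basisP latL).2. Qed.
Let p0 : p%:R != 0 :> R. Proof. by rewrite pnatr_eq0 -lt0n prime_gt0. Qed.

Lemma intvecM m (c : 'rV[int]_m) (G : 'M[int]_(m, n)) :
  intvec R (c *m G) = intvec R c *m imx G.
Proof. exact: (map_mxM (intmul (1 : R))). Qed.

Lemma intvecD (c d : 'rV[int]_n) : intvec R (c + d) = intvec R c + intvec R d.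
Proof. exact: (map_mxD (intmul (1 : R))). Qed.

Lemma intvecZ (k : int) (c : 'rV[int]_n) : intvec R (k *: c) = k%:~R *: intvec R c.
Proof. by apply/rowP => i; rewrite !mxE intrM. Qed.

Lemma intvec_inj : injective (@intvec R n).
Proof.
by move=> c d /rowP h; apply/rowP => i; have := h i; rewrite !mxE => /intr_inj.
Qed.

Lemma sublatticeP (S : 'M['F_p]_n) x : sublattice L S x <->
  exists2 c, (modp p c <= S)%MS & x = p%:R^-1 *: (intvec R c *m B).
Proof. by split=> [[c cS <-]|[c cS ->]]; exists c. Qed.

Lemma sublattice_between (S : 'M['F_p]_n) : between p L (sublattice L S).
Proof.
split=> [x Lx|u Lu x Sx].
  have [c _ <-] : lattice_of B x by rewrite -LB.
  apply/(sublatticeP S); exists (p%:Z *: c).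
    by rewrite modpZp// sub0mx.
  by rewrite intvecZ -scalemxAl scalerA mulVf// scale1r.
have [c _ ->] := (sublatticeP S x).1 Sx.
rewrite dotpZl dotpZr mulKf//; apply: Lu.
by have : lattice_of B (intvec R c *m B) by [exists c]; rewrite -LB.
Qed.

(** The coordinates modulo [p] in the basis dual to that of [L]. For [u] in the dual lattice the
    pairings are integers, and the floor merely converts them to [int]. *)
Definition coordp (u : V) : 'rV['F_p]_n :=
  modp p (\row_i Num.floor (dotp (row i B) u)).

Lemma dual_sublatticeP (S : 'M['F_p]_n) u : dual_lattice L u ->
  dual_lattice (sublattice L S) u <-> S *m (coordp u)^T = 0.
Proof.
move=> Lu'; have Lu : forall i, dotp (row i B) u \is a Num.int.
  by move=> i; apply: Lu'; have := lattice_of_row B i; rewrite -LB.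
pose z : 'rV[int]_n := \row_i Num.floor (dotp (row i B) u).
have zE i : dotp (row i B) u = (z 0 i)%:~R by rewrite mxE floorK.
have dotE (c : 'rV[int]_n) : dotp (p%:R^-1 *: (intvec R c *m B)) u = p%:R^-1 * ((c *m z^T) 0 0)%:~R.
  rewrite dotpZl mulmx_sum_row dotp_suml; congr (_ * _).
  rewrite mxE rmorph_sum; apply: eq_bigr => i _.
  by rewrite dotpZl zE !mxE rmorphM.
have intE (c : 'rV[int]_n) : p%:R^-1 * ((c *m z^T) 0 0)%:~R \is a @Num.int R <->
    modp p c *m (coordp u)^T = 0.
  rewrite (_ : (coordp u)^T = modp p z^T) -?modpM; last by rewrite /coordp /modp map_trmx.
  split=> [/intrP[k kE]|h].
    apply/matrixP => i j; rewrite !ord1 [RHS]mxE mxE; apply/eqP.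
    rewrite int_Fp_eq0//; apply/dvdzP; exists k; apply: (@intr_inj R).
    by rewrite intrM -kE -pmulrn mulrC mulVKf.
  have /matrixP/(_ 0 0) := h; rewrite [RHS]mxE mxE => /eqP.
  rewrite int_Fp_eq0// => /dvdzP[k ->]; rewrite intrM -pmulrn.
  by apply/intrP; exists k; rewrite mulrC mulfK.
split=> [Mu|h x Sx].
  apply/row_matrixP => i; rewrite row_mul row0 -[row i S]liftpK.
  apply/intE; rewrite -dotE; apply: Mu; apply/(sublatticeP S).
  by exists (liftp (row i S)); rewrite ?liftpK ?row_sub.
have [c cS ->] := (sublatticeP S x).1 Sx.
rewrite dotE; apply/intE; have /submxP[D ->] := cS.
by rewrite -mulmxA h mulmx0.
Qed.

(** The Smith normal form of the generator matrix leaves at most [n] nonzero rows, which form [G].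
    Their span contains the multiples of [p], so [G] is invertible over the reals. *)
Lemma is_lattice_sublattice (S : 'M['F_p]_n) : is_lattice (sublattice L S).
Proof.
pose C := col_mx (liftp S) (p%:Z)%:M.
have [Lm Lu [Rm Ru [d _ CE]]] := int_Smith_normal_form C.
pose G : 'M[int]_n := diag_mx (\row_j d`_j) *m Rm.
have DE : \matrix_(i < n + n, j < n) (d`_i *+ (i == j :> nat)) =
    col_mx (diag_mx (\row_j d`_j)) 0.
  apply/matrixP => i j; rewrite !mxE; case: splitP => k ik; rewrite !mxE ik.
    by rewrite -(inj_eq val_inj) /=; case: eqVneq => [->|].
  by rewrite [_ == _](_ : _ = false)//; apply/eqP; have := ltn_ord j; lia.
have spanE (c : 'rV[int]_n) : (exists y, c = y *m C) <-> exists c', c = c' *m G.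
  split=> [[y ->]|[c' ->]].
    exists (lsubmx (y *m Lm)); rewrite CE DE !mulmxA -[y *m Lm in LHS]hsubmxK.
    by rewrite mul_row_col mulmx0 addr0.
  exists (row_mx c' 0 *m invmx Lm); rewrite CE DE !mulmxA mulmxKV//.
  by rewrite mul_row_col mulmx0 addr0.
have Gu : imx G \in unitmx.
  have /boolp.choice[X hX] i : exists c', row i (p%:Z)%:M = c' *m G.
    apply/spanE; exists (row_mx 0 (delta_mx 0 i)).
    by rewrite mul_row_col mul0mx add0r -rowE.
  have XE : (p%:Z)%:M = \matrix_i X i *m G :> 'M[int]_n.
    by apply/row_matrixP => i; rewrite row_mul rowK.
  have := congr1 (map_mx (intmul (1 : R))) XE; rewrite map_scalar_mx map_mxM /= => pE.
  have : (p%:R : R)%:M \in @unitmx R n by rewrite unitmxE det_scalar unitrX// unitfE.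
  by rewrite -[p%:R]/(p%:~R) pE unitmx_mul => /andP[].
exists (p%:R^-1 *: (imx G *m B)).
  by rewrite unitmxZ ?unitfE ?invr_neq0// unitmx_mul Gu Bu.
apply/seteqP; split => x.
  move=> Sx; have [c /(modp_span pp)/spanE[c' ->] ->] := (sublatticeP S x).1 Sx.
  exists c' => //.
  by rewrite -scalemxAr mulmxA intvecM.
move=> [c' _ <-]; apply/(sublatticeP S); exists (c' *m G).
  by apply/(modp_span pp)/spanE; exists c'.
by rewrite -scalemxAr mulmxA intvecM.
Qed.

End IntermediateLattice.

(** * Fundamental domains and the ratio of their volumes *)

Section FundamentalDomain.
Variables (R : realType) (n : nat).
Local Notation V := 'rV[R]_n.
Implicit Types (B : 'M[R]_n).

Definition parallelepiped B : set V :=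
  [set t *m B | t in [set t : V | forall i, 0 <= t 0 i < 1]].

Lemma parallelepipedP B q : B \in unitmx ->
  parallelepiped B q <-> forall i, 0 <= (q *m invmx B) 0 i < 1.
Proof.
move=> Bu; split=> [[t ht <-]|h]; first by rewrite mulmxK.
by exists (q *m invmx B); rewrite ?mulmxKV.
Qed.

Lemma parallelepiped_bound B (C : 'M[R]_n) q i : parallelepiped B q ->
  `|(q *m C) 0 i| <= \sum_k \sum_j `|(B *m C) j k|.
Proof.
move=> [t ht <-]; rewrite -mulmxA mxE [leRHS](bigD1 i)//= -[leLHS]addr0.
apply: lerD; last by do 2![apply: sumr_ge0 => ? _].
apply: (le_trans (ler_norm_sum _ _ _)); apply: ler_sum => j _.
have /andP[t0 t1] := ht j; rewrite normrM ger0_norm// -[leRHS]mul1r.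
by rewrite ler_wpM2r// ltW.
Qed.

Lemma polyhedral_parallelepiped B : B \in unitmx -> polyhedral (parallelepiped B).
Proof.
move=> Bu; split; last first.
  exists (\sum_k \sum_j `|(B *m 1%:M) j k|) => q hq i.
  by have := parallelepiped_bound 1%:M i hq; rewrite mulmx1.
pose a (i : 'I_n) (e : nat -> R) := ((\row_i e i) *m invmx B) 0 i.
have pa i : polyf 1 (a i).
  rewrite /a; under [X in polyf _ X]eq_fun do rewrite mxE.
  apply: polyf_sum => j; under [X in polyf _ X]eq_fun do rewrite mxE mulrC.
  by apply: polyfZ; exact: polyf_var.
have -> : indic (parallelepiped B) =
    fun e => if all (fun i => 0 <= a i e < 1) (enum 'I_n) then 1 else 0.
  apply/funext => e; rewrite /indic; congr (if _ then _ else _).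
  apply/asboolP/allP => [/(parallelepipedP _ Bu) h i _|h]; first exact: h.
  by apply/(parallelepipedP _ Bu) => i; apply: h; rewrite mem_enum.
elim: (enum _) => [|i s IH] /=; first exact: pwpoly_cst.
rewrite [X in pwpoly _ X](_ : _ = fun e => if 0 <= a i e then if a i e < 1 then
   (if all (fun i => 0 <= a i e < 1) s then 1 else 0) else 0 else 0).
  apply: pwpoly_if => //; apply: (pwpoly_lt (b := fun=> 1)) => //; first exact: polyf_cst.
  exact: pwpoly_cst.
by apply/funext => e; case: (0 <= _) => //; case: (_ < 1).
Qed.

Lemma parallelepiped_floor B q : B \in unitmx -> exists m, lattice_of B m /\
  forall m', lattice_of B m' -> parallelepiped B (q - m') <-> m' = m.
Proof.
move=> Bu; pose c := \row_i Num.floor ((q *m invmx B) 0 i).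
exists (intvec R c *m B); split; first by exists c.
move=> m' [c' _ <-]; rewrite parallelepipedP// mulmxBl mulmxK//.
split=> [h|/(can_inj (mulmxK Bu)) -> i].
  congr (intvec R _ *m B); apply/rowP => i; rewrite !mxE.
  have := h i; rewrite !mxE; set x := \sum_j _ => /andP[h1 h2].
  apply/esym/floor_def; rewrite intrD; lra.
rewrite !mxE; set x := \sum_j _.
by have /andP[] := floor_itv x => h1 h2; apply/andP; split; move: h2; rewrite ?intrD; lra.
Qed.

End FundamentalDomain.

Section FundamentalDomainRatio.
Variables (R : realType) (n p : nat).
Hypothesis pp : prime p.
Local Notation V := 'rV[R]_n.
Variables (L : set V).
Hypothesis latL : is_lattice L.
Local Notation B := (lattice_basis L).

(** The translations [x w z] run through [M]: [w] is the class modulo [L] and [z] a vector of [L]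
    from a finite range. Each point of the domain of [L] has a unique translate in that of [M];
    conversely, each class [w] brings a point of the domain of [M] into that of [L] by exactly one
    [z]. *)
Lemma vol_fund_domain_sublattice (S : 'M['F_p]_n) :
  vol (fund_domain L) = (p ^ \rank S)%:R * vol (fund_domain (sublattice L S)).
Proof.
have Bu : B \in unitmx := (lattice_basisP latL).1.
have p0 : p%:R != 0 :> R by rewrite pnatr_eq0 -lt0n prime_gt0.
have [BMu MB] := lattice_basisP (is_lattice_sublattice pp latL S).
set M := sublattice L S in BMu MB *; set BM := lattice_basis M in BMu MB *.
pose T : finType := {w : 'rV['F_p]_n | (w <= S)%MS}.
pose rep (w : 'rV['F_p]_n) : V := p%:R^-1 *: (intvec R (liftp w) *m B).
(* In coordinates with respect to [B], the three summands bound a point of the domain of [L], a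
   point of the domain of [M], and a representative [rep w]. *)
pose bnd : R := 1 + \sum_k \sum_j `|(BM *m invmx B) j k| + 1.
have bnd0 : 0 <= bnd by do 2!rewrite addr_ge0//; do 2![apply: sumr_ge0 => ? _].
pose K := Num.bound bnd.
pose Z : finType := {ffun 'I_n -> 'I_(K + K).+1}.
pose zz (z : Z) : 'rV[int]_n := \row_i ((z i : nat)%:Z - K%:Z).
pose x (w : T) (z : Z) : V := rep (val w) + intvec R (zz z) *m B.
have zz_inj : injective zz.
  move=> z z' /rowP h; apply/ffunP => i; apply: val_inj.
  by have := h i; rewrite !mxE => /addIr [].
have zz_surj (d : 'rV[int]_n) : (forall i, `|(d 0 i)%:~R| <= bnd) -> exists z, zz z = d.
  move=> hd; have hd' i : (absz (d 0%R i) <= K)%N.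
    have := le_lt_trans (hd i) (archi_boundP bnd0).
    by rewrite -intr_norm -[X in _ < X]/(K%:~R) ltr_int => /ltW; rewrite -abszE lez_nat.
  exists [ffun i => inord (absz (d 0 i + K%:Z))]; apply/rowP => i; rewrite !mxE ffunE.
  have := hd' i => hi; rewrite inordK; lia.
have diff_bnd q q' (w : 'rV['F_p]_n) d i : parallelepiped B q -> parallelepiped BM q' ->
    q - q' = rep w + intvec R d *m B -> `|(d 0 i)%:~R| <= bnd.
  move=> hq hq' E.
  have -> : (d 0 i)%:~R = (q *m invmx B) 0 i - (q' *m invmx B) 0 i -
      p%:R^-1 * ((liftp w 0 i)%:~R : R).
    have : q *m invmx B - q' *m invmx B = p%:R^-1 *: intvec R (liftp w) + intvec R d.
      by rewrite -mulmxBl E /rep mulmxDl -scalemxAl !mulmxK.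
    move: (q *m _) (q' *m _) => a a' /(congr1 (fun y : V => y 0 i)).
    rewrite [LHS]mxE [(- a') 0 i]mxE => ->.
    by rewrite !mxE; ring.
  have /andP[q0 q1] := (parallelepipedP q Bu).1 hq i.
  have hq2 := parallelepiped_bound (invmx B) i hq'.
  have [w0 w1] : 0 <= p%:R^-1 * ((liftp w 0 i)%:~R : R) /\ p%:R^-1 * ((liftp w 0 i)%:~R : R) <= 1.
    rewrite mxE -pmulrn mulr_ge0 ?invr_ge0//; split => //.
    rewrite mulrC ler_pdivrMr ?ltr0n ?prime_gt0// mul1r ler_nat.
    by rewrite -[X in (_ <= X)%N](Fp_cast pp) ltnW.
  rewrite -/(rep w) in E.
  rewrite /bnd (le_trans (ler_normB _ _))// lerD//; last by rewrite ger0_norm.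
  rewrite (le_trans (ler_normB _ _))// lerD//.
  by rewrite ger0_norm// ltW.
have x_inj w z (w' : 'rV['F_p]_n) d :
    x w z = rep w' + intvec R d *m B -> val w = w' /\ zz z = d.
  rewrite /x /rep => E.
  have {}E : liftp (val w) + p%:Z *: zz z = liftp w' + p%:Z *: d.
    apply: (@intvec_inj R); rewrite !intvecD !intvecZ.
    apply: (can_inj (mulmxK Bu)); apply: (scalerI (invr_neq0 p0)).
    by rewrite !mulmxDl !scalerDr -!scalemxAl !scalerA -!pmulrn !mulVf// !scale1r.
  have ww : val w = w'.
    have := congr1 (@modp p _ _) E.
    by rewrite !modpD !modpZp// !addr0 !liftpK.
  split => //; move: E; rewrite ww => /addrI /rowP h; apply/rowP => i.
  have := h i; rewrite !mxE; apply: mulfI.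
  by rewrite -lt0n prime_gt0.
have <- : #|T| = (p ^ \rank S)%N by rewrite card_sig card_rowspace.
apply: (@vol_equidecomposable _ _ _ _ _ Z x).
- exact: polyhedral_parallelepiped.
- exact: polyhedral_parallelepiped.
- move=> q hq; have [m [Mm hm]] := parallelepiped_floor q BMu.
  have [c cS mE] : exists2 c, (modp p c <= S)%MS & m = p%:R^-1 *: (intvec R c *m B).
    by apply/(sublatticeP L S); rewrite -/M MB.
  have [d dE] : exists d, c - liftp (modp p c) = p%:Z *: d.
    by apply: modp_eq0 => //; rewrite modpB liftpK subrr.
  have {}mE : m = rep (modp p c) + intvec R d *m B.
    rewrite mE /rep -[c in LHS](subrK (liftp (modp p c))) dE intvecD intvecZ.
    by rewrite mulmxDl scalerDr -scalemxAl scalerA mulVf// scale1r addrC.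
  have [z zE] : exists z, zz z = d.
    apply: zz_surj => i; apply: (diff_bnd q (q - m) (modp p c) d i hq).
      by apply/hm.
    by rewrite -mE opprB addrC subrK.
  exists (Sub (modp p c) cS, z) => w' z'.
  have Mx : lattice_of BM (x w' z').
    rewrite -MB; apply/(sublatticeP L S); exists (liftp (val w') + p%:Z *: zz z').
      by rewrite modpD modpZp// addr0 liftpK (valP w').
    by rewrite /x /rep intvecD intvecZ mulmxDl scalerDr -scalemxAl scalerA mulVf// scale1r.
  have hx : fund_domain M (q - x w' z') <-> x w' z' = m by exact: hm Mx.
  rewrite hx mE; split => [/x_inj[wE zE']|[-> ->]].
    by congr pair; [apply: val_inj; rewrite wE SubK|apply: zz_inj; rewrite zE].
  by rewrite /x SubK zE.
(* For a given class the vector of [L] has to be minus the integral part of [q + rep w]; [diff_bnd]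
   puts it in the finite range. *)
- move=> q w hq; have [m [Lm hm]] := parallelepiped_floor (q + rep (val w)) Bu.
  have [d _ dE] := Lm.
  have [z zE] : exists z, zz z = - d.
    apply: zz_surj => i; apply: (diff_bnd (q + rep (val w) - m) q (val w) (- d) i) => //.
      by apply/hm.
    rewrite -dE (_ : intvec R (- d) = - intvec R d); last first.
      by rewrite -scaleN1r intvecZ mulrN1z scaleN1r.
    by rewrite mulNmx -[q + _ - _]addrA [q + _]addrC addrK.
  exists z => z'.
  have E : q + x w z' = q + rep (val w) - intvec R (- zz z') *m B.
    rewrite (_ : intvec R (- zz z') = - intvec R (zz z')); last first.
      by rewrite -scaleN1r intvecZ mulrN1z scaleN1r.
    by rewrite mulNmx opprK addrA.
  have hx : fund_domain L (q + x w z') <-> intvec R (- zz z') *m B = m.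
    by rewrite E; apply: hm; exists (- zz z').
  rewrite hx; split=> [|->]; last by rewrite zE opprK.
  rewrite -dE => /(can_inj (mulmxK Bu)) /(@intvec_inj R) h.
  by apply: zz_inj; rewrite zE -h opprK.
Qed.

End FundamentalDomainRatio.

(** * Subspaces of F_p^n *)

Section CountingSubspaces.
Variables (p n k : nat).
Hypothesis pp : prime p.
Local Notation F := 'F_p.
Implicit Types (W A : 'M[F]_n) (x y : 'rV[F]_n).

Definition nb_subspaces : nat := (\sum_(W : 'M[F]_n | subspace_k k W) 1)%N.
Definition nb_annihilated x : nat :=
  (\sum_(W : 'M[F]_n | subspace_k k W && (W *m x^T == 0%R)) 1)%N.
Definition nb_containing y : nat :=
  (\sum_(W : 'M[F]_n | subspace_k k W && (y <= W)%MS) 1)%N.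

(** The action of an invertible matrix on subspaces; [genmx] returns to the canonical
    representative, over which the sums run. *)
Definition transport A W : 'M[F]_n := <<W *m A>>%MS.

Lemma subspace_transport A W : A \in unitmx -> subspace_k k W -> subspace_k k (transport A W).
Proof.
move=> Au /andP[_ /eqP rW]; rewrite /subspace_k genmx_id eqxx /=.
by rewrite mxrank_gen mxrankMfree ?rW// row_free_unit.
Qed.

Lemma transportK A W : A \in unitmx -> subspace_k k W -> transport (invmx A) (transport A W) = W.
Proof.
move=> Au /andP[/eqP WE _]; rewrite /transport -[RHS]WE; apply/genmxP/eqmxP.
by apply: (eqmx_trans (eqmxMr _ (genmxE _))); rewrite mulmxK.
Qed.

Lemma transport_count A (Q Q' : pred 'M[F]_n) : A \in unitmx ->
  (forall W, Q' (transport A W) = Q W) ->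
  (\sum_(W : 'M[F]_n | subspace_k k W && Q W) 1 =
   \sum_(W : 'M[F]_n | subspace_k k W && Q' W) 1)%N.
Proof.
move=> Au QQ'; have Au' : invmx A \in unitmx by rewrite unitmx_inv.
apply/esym; rewrite (reindex_onto (transport A) (transport (invmx A))) /=; last first.
  by move=> W /andP[sW _]; rewrite -{1}[A]invmxK transportK.
apply: eq_bigl => W; rewrite QQ'; apply/idP/idP.
  move=> /andP[/andP[sW QW] /eqP WE]; rewrite QW andbT -WE.
  exact: subspace_transport.
by move=> /andP[sW QW]; rewrite subspace_transport// QW transportK//= eqxx.
Qed.

Lemma row_transitive x y : x != 0 -> y != 0 -> exists2 A, A \in unitmx & x *m A = y.
Proof.
have rep z : z != 0 -> exists2 A : 'M[F]_n, A \in unitmx & z = (pid_mx 1 : 'M[F]_(1, n)) *m A.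
  move=> z0; have rz : \rank z = 1%N.
    by apply/eqP; rewrite eqn_leq rank_leq_row lt0n mxrank_eq0.
  have := mulmx_ebase z; rewrite rz [col_ebase z]mx11_scalar => zE.
  have c0 : col_ebase z 0 0 != 0.
    have := col_ebase_unit z; rewrite [col_ebase z]mx11_scalar unitmxE det_scalar1.
    by rewrite unitfE !mxE eqxx.
  exists (col_ebase z 0 0 *: row_ebase z).
    by rewrite unitmxZ ?unitfE// row_ebase_unit.
  by rewrite -[LHS]zE mul_scalar_mx -scalemxAl scalemxAr.
move=> /rep[A Au ->] /rep[A' Au' ->]; exists (invmx A *m A').
  by rewrite unitmx_mul unitmx_inv Au.
by rewrite mulmxA mulmxK.
Qed.

Lemma nb_containing_eq x y : x != 0 -> y != 0 -> nb_containing x = nb_containing y.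
Proof.
move=> x0 y0; have [A Au <-] := row_transitive x0 y0.
apply: (transport_count (Q := fun W => (x <= W)%MS) (Q' := fun W => (x *m A <= W)%MS) Au) => W.
by rewrite /transport genmxE submxMfree// row_free_unit.
Qed.

Lemma genmx_mul0 W (q : nat) (M : 'M[F]_(n, q)) : (<<W>>%MS *m M == 0) = (W *m M == 0).
Proof. by rewrite -!sub_kermx genmxE. Qed.

Lemma nb_annihilated_eq x y : x != 0 -> y != 0 -> nb_annihilated x = nb_annihilated y.
Proof.
move=> x0 y0; have [A Au <-] := row_transitive x0 y0; apply/esym.
apply: (transport_count (Q := fun W => W *m (x *m A)^T == 0) (Q' := fun W => W *m x^T == 0)
  (A := A^T)); first by rewrite unitmx_tr.
by move=> W; rewrite /transport genmx_mul0 trmx_mul mulmxA.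
Qed.

Lemma nb_annihilated0 : nb_annihilated 0 = nb_subspaces.
Proof. by apply: eq_bigl => W; rewrite trmx0 mulmx0 eqxx andbT. Qed.

Lemma nb_containing0 : nb_containing 0 = nb_subspaces.
Proof. by apply: eq_bigl => W; rewrite sub0mx andbT. Qed.

Lemma sum_rowspace (S : 'M[F]_n) : (\sum_(x : 'rV[F]_n | (x <= S)%MS) 1 = p ^ \rank S)%N.
Proof. by rewrite sum1_card card_rowspace. Qed.

(** The term [c1] is added on the left in place of a subtraction of natural numbers on the right. *)
Lemma sum_nonconst (P : pred 'rV[F]_n) (g : 'rV[F]_n -> nat) c0 c1 : P 0 ->
  g 0 = c0 -> (forall x, x != 0 -> g x = c1) ->
  (\sum_(x | P x) g x + c1 = c0 + (\sum_(x | P x) 1) * c1)%N.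
Proof.
move=> P0 g0 g1; rewrite (bigD1 0)//= [in RHS](bigD1 0)//= g0.
rewrite (eq_bigr (fun=> c1)) => [|x /andP[_ /g1]//].
by rewrite !sum_nat_const; lia.
Qed.

(** Double counting of the pairs of a subspace and a vector orthogonal to it: a [k]-dimensional
    subspace is orthogonal to [p ^ (n - k)] vectors. *)
Lemma nb_annihilated_rel x : x != 0 -> (k <= n)%N ->
  (nb_subspaces * p ^ (n - k) + nb_annihilated x =
   nb_subspaces + p ^ n * nb_annihilated x)%N.
Proof.
move=> x0 kn; have <- : (\sum_(y : 'rV[F]_n) nb_annihilated y = nb_subspaces * p ^ (n - k))%N.
  rewrite /nb_annihilated; under eq_bigr do rewrite big_mkcondr /=.
  rewrite exchange_big /= /nb_subspaces big_distrl /=; apply: eq_bigr => W /andP[_ /eqP rW].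
  rewrite mul1n -big_mkcond /= (_ : (n - k = \rank (kermx W^T))%N).
    rewrite -sum_rowspace; apply: eq_bigl => y.
    by rewrite sub_kermx -trmx_eq0 trmx_mul trmxK.
  by rewrite mxrank_ker mxrank_tr rW.
rewrite (@sum_nonconst xpredT _ nb_subspaces (nb_annihilated x))//.
- by rewrite sum1_card card_mx card_Fp// mul1n.
- exact: nb_annihilated0.
- by move=> y y0; exact: nb_annihilated_eq.
Qed.

(** Double counting of the pairs of a subspace [W] and a vector of its intersection with [U]. *)
Lemma sum_nb_containing (U : 'M[F]_n) :
  (\sum_(W | subspace_k k W) p ^ \rank (W :&: U)%MS =
   \sum_(y : 'rV[F]_n | (y <= U)%MS) nb_containing y)%N.
Proof.
rewrite /nb_containing; under [RHS]eq_bigr do rewrite big_mkcondr /=.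
rewrite [RHS]exchange_big /=; apply: eq_bigr => W _.
rewrite -sum_rowspace -big_mkcondr /=; apply: eq_bigl => y.
by rewrite sub_capmx andbC.
Qed.

Lemma nb_containing_rel y : y != 0 ->
  (nb_subspaces * p ^ k + nb_containing y = nb_subspaces + p ^ n * nb_containing y)%N.
Proof.
move=> y0; have <- : (\sum_(y : 'rV[F]_n) nb_containing y = nb_subspaces * p ^ k)%N.
  transitivity (\sum_(y : 'rV[F]_n | (y <= (1%:M : 'M[F]_n))%MS) nb_containing y)%N.
    by apply: eq_bigl => z; rewrite submx1.
  rewrite -sum_nb_containing /nb_subspaces big_distrl /=.
  by apply: eq_bigr => W /andP[_ /eqP rW]; rewrite mul1n capmx1 rW.
rewrite (@sum_nonconst xpredT _ nb_subspaces (nb_containing y))//.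
- by rewrite sum1_card card_mx card_Fp// mul1n.
- exact: nb_containing0.
- by move=> z z0; exact: nb_containing_eq.
Qed.

Lemma nu_rel y j : y != 0 -> (j <= n)%N ->
  (nu n k j p + nb_containing y = nb_subspaces + p ^ j * nb_containing y)%N.
Proof.
move=> y0 jn; rewrite /nu sum_nb_containing.
rewrite (@sum_nonconst _ _ nb_subspaces (nb_containing y)).
- by rewrite sum_rowspace rank_pid_mx.
- exact: sub0mx.
- exact: nb_containing0.
- by move=> z z0; exact: nb_containing_eq.
Qed.

(* Both sides, multiplied by [(p ^ n - 1) * p ^ l], equal the number of
   subspaces times [p ^ (n + k) + p ^ (n + l) - p ^ (k + l) - p ^ n]. *)
Lemma subspace_count_identity (C : numFieldType) x l : x != 0 -> (k <= n)%N -> (l <= n)%N ->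
  p%:R ^+ k / p%:R ^+ l * (nb_subspaces%:R + (p%:R ^+ l - 1) * (nb_annihilated x)%:R) =
  (nu n k (n - l) p)%:R :> C.
Proof.
move=> x0 kn ln.
have n0 : (0 < n)%N.
  by case: n x x0 {kn ln} => // x; rewrite thinmx0 eqxx.
have pn0 : p%:R != 0 :> C by rewrite pnatr_eq0 -lt0n prime_gt0.
have P1 : p%:R ^+ n - 1 != 0 :> C.
  by rewrite subr_eq0 -natrX -[1]/(1%:R) eqr_nat gtn_eqF// -(expn0 p) ltn_exp2l ?prime_gt1.
have cast (a b : nat) : a = b -> a%:R = b%:R :> C by move=> ->.
have := cast _ _ (nb_annihilated_rel x0 kn).
have := cast _ _ (nb_containing_rel x0).
have := cast _ _ (nu_rel x0 (leq_subr l n)).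
rewrite !natrD !natrM !natrX.
set N := nb_subspaces%:R; set N1 := (nb_annihilated x)%:R; set N2 := (nb_containing x)%:R.
have E1 : p%:R ^+ n = p%:R ^+ k * p%:R ^+ (n - k) :> C by rewrite -exprD subnKC.
have E2 : p%:R ^+ n = p%:R ^+ l * p%:R ^+ (n - l) :> C by rewrite -exprD subnKC.
have Q0 : p%:R ^+ l != 0 :> C by rewrite expf_neq0.
move: E1 E2 P1 Q0; move: (p%:R ^+ n) (p%:R ^+ k) (p%:R ^+ (n - k)) (p%:R ^+ l) (p%:R ^+ (n - l)).
move=> P K K' Q Q' E1 E2 P1 Q0 h3 h2 h1.
have N1E : N1 = N * (K' - 1) / (P - 1).
  apply: (mulIf P1); rewrite divfK//.
  by transitivity (N + P * N1 - N - N1); [ring|rewrite -h1; ring].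
have N2E : N2 = N * (K - 1) / (P - 1).
  apply: (mulIf P1); rewrite divfK//.
  by transitivity (N + P * N2 - N - N2); [ring|rewrite -h2; ring].
have -> : (nu n k (n - l) p)%:R = N + (Q' - 1) * N2.
  by transitivity (N + Q' * N2 - N2); [rewrite -h3; ring|ring].
rewrite N1E N2E; apply: (mulIf P1); apply: (mulIf Q0).
transitivity (N * (K * P + (Q - 1) * (K * K') - Q * K)).
  by field; rewrite P1 Q0.
transitivity (N * (Q * P + (K - 1) * (Q * Q') - Q * K)); last by field.
by rewrite -E1 -E2; ring.
Qed.

End CountingSubspaces.

(** * The sums A *)

Section GammaSums.
Variables (R : realType) (n p r : nat).
Hypothesis pp : prime p.
Local Notation V := 'rV[R]_n.
Local Notation C := R[i].
Variables (L : set V) (u w : 'I_r -> V).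
Hypothesis uL : forall i, dual_lattice L (u i).
Hypothesis wL : forall i, L (w i).
Hypothesis wu : forall i j, dotp (w i) (u j) = (i == j)%:R.
Implicit Types (m : {ffun 'I_r -> 'F_p}) (N : set V).

Definition lincomb m : V := \sum_i (m i : nat)%:R *: u i.

Lemma dotp_lincomb m i : dotp (w i) (lincomb m) = (m i : nat)%:R.
Proof.
rewrite dotp_sumr (bigD1 i)//= big1 => [|j ji].
  by rewrite dotpZr wu eqxx mulr1 addr0.
by rewrite dotpZr wu eq_sym (negbTE ji) mulr0.
Qed.

Lemma lincomb_inj : injective lincomb.
Proof.
move=> m m' E; apply/ffunP => i; apply: val_inj; apply/eqP.
by rewrite -(eqr_nat R) -!dotp_lincomb E.
Qed.

Lemma dual_sum N (I : Type) (s : seq I) (F : I -> V) :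
  (forall i, dual_lattice N (F i)) -> dual_lattice N (\sum_(i <- s) F i).
Proof.
move=> h; apply: big_ind => //; first by move=> x _; rewrite dotp0r rpred0.
by move=> x y; exact: dual_latticeD.
Qed.

Lemma dual_lincomb m : dual_lattice L (lincomb m).
Proof. by apply: dual_sum => i; exact: dual_latticeMn. Qed.

Lemma Fp_lt (a : 'F_p) : (a < p)%N.
Proof. by rewrite -[X in (_ < X)%N](Fp_cast pp). Qed.

Definition weight (pi : 'I_r -> nat) m : C :=
  \prod_(i < r) ccoef (expi2pi ((m i : nat)%:R / p%:R : R)) (pi i).

Section OneLattice.
Variables (N P : set V) (Fs : 'I_r -> set V) (pi : 'I_r -> nat).
Hypothesis bw : between p L N.
Hypothesis normalE : forall i, unormal N P (Fs i) = (eps p N (u i))%:R *: u i.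

(** An element of [Gamma] is a combination of the [u i] with coefficients [m i = rho i * eps], where
    [0 <= m i < eps]. So [m i] is 0 where [eps] is 1, and an arbitrary residue modulo [p]
    otherwise. *)
Definition admissible m : bool :=
  [forall i, `[< dual_lattice N (u i) >] ==> (m i == 0)] && `[< dual_lattice N (lincomb m) >].

Lemma Gamma_repP m rho : Gamma_rep N P Fs (lincomb m) rho ->
  forall i, rho 0 i * (eps p N (u i))%:R = (m i : nat)%:R.
Proof.
move=> [_ gE] i; rewrite -dotp_lincomb gE dotp_sumr (bigD1 i)//= big1 => [|j ji].
  by rewrite normalE !dotpZr wu eqxx mulr1 addr0.
by rewrite normalE !dotpZr wu eq_sym (negbTE ji) !mulr0.
Qed.

Lemma eps_admissible m i : admissible m ->
  (m i : nat)%:R / (eps p N (u i))%:R = (m i : nat)%:R / p%:R :> R.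
Proof.
move=> /andP[/forallP /(_ i) + _]; rewrite /eps; case: asboolP => //= _ /eqP ->.
by rewrite !mul0r.
Qed.

Lemma admissible_Gamma_rep m : admissible m ->
  Gamma_rep N P Fs (lincomb m) (\row_i ((m i : nat)%:R / p%:R)).
Proof.
move=> am; split=> [i|].
  rewrite mxE divr_ge0//= ltr_pdivrMr ?ltr0n ?prime_gt0// mul1r ltr_nat.
  exact: Fp_lt.
apply: eq_bigr => i _; rewrite mxE normalE -eps_admissible// scalerA divfK//.
by rewrite pnatr_eq0 -lt0n eps_gt0.
Qed.

Lemma rhoF_admissible m i : admissible m ->
  rhoF N P Fs (lincomb m) 0 i = (m i : nat)%:R / p%:R.
Proof.
move=> am; have rep : Gamma_rep N P Fs (lincomb m) (rhoF N P Fs (lincomb m)).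
  exact: (@xgetPex _ 0 [set rho | Gamma_rep N P Fs (lincomb m) rho])
    (ex_intro _ _ (admissible_Gamma_rep am)).
rewrite -eps_admissible// -(Gamma_repP rep) mulfK//.
by rewrite pnatr_eq0 -lt0n eps_gt0.
Qed.

Lemma GammaE g : Gamma N P Fs g <-> exists2 m, admissible m & g = lincomb m.
Proof.
split=> [[Ng [rho [rho01 gE]]]|[m am ->]]; last first.
  split; first by have /andP[_ /asboolP] := am.
  by exists (\row_i ((m i : nat)%:R / p%:R)); exact: admissible_Gamma_rep.
have gw i : dotp (w i) g = rho 0 i * (eps p N (u i))%:R.
  rewrite gE dotp_sumr (bigD1 i)//= big1 => [|j ji].
    by rewrite normalE !dotpZr wu eqxx mulr1 addr0.
  by rewrite normalE !dotpZr wu eq_sym (negbTE ji) !mulr0.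
(* The coefficient is the pairing of [g] with [w i], which lies in [L] and hence in [N]; so it is an
   integer. *)
have /boolp.choice[z zE] i : exists z : nat, rho 0 i * (eps p N (u i))%:R = z%:R.
  apply/natrP; rewrite natrEint -gw Ng ?gw; last exact: bw.1.
  by have /andP[h _] := rho01 i; rewrite mulr_ge0.
have zlt i : (z i < eps p N (u i))%N.
  rewrite -(ltr_nat R) -zE -[ltRHS]mul1r ltr_pM2r ?ltr0n ?eps_gt0//.
  by have /andP[_ h] := rho01 i.
pose m : {ffun 'I_r -> 'F_p} := [ffun i => (z i)%:R].
have mz i : (m i : nat) = z i.
  rewrite ffunE val_Fp_nat// modn_small// (leq_trans (zlt i))//.
  by rewrite /eps; case: ifP => // _; exact: prime_gt0.
have gm : g = lincomb m.
  by rewrite gE; apply: eq_bigr => i _; rewrite normalE scalerA zE mz.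
exists m => //; apply/andP; split; last by apply/asboolP; rewrite -gm.
apply/forallP => i; apply/implyP => /asboolP Nu; apply/eqP/val_inj.
by have := zlt i; rewrite /= mz /eps; case: asboolP => //; rewrite ltnS leqn0 => _ /eqP.
Qed.

Lemma AN_admissible : AN N P Fs pi = \sum_(m | admissible m) weight pi m.
Proof.
rewrite /AN (fsbigE [seq lincomb m | m <- enum [pred m | admissible m]]) /=.
- rewrite big_mkcond big_map -[RHS]big_enum /=; apply: eq_big_seq => m.
  rewrite mem_enum => am; rewrite ifT; last by rewrite inE; apply/GammaE; exists m.
  by apply: eq_bigr => i _; rewrite rhoF_admissible.
- by rewrite map_inj_uniq ?enum_uniq//; exact: lincomb_inj.
- move=> g /= /mapP[m]; rewrite mem_enum => am ->.
  by apply/GammaE; exists m.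
- move=> g /GammaE[m am ->] /negP[]; apply: map_f.
  by rewrite mem_enum.
Qed.

End OneLattice.
End GammaSums.

Section AnnihilatorSums.
Variables (R : realType) (n p r : nat).
Hypothesis pp : prime p.
Local Notation V := 'rV[R]_n.
Local Notation C := R[i].
Variables (L : set V) (u w : 'I_r -> V).
Hypothesis latL : is_lattice L.
Hypothesis uL : forall i, dual_lattice L (u i).
Hypothesis wL : forall i, L (w i).
Hypothesis wu : forall i j, dotp (w i) (u j) = (i == j)%:R.
Implicit Types (m : {ffun 'I_r -> 'F_p}) (S : 'M['F_p]_n).
Local Notation B := (lattice_basis L).
Local Notation weight := (@weight R p r).
Local Notation admissible := (@admissible R n p r u).
Local Notation coord := (@coordp R n p L).
Local Notation lincomb := (@lincomb R n p r u).

Let p0 : p%:R != 0 :> R. Proof. by rewrite pnatr_eq0 -lt0n prime_gt0. Qed.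
Let LB : L = lattice_of B. Proof. exact: (lattice_basisP latL).2. Qed.
Let rowB i : L (row i B).
Proof. by have := lattice_of_row B i; rewrite -LB. Qed.

Lemma coordpD x y : dual_lattice L x -> dual_lattice L y -> coord (x + y) = coord x + coord y.
Proof.
move=> Lx Ly; rewrite /coordp -modpD; congr modp; apply/rowP => i; rewrite !mxE.
by rewrite dotpDr floorDrz//; exact: Ly.
Qed.

Lemma coordp0 : coord 0 = 0.
Proof. by apply/rowP => i; rewrite !mxE dotp0r floor0. Qed.

Lemma coordpMn k x : dual_lattice L x -> coord (k%:R *: x) = k%:R *: coord x.
Proof.
move=> Lx; elim: k => [|k IH]; first by rewrite !scale0r coordp0.
by rewrite -!natr1 !scalerDl !scale1r coordpD ?IH//; exact: dual_latticeMn.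
Qed.

Definition residue m : 'rV['F_p]_n := \sum_i m i *: coord (u i).

Lemma coordp_lincomb m : coord (lincomb m) = residue m.
Proof.
have h : forall s : seq 'I_r, coord (\sum_(i <- s) (m i : nat)%:R *: u i) =
    \sum_(i <- s) m i *: coord (u i).
  elim=> [|i s IH]; first by rewrite !big_nil coordp0.
  rewrite !big_cons coordpD ?IH ?coordpMn ?natr_Zp//; first exact: dual_latticeMn.
  by apply: dual_sum => j; exact: dual_latticeMn.
exact: h.
Qed.

(** If all coordinates of the combination are divisible by [p], then it is [p] times a vector of the
    dual of [L]. Pairing with [w i] shows that [p] divides [m i], which is less than [p]. *)
Lemma residue_eq0 m : residue m = 0 -> m = [ffun=> 0].
Proof.
rewrite -coordp_lincomb => h; apply/ffunP => i; rewrite ffunE; apply: val_inj => /=.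
have Lg := dual_lincomb uL m.
have : dual_lattice L (p%:R^-1 *: lincomb m).
  rewrite {1}LB; apply/dual_lattice_ofP => j; rewrite dotpZr.
  have /rowP/(_ j)/eqP := h; rewrite !mxE int_Fp_eq0// => /dvdzP[k kE].
  rewrite -(floorK (Lg _ (rowB j))) kE intrM -pmulrn.
  by apply/intrP; exists k; rewrite mulrC mulfK.
move=> /(_ _ (wL i)); rewrite dotpZr dotp_lincomb// => /intrP[k kE].
have kp : (m i : nat)%:Z = k * p%:Z.
  apply: (@intr_inj R); rewrite intrM -kE -!pmulrn mulrAC mulVf// mul1r.
  by rewrite pmulrn.
have pm : (p %| m i)%N by have : (p %| (m i : nat)%:Z)%Z by [apply/dvdzP; exists k].
by apply/eqP; rewrite -leqn0 leqNgt; apply/negP => /dvdn_leq/(_ pm); rewrite leqNgt Fp_lt.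
Qed.

Lemma admissible_sublatticeE S m : admissible (sublattice L S) m =
  [forall i, (S *m (coord (u i))^T == 0) ==> (m i == 0)] && (S *m (residue m)^T == 0).
Proof.
have dE x : dual_lattice L x -> `[< dual_lattice (sublattice L S) x >] = (S *m (coord x)^T == 0).
  by move=> Lx; apply/asboolP/eqP => /(dual_sublatticeP pp latL S Lx).
rewrite /admissible dE ?coordp_lincomb//; last exact: dual_lincomb.
by congr (_ && _); apply: eq_forallb => i; rewrite dE.
Qed.

Lemma weight0 (pi : 'I_r -> nat) : weight pi [ffun=> 0] = \prod_i ccoef 1 (pi i).
Proof.
by apply: eq_bigr => i _; rewrite ffunE /= mul0r expi2pi0.
Qed.

Lemma sum_weight_all (pi : 'I_r -> nat) :
  \sum_(m : {ffun 'I_r -> 'F_p}) weight pi m =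
  p%:R ^+ (\sum_i pi i)%N * \prod_i ccoef 1 (pi i) :> C.
Proof.
rewrite -(bigA_distr_bigA (fun i (a : 'F_p) =>
  ccoef (expi2pi ((a : nat)%:R / p%:R : R)) (pi i))) /=.
under eq_bigr do rewrite sum_ccoef_Fp//.
by rewrite big_split /= -expr_sum.
Qed.

(* The coordinates [m i] with [u i] in the dual of the intermediate lattice are
   unconstrained on the left and zero on the right. *)
Lemma sum_weight_annihilated S (pi : 'I_r -> nat) :
  \sum_(m : {ffun 'I_r -> 'F_p} | S *m (residue m)^T == 0) weight pi m =
  (\prod_i (p %/ eps p (sublattice L S) (u i))%:R ^+ pi i) *
  \sum_(m | admissible (sublattice L S) m) weight pi m :> C.
Proof.
pose I i := S *m (coord (u i))^T == 0.
have epsE i : (p %/ eps p (sublattice L S) (u i))%N = if I i then p else 1%N.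
  rewrite /eps /I; case: asboolP => [/(dual_sublatticeP pp latL S (uL i)) ->|nd].
    by rewrite eqxx divn1.
  case: eqP => [/(dual_sublatticeP pp latL S (uL i))//|_].
  by rewrite divnn prime_gt0.
(* Clearing the coordinates in [I] changes the residue by a vector orthogonal to [S], so it maps the
   solutions onto the admissible ones. *)
pose h (m : {ffun 'I_r -> 'F_p}) : {ffun 'I_r -> 'F_p} :=
  [ffun i => if I i then 0 else m i].
have hres m : S *m (residue (h m))^T = S *m (residue m)^T.
  rewrite /residue !linear_sum /=; apply: eq_bigr => i _.
  rewrite ffunE; case: ifP => // /eqP Ii.
  by rewrite !linearZ /= Ii !scaler0.
rewrite (partition_big h (admissible (sublattice L S))) /=; last first.
  move=> m mS; rewrite admissible_sublatticeE hres mS andbT.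
  by apply/forallP => i; apply/implyP => Ii; rewrite ffunE /I Ii.
rewrite mulr_sumr; apply: eq_bigr => m' am'.
have [m'I m'S] : (forall i, I i -> m' i = 0) /\ S *m (residue m')^T = 0.
  move: am'; rewrite admissible_sublatticeE => /andP[/forallP h0 /eqP ->]; split => // i Ii.
  by have := h0 i; rewrite -/(I i) Ii => /eqP.
(* The fibre over [m'] is a product: the coordinates in [I] are free, the others fixed. Each free
   one contributes [p ^ pi i] by [sum_ccoef_Fp]. *)
transitivity (\prod_i \sum_(a : 'F_p | I i || (a == m' i))
    (ccoef (expi2pi ((a : nat)%:R / p%:R : R)) (pi i) : C)).
  rewrite bigA_distr_big_dep /=; apply: eq_bigl => m; apply/andP/familyP.
    move=> [_ /eqP <-] i; have : I i || (m i == h m i) by rewrite ffunE; case: ifP => //=.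
    exact.
  move=> fm; have hm : h m = m'.
    apply/ffunP => i; rewrite ffunE; have : I i || (m i == m' i) := fm i.
    by case: ifP => /= [/m'I ->//|_ /eqP].
  by rewrite -hres hm m'S !eqxx.
rewrite /weight -big_split /=; apply: eq_bigr => i _; rewrite epsE.
case: ifP => Ii /=; last by rewrite expr1n mul1r big_pred1_eq.
by rewrite sum_ccoef_Fp// m'I//= mul0r expi2pi0.
Qed.

End AnnihilatorSums.

(** * Comparison of the lattices *)

Lemma germ_scale (R : realType) m k (f : (nat -> R) -> R) c :
  germ m k f -> germ m k (fun e => f e * c).
Proof.
move=> gf s; have [Q pQ fQ] := gf s; exists (fun e => Q e * c); last first.
  by apply: lex_nearS fQ => e /= ->.
case: m pQ {gf} => [->|d pQ] /=; first by apply/funext => e; rewrite mul0r.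
by under [X in polyf _ X]eq_fun do rewrite mulrC; exact: polyfZ.
Qed.

Lemma cancel_scaling (F : fieldType) (A K X D Q : F) : Q != 0 ->
  A * (K * X * D) = K / Q * (Q * X * A) * D.
Proof. by move=> Q0; field. Qed.

Lemma collect_constant_term (F : fieldType) (N N1 G Q : F) :
  N * G + N1 * (Q * G - G) = (N + (Q - 1) * N1) * G.
Proof. by ring. Qed.

Section Comparison.
Local Notation conv := Defs.conv.
Variables (R : realType) (n p : nat).
Hypothesis pp : prime p.
Local Notation V := 'rV[R]_n.
Local Notation C := R[i].
Variables (vs : seq V) (L : set V).
Local Notation P := (conv vs).
Hypothesis latL : is_lattice L.
Hypothesis nsP : nonsingular L P.
Hypothesis P_thick : exists2 x, P x & exists2 y, P y & x != y.
Variables (r : nat) (Fs : 'I_r -> set V) (pi : 'I_r -> nat).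

Lemma dvol_eq0 : injective Fs -> (n < \sum_i pi i)%N -> dvol L P Fs pi = 0.
Proof.
move=> Fs_inj nl; apply: (dop_eq0 Fs_inj _ nl); rewrite /VolN; apply: germ_scale.
exact: vol_germ.
Qed.

Lemma dvol_sublattice (S : 'M['F_p]_n) : dvol (sublattice L S) P Fs pi =
  (p ^ \rank S)%:R * (\prod_i eps_inv vs L p (sublattice L S) (Fs i) ^+ pi i) *
  dvol L P Fs pi.
Proof.
set M := sublattice L S.
have bw : between p L M by exact: sublattice_between.
have K0 : (p ^ \rank S)%:R != 0 :> R by rewrite pnatr_eq0 -lt0n expn_gt0 prime_gt0.
have s0 F : eps_inv vs L p M F != 0 by exact: eps_inv_neq0.
rewrite /dvol -(dop_rescale s0)//; congr (dop _ _ _ _); apply/funext => h.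
rewrite /rescale /VolN (PNh_rescale latL nsP P_thick h pp bw).
by rewrite (vol_fund_domain_sublattice pp latL S) invfM [RHS]mulrCA mulVKf.
Qed.

Variables (v : V) (E : 'I_n -> set V) (b : 'I_n -> V) (W : 'M[R]_n) (jj : 'I_r -> 'I_n).
Hypothesis vP : vertex P v.
Hypothesis Wu : W \in unitmx.
Hypothesis LW : L = lattice_of W.
Hypothesis edgeE : forall i, edge P (E i) /\ E i = segment v (b i).
Hypothesis edge_at : forall E', edge P E' -> E' v -> exists i, E' = E i.
Hypothesis rowW : forall i, exists2 t : R, 0 < t & row i W = t *: (b i - v).
Hypothesis jj_inj : injective jj.
Hypothesis FsE : forall i, Fs i = dual_facet vs v W (jj i).

Let u i := dualvec W (jj i).
Let w i := row (jj i) W.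

Let uL i : dual_lattice L (u i).
Proof. by rewrite LW; exact: dual_lattice_dualvec. Qed.

Let wL i : L (w i). Proof. by rewrite LW; exact: lattice_of_row. Qed.

Let wu i j : dotp (w i) (u j) = (i == j)%:R.
Proof. by rewrite dotp_dualvec// (inj_eq jj_inj). Qed.

Let normalE N i : between p L N -> unormal N P (Fs i) = (eps p N (u i))%:R *: u i.
Proof.
rewrite FsE LW => bw.
exact: (unormal_dual_facet vP (@P_not_point _ _ _ P_thick v) Wu edgeE edge_at rowW pp bw).
Qed.

Let eps_self x : dual_lattice L x -> eps p L x = 1%N.
Proof. by rewrite /eps; case: asboolP. Qed.

(** All [u i] lie in the dual of [L], so 0 is the only admissible [m]: the set [Gamma] for [L]
    consists of 0. *)
Lemma AN_nonsingular : AN L P Fs pi = \prod_i ccoef 1 (pi i).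
Proof.
have bw := between_refl L p.
rewrite (AN_admissible pp wL wu pi bw (fun i => normalE i bw)).
rewrite -(weight0 R p pi) (big_pred1 [ffun=> 0])// => m.
rewrite /admissible asboolT ?andbT; last exact: dual_lincomb.
apply/forallP/eqP => [h|-> i]; last by rewrite ffunE eqxx implybT.
apply/ffunP => i; rewrite ffunE; have := h i.
by rewrite asboolT; [move=> /eqP|exact: uL].
Qed.

Lemma AN_dvol_sublattice (S : 'M['F_p]_n) l : (\sum_i pi i)%N = l ->
  AN (sublattice L S) P Fs pi * (dvol (sublattice L S) P Fs pi)%:C%C =
  p%:R ^+ \rank S / p%:R ^+ l *
  (\sum_(m : {ffun 'I_r -> 'F_p} | S *m (residue L u m)^T == 0) weight R pi m) *
  (dvol L P Fs pi)%:C%C.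
Proof.
move=> lE; set M := sublattice L S.
have bw : between p L M by exact: sublattice_between.
have pC : p%:R != 0 :> C by rewrite pnatr_eq0 -lt0n prime_gt0.
rewrite (AN_admissible pp wL wu pi bw (fun i => normalE i bw)).
rewrite (sum_weight_annihilated pp latL uL) -/M dvol_sublattice -/M.
(* The factors from the fibres are [p / eps], those from the derivative [1 / eps]; their ratio
   [p ^ l] does not depend on [S]. *)
have -> : \prod_i (p %/ eps p M (u i))%:R ^+ pi i =
    p%:R ^+ l * (\prod_i eps_inv vs L p M (Fs i) ^+ pi i)%:C%C.
  rewrite -lE expr_sum rmorph_prod -big_split; apply: eq_bigr => i _ /=.
  rewrite rmorphXn -exprMn; congr (_ ^+ _).
  rewrite /eps_inv (normalE _ (between_refl L p)) eps_self// scale1r fmorphV rmorph_nat.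
  rewrite /eps; case: ifP => _; first by rewrite divn1 invr1 mulr1.
  by rewrite divnn prime_gt0// divff.
rewrite !rmorphM /= rmorph_nat natrX; set A := \sum_(m | _) _.
by apply: cancel_scaling; rewrite expf_neq0.
Qed.

Lemma sum_AN_dvol k l (x : 'rV['F_p]_n) : x != 0 -> (\sum_i pi i)%N = l ->
  \sum_(S : 'M['F_p]_n | subspace_k k S)
    AN (sublattice L S) P Fs pi * (dvol (sublattice L S) P Fs pi)%:C%C =
  p%:R ^+ k / p%:R ^+ l *
  ((nb_subspaces p n k)%:R + (p%:R ^+ l - 1) * (nb_annihilated k x)%:R) *
  AN L P Fs pi * (dvol L P Fs pi)%:C%C.
Proof.
move=> x0 lE.
rewrite (eq_bigr (fun S : 'M['F_p]_n => p%:R ^+ k / p%:R ^+ l *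
  (\sum_(m : {ffun 'I_r -> 'F_p} | S *m (residue L u m)^T == 0) weight R pi m) *
  (dvol L P Fs pi)%:C%C)) => [|S /andP[_ /eqP rS]]; last first.
  by rewrite (AN_dvol_sublattice S lE) rS.
rewrite -mulr_suml -mulr_sumr -!mulrA; congr (_ * (_ * _)); rewrite !mulrA; congr (_ * _).
under eq_bigr do rewrite big_mkcond /=.
rewrite exchange_big /=.
have termE (m : {ffun 'I_r -> 'F_p}) :
    \sum_(S : 'M['F_p]_n | subspace_k k S)
      (if S *m (residue L u m)^T == 0 then weight R pi m else 0) =
    (nb_annihilated k (residue L u m))%:R * weight R pi m.
  rewrite /nb_annihilated natr_sum mulr_suml [RHS]big_mkcondr /=.
  by apply: eq_bigr => S _; case: ifP; rewrite ?mul1r ?mul0r.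
under eq_bigr do rewrite termE.
have W0 := weight0 R p pi.
have Wall := sum_weight_all R pp pi.
have res0 : residue L u ([ffun=> 0] : {ffun 'I_r -> 'F_p}) = 0.
  by rewrite /residue big1// => i _; rewrite ffunE scale0r.
move: W0 res0 Wall; set z : {ffun 'I_r -> 'F_p} := [ffun=> 0] => W0 res0.
rewrite (bigD1 z)//= W0 lE => Wall; rewrite (bigD1 z)//= W0 res0 nb_annihilated0.
(* For [m != 0] the residue is nonzero, so the count equals that for the reference vector [x]. The
   remaining weights add up to the total minus the term of 0. *)
rewrite (eq_bigr (fun m => (nb_annihilated k x)%:R * weight R pi m)).
  rewrite -mulr_sumr AN_nonsingular.
  have -> : \sum_(m | m != z) weight R pi m =
      p%:R ^+ l * (\prod_i ccoef 1 (pi i)) - \prod_i ccoef 1 (pi i) :> C.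
    by rewrite -Wall addrAC subrr add0r.
  exact: collect_constant_term.
move=> m m0; rewrite (nb_annihilated_eq k _ x0)//.
by apply: contra m0 => /eqP h; apply/eqP; exact: (residue_eq0 pp latL uL wL wu h).
Qed.

End Comparison.

Lemma polytope_thick (R : realType) n (L P : set 'rV[R]_n) : (0 < n)%N ->
  lattice_polytope L P -> exists2 x, P x & exists2 y, P y & x != y.
Proof.
move=> n0 [_ [x [e [e0 ball]]]].
pose y : 'rV[R]_n := x + const_mx (e / 2).
exists x; first by apply: ball => i; rewrite subrr normr0.
exists y.
  by apply: ball => i; rewrite !mxE addrAC subrr add0r gtr0_norm ?divr_gt0//; lra.
apply/eqP => /rowP/(_ (Ordinal n0)); rewrite !mxE; lra.
Qed.

(* L : lattice of rank n in V = R^n; P a nonsingular lattice polytope w.r.t. L;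
   f a face of P; Fs 0, ..., Fs (r-1) an enumeration of the facets of P
   containing f; pi (i) = pi(Fs i) > 0 with sum l. *)
Theorem theorem1p2 (R : realType) (n : nat) (L : set 'rV[R]_n) (p k : nat)
    (P f : set 'rV[R]_n) (r : nat) (Fs : 'I_r -> set 'rV[R]_n)
    (pi : 'I_r -> nat) (l : nat) :
  is_lattice L -> prime p -> (1 <= k <= n - 1)%N ->
  lattice_polytope L P -> nonsingular L P ->
  face P f ->
  injective Fs ->
  (forall i, facet P (Fs i) /\ f `<=` Fs i) ->
  (forall F, facet P F -> f `<=` F -> exists i, F = Fs i) ->
  (forall i, (0 < pi i)%N) -> (\sum_(i < r) pi i)%N = l ->
  \sum_(W : 'M['F_p]_n | subspace_k k W)
      AN (sublattice L W) P Fs pi * (dvol (sublattice L W) P Fs pi)%:C%C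
  = (nu n k (n - l) p)%:R * AN L P Fs pi * (dvol L P Fs pi)%:C%C.
Proof.
move=> latL pp /andP[k1 kn] polP nsP fP Fs_inj facetF _ _ lE.
have n0 : (0 < n)%N by lia.
have thick := polytope_thick n0 polP.
have [[vs [_ PE]] _] := polP; rewrite {}PE in nsP fP facetF thick *.
(* A vertex of [f] lies on every facet containing [f], so a single dual basis describes all the
   normals involved. *)
have [v [_ fv vP]] := face_vertex fP.
have [E [b [W [[Wu LW] hE hE' hW]]]] := vertex_frame latL nsP vP.
have npt := @P_not_point _ _ _ thick v.
have /boolp.choice[jj FsE] i : exists j, Fs i = dual_facet vs v W j.
  have [fF fsub] := facetF i.
  exact: (facet_at_vertex vP npt Wu hE hE' hW fF (fsub _ fv)).
have jj_inj : injective jj by move=> i j E'; apply: Fs_inj; rewrite !FsE E'.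
(* Any nonzero vector would serve as reference for the count. *)
pose x : 'rV['F_p]_n := const_mx 1.
have x0 : x != 0.
  by apply/eqP => /rowP/(_ (Ordinal n0))/eqP; rewrite !mxE oner_eq0.
rewrite (sum_AN_dvol pp latL nsP thick vP Wu LW hE hE' hW jj_inj FsE k x0 lE).
have [ln|nl] := leqP l n.
  congr (_ * _ * _); apply: subspace_count_identity => //; lia.
rewrite (dvol_eq0 latL nsP thick Fs_inj) ?lE//.
by rewrite rmorph0 !mulr0.
Qed.
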